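(* For each $c\in(0,1)$ let $R^*(c)$ denote the Bayes risk $R$ of the DGF policy with parameter $c$ (defined in the context). Then, as $c\to 0$, $$R^*(c)\;\sim\;\frac{-c\log c}{I^*(M,K)}\;\sim\;\inf_{\Gamma} R(\Gamma),$$ where the infimum is over all admissible policies $\Gamma$ (for the same cost $c$), and $a(c)\sim b(c)$ means $\lim_{c\to0}a(c)/b(c)=1$.
   Context: Model. Fix integers $M\ge 2$ and $1\le K\le M$. There are $M$ cells, exactly one of which contains a target. Hypothesis $H_m$ ($m=1,\dots,M$): the target is in cell $m$; its prior probability is $\pi_m\in(0,1)$, $\sum_m\pi_m=1$. Let $f,g$ be probability densities with respect to a common measure, with $0<D(g\|f)<\infty$ and $0<D(f\|g)<\infty$, where $D(p\|q)=\int p\log(p/q)$ is the Kullback–Leibler divergence; assume the log-likelihood ratio $\log(g(Y)/f(Y))$ has a finite moment generating function in a neighborhood of $0$ both when $Y\sim f$ and when $Y\sim g$. At each time $n=1,2,\dots$ a set $\phi(n)$ of $K$ distinct cells is selected and an observation $y_k(n)$ is obtained from every $k\in\phi(n)$. Under $H_m$ all observations are independent, $y_m(n)\sim g$ and $y_k(n)\sim f$ for $k\ne m$. An admissible policy $\Gamma=(\tau,\delta,\boldsymbol\phi)$ consists of a selection rule (each $\phi(n)$ is a deterministic or randomized function of past selections and observations), a stopping time $\tau$ with respect to the observation history, and a decision $\delta\in\{1,\dots,M\}$ made at time $\tau$. $\mathbf P_m,\mathbf E_m$ denote probability and expectation under $H_m$. Let $\alpha_m(\Gamma)=\mathbf P_m(\delta\neq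 m)$, $P_e(\Gamma)=\sum_m\pi_m\alpha_m(\Gamma)$. For a cost $c>0$ per time step, $R_m(\Gamma)=\alpha_m(\Gamma)+c\,\mathbf E_m(\tau)$ and the Bayes risk is $R(\Gamma)=\sum_m\pi_mR_m(\Gamma)=P_e(\Gamma)+c\sum_m\pi_m\mathbf E_m(\tau)$. Notation. $\ell_k(n)=\log\frac{g(y_k(n))}{f(y_k(n))}$; $\mathbf 1_k(n)=1$ if cell $k$ is observed at time $n$ and $0$ otherwise; $S_k(n)=\sum_{t=1}^n\ell_k(t)\mathbf 1_k(t)$. $m^{(i)}(n)$ is the index of the cell with the $i$-th largest value of $S_k(n)$ (ties broken arbitrarily), and $\Delta S(n)=S_{m^{(1)}(n)}(n)-S_{m^{(2)}(n)}(n)$. Rate. $I^*(M,K)=D(g\|f)+D(f\|g)$ if $K=M$, and $I^*(M,K)=\max\Big[\frac{K D(f\|g)}{M-1},\,D(g\|f)+\frac{(K-1)D(f\|g)}{M-1}\Big]$ if $K<M$. DGF policy with parameter $c\in(0,1)$: at each time $n$ (using the values $S_k(n-1)$ available before time $n$ to rank cells), select the cells $m^{(1)},\dots,m^{(K)}$ if $D(g\|f)\ge D(f\|g)/(M-1)$ or $K=M$, and the cells $m^{(2)},\dots,m^{(K+1)}$ if $D(g\|f)<D(f\|g)/(M-1)$ and $K<M$. Stop at $\tau=\inf\{n:\Delta S(n)\ge-\log c\}$ and declare $\delta=m^{(1)}(\tau)$. *)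

(* Defs.v *)
From HB Require Import structures.
From mathcomp Require Import all_boot all_order all_algebra.
From mathcomp Require Import all_classical all_reals all_analysis.
Set Implicit Arguments. Unset Strict Implicit. Unset Printing Implicit Defensive.
Import Order.TTheory GRing.Theory Num.Theory.
Import numFieldNormedType.Exports.
Local Open Scope classical_set_scope.
Local Open Scope ring_scope.

Definition KL (R : realType) (dY : measure_display) (Y : measurableType dY)
  (mu : {measure set Y -> \bar R}) (p q : Y -> R) : \bar R :=
  if `[< {ae mu, forall y, 0 < p y -> 0 < q y} >]
  then (\int[mu]_y (p y * ln (p y / q y))%:E)%E
  else +oo%E.

Definition Istar (R : realType) (M K : nat) (Dgf Dfg : R) : R :=
  if K == M then Dgf + Dfg
  else Num.max (K%:R * Dfg / (M.-1)%:R) (Dgf + (K.-1)%:R * Dfg / (M.-1)%:R).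

Section Model.
Variables (R : realType) (M : nat).
Variables (dY : measure_display) (Y : measurableType dY).
Variables (dO : measure_display) (Omega : measurableType dO).
Variables (dV : measure_display) (TV : measurableType dV).

(* Underlying probability model.  Z t k w is the value that cell k would
   produce at time t (only observed if k is selected at time t);
   V is an independent randomization variable available to the policy. *)
Variables (Z : nat -> 'I_M -> Omega -> Y) (V : Omega -> TV).

(* A policy: selection rule phi n (the set phi(n) selected at time n >= 1;
   phi 0 is irrelevant), stopping time tau (values in {1,2,...} or +oo),
   and decision delta. *)
Record policy := Policy {
  pol_phi : nat -> Omega -> {set 'I_M};
  pol_tau : Omega -> \bar R;
  pol_delta : Omega -> 'I_M }.

Definition hist_gen (phi : nat -> Omega -> {set 'I_M}) (n : nat) : set (set Omega) :=
  [set E | (exists A, measurable A /\ E = V @^-1` A)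
        \/ (exists s k, (1 <= s <= n)%N /\ E = [set w | k \in phi s w])
        \/ (exists s k B, (1 <= s <= n)%N /\ measurable B /\
               E = [set w | k \in phi s w /\ B (Z s k w)])].

Definition F (phi : nat -> Omega -> {set 'I_M}) (n : nat) : set (set Omega) :=
  <<s hist_gen phi n >>.

Definition admissible (K : nat) (p : policy) : Prop :=
  [/\ (forall n w, #|pol_phi p n w| = K),
      (forall n S, F (pol_phi p) n [set w | pol_phi p n.+1 w = S]),
      (forall w, pol_tau p w = +oo%E \/ exists n : nat, pol_tau p w = (n.+1)%:R%:E),
      (forall n : nat, F (pol_phi p) n [set w | pol_tau p w = n%:R%:E]) &
      (forall (n : nat) j, F (pol_phi p) n
             [set w | pol_tau p w = n%:R%:E /\ pol_delta p w = j])].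

Definition risk_m (P : 'I_M -> probability Omega R) (c : R) (p : policy)
  (m : 'I_M) : \bar R :=
  (P m [set w | (pol_tau p w < +oo)%E /\ pol_delta p w != m]
   + c%:E * \int[P m]_w pol_tau p w)%E.

Definition bayes_risk (P : 'I_M -> probability Omega R) (pi : 'I_M -> R)
  (c : R) (p : policy) : \bar R :=
  (\sum_(m < M) (pi m)%:E * risk_m P c p m)%E.

Definition inf_risk (P : 'I_M -> probability Omega R) (pi : 'I_M -> R)
  (K : nat) (c : R) : \bar R :=
  ereal_inf [set bayes_risk P pi c p | p in [set p | admissible K p]].

Definition Sstat (f g : Y -> R) (phi : nat -> Omega -> {set 'I_M})
  (n : nat) (k : 'I_M) (w : Omega) : R :=
  \sum_(1 <= t < n.+1)
     (if k \in phi t w then ln (g (Z t k w) / f (Z t k w)) else 0).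

Definition DeltaS (f g : Y -> R) (phi : nat -> Omega -> {set 'I_M})
  (n : nat) (w : Omega) : R :=
  let s := sort (fun x y : R => y <= x) [seq Sstat f g phi n k w | k <- enum 'I_M] in
  nth 0 s 0 - nth 0 s 1.

(* p is a DGF policy with parameter c (ties broken arbitrarily). *)
Definition is_DGF (K : nat) (Dgf Dfg : R) (f g : Y -> R) (c : R)
  (p : policy) : Prop :=
  let phi := pol_phi p in
  let S := Sstat f g phi in
  [/\ (forall (n : nat) w,
        if (Dgf >= Dfg / (M.-1)%:R) || (K == M) then
          (* phi(n+1) = {m^(1)(n), ..., m^(K)(n)} *)
          forall k k', k \in phi n.+1 w -> k' \notin phi n.+1 w ->
            S n k' w <= S n k w
        else
          (* phi(n+1) = {m^(2)(n), ..., m^(K+1)(n)} *)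
          exists m1, [/\ m1 \notin phi n.+1 w,
            (forall k, S n k w <= S n m1 w) &
            (forall k k', k \in phi n.+1 w -> k' \notin phi n.+1 w ->
               k' != m1 -> S n k' w <= S n k w)]),
      (forall w, pol_tau p w =
         ereal_inf [set (n%:R)%:E | n in
                    [set n : nat | (1 <= n)%N /\ - ln c <= DeltaS f g phi n w]]) &
      (forall w (n : nat), pol_tau p w = n%:R%:E ->
         forall k, S n k w <= S n (pol_delta p w) w)].

End Model.

(* Main.v *)
(* Write S_k for the accumulated log-likelihood ratio of cell k and suppose that
   the target is in cell m. For exponents s, the conditional expectation of
   exp (sum_k s_k S_k(n+1)) given the past is exp (sum_k s_k S_k(n)) times the
   product over the selected cells of moment generating functions, whose
   logarithms are s_k times the drift of S_k up to O(s_k^2). Everything is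
   deduced from such exponentials with small s.

   Upper bound: sum_{j <> m} exp (s (S_j - S_m)) must exceed c^s as long as the
   DGF policy has not stopped. Since the policy observes the largest S_j, it
   shrinks this potential at each step by a factor exp (- s I* + O(s^2)), except
   when the target cell is not ranked as in the long run; then some S_j >= S_m,
   and the potential is dominated by the one with a larger exponent, which decays
   faster. The error probability is at most M c by a change of measure.

   Lower bound: a policy of small risk has small error probabilities, so by a
   change of measure all differences S_m - S_j must be about - log c when it
   stops with the decision m. Their mean over j <> m grows at rate at most I*,
   whatever cells are selected, which an exponential moment turns into a lower
   bound on the stopping time. *)
Require Import Defs.
From HB Require Import structures.
From mathcomp Require Import all_boot all_order all_algebra.
From mathcomp Require Import all_classical all_reals all_analysis.
From mathcomp Require Import simple_functions measurable_realfun.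
From mathcomp Require Import ring lra.
Import Order.TTheory GRing.Theory Num.Theory.
Import numFieldNormedType.Exports.
Import HBNNSimple.
Local Open Scope classical_set_scope.
Local Open Scope ring_scope.

(** No law of large numbers is used: each bound is an inequality valid for all c below a threshold
    that depends only on the relative accuracy [eta]. In the lower bound this threshold is the same
    for all admissible policies, so the bound passes to the infimum. Conditional expectations are
    avoided as well: the one-step identities are identities between integrals, obtained by splitting
    over the finitely many values of the selected set. The obstacle in the upper bound is that the
    ranking may be wrong for a random stretch of time. The last such time is not estimated. With a
    small exponent s the required decay per step is only a factor 1 - O(s), while the potential of
    fixed exponent loses a constant factor; for s small its surplus pays for the badly ranked steps,
    and a weighted sum of both potentials decays at every step. Two families of sigma-algebras are
    needed: independence is used on the past of all cells, but the likelihood ratio is a function of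
    the observed cells and serves only on the history of the policy. *)

(** * Extension of integral identities and of densities *)

(** Simple functions and monotone convergence extend the identity from indicators to [h]. The two
    sides may live on different spaces because [step_now] uses it both to pass from past events to
    past-measurable functions and to replace an observation by the integral of its density. [C] is
    an extended real since it is there a product with an integral not known to be finite. *)
Lemma ge0_integral_comp_ext (R : realType) (d1 d2 d3 : measure_display)
    (T1 : measurableType d1) (T2 : measurableType d2) (Y : measurableType d3)
    (m1 : {measure set T1 -> \bar R}) (m2 : {measure set T2 -> \bar R})
    (Z1 : T1 -> Y) (Z2 : T2 -> Y) (X1 : T1 -> R) (X2 : T2 -> R) (C : \bar R) :
  measurable_fun setT Z1 -> measurable_fun setT Z2 ->
  measurable_fun setT X1 -> measurable_fun setT X2 ->
  (forall w, 0 <= X1 w) -> (forall w, 0 <= X2 w) -> (0 <= C)%E ->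
  (forall B, measurable B ->
    \int[m1]_w (X1 w * \1_B (Z1 w))%:E
    = C * \int[m2]_w (X2 w * \1_B (Z2 w))%:E)%E ->
  forall h : Y -> R, measurable_fun setT h -> (forall y, 0 <= h y) ->
  (\int[m1]_w (X1 w * h (Z1 w))%:E = C * \int[m2]_w (X2 w * h (Z2 w))%:E)%E.
Proof.
move=> mZ1 mZ2 mX1 mX2 X10 X20 C0 HB h mh h0.
have meh : measurable_fun setT (fun y => (h y)%:E) by exact/measurable_EFinP.
pose s_ := nnsfun_approx measurableT meh.
have mXs (d : measure_display) (T : measurableType d) (Z : T -> Y) (X : T -> R) :
    measurable_fun setT Z -> measurable_fun setT X ->
    forall s : Y -> R, measurable_fun setT s ->
    measurable_fun setT (fun w => (X w * s (Z w))%:E).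
  move=> mZ mX s ms; apply/measurable_EFinP/measurable_funM => //.
  exact: (measurableT_comp ms).
have H0 (d : measure_display) (T : measurableType d) (m : {measure set T -> \bar R})
    (Z : T -> Y) (X : T -> R) : measurable_fun setT Z -> measurable_fun setT X ->
    (forall w, 0 <= X w) -> forall s : {nnsfun Y >-> R},
    (\int[m]_w (X w * s (Z w))%:E = \sum_(r \in range s)
      `|r|%:E * \int[m]_w (X w * \1_(s @^-1` [set r]) (Z w))%:E)%E.
  move=> mZ mX X0 s.
  transitivity (\int[m]_w (\sum_(r \in range s)
     `|r|%:E * (X w * \1_(s @^-1` [set r]) (Z w))%:E))%E.
    apply: eq_integral => w _.
    rewrite fimfunE fsbig_finite//= mulr_sumr -sumEFin fsbig_finite//=.
    apply: eq_big_seq => r; rewrite in_fset_set// inE => -[y _ <-].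
    by rewrite ger0_norm// -EFinM mulrCA.
  have mXsr r : measurable_fun setT (fun w => (X w * \1_(s @^-1` [set r]) (Z w))%:E).
    exact: mXs.
  rewrite ge0_integral_fsum//; last 2 first.
  - by move=> r; apply: measurable_funeM.
  - by move=> r w _; rewrite -EFinM lee_fin !mulr_ge0.
  apply: eq_fsbigr => r _; rewrite ge0_integralZl//.
  by move=> w _; rewrite lee_fin mulr_ge0.
have Hs n : (\int[m1]_w (X1 w * s_ n (Z1 w))%:E =
    C * \int[m2]_w (X2 w * s_ n (Z2 w))%:E)%E.
  rewrite !H0// ge0_mule_fsumr; last first.
    move=> r; apply: mule_ge0; rewrite ?lee_fin//.
    by apply: integral_ge0 => w _; rewrite lee_fin mulr_ge0.
  by apply: eq_fsbigr => r _; rewrite HB// muleCA.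
have Hc (d : measure_display) (T : measurableType d) (m : {measure set T -> \bar R})
    (Z : T -> Y) (X : T -> R) : measurable_fun setT Z -> measurable_fun setT X ->
    (forall w, 0 <= X w) ->
    ((fun n => \int[m]_w (X w * s_ n (Z w))%:E) @ \oo -->
     \int[m]_w (X w * h (Z w))%:E)%E.
  move=> mZ mX X0.
  have cv w : (fun n => (X w * s_ n (Z w))%:E) @ \oo --> (X w * h (Z w))%:E.
    under eq_fun do rewrite EFinM.
    rewrite EFinM; apply: cvgeZl => //.
    by apply: (@cvg_nnsfun_approx _ _ _ _ measurableT _ meh) => // y _; rewrite lee_fin.
  have -> : (\int[m]_w (X w * h (Z w))%:E =
             \int[m]_w limn (fun n => (X w * s_ n (Z w))%:E))%E.
    by apply: eq_integral => w _; apply/esym/cvg_lim.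
  apply: cvg_monotone_convergence => //.
  - by move=> n; apply: mXs.
  - by move=> n w _; rewrite lee_fin mulr_ge0.
  - move=> w _ i j ij; rewrite lee_fin ler_wpM2l//.
    exact/lefP/nd_nnsfun_approx.
apply: (cvg_unique _ (Hc _ _ m1 _ _ mZ1 mX1 X10)) => //.
rewrite (funext Hs).
have Cv := Hc _ _ m2 _ _ mZ2 mX2 X20.
(* For [C] infinite, either the limit integral vanishes, and with it all approximations, or some
   approximation is already positive and the products are eventually infinite. *)
have [Cfin|] := boolP (C \is a fin_num); first exact: cvgeZl.
rewrite ge0_fin_numE// -leNgt leye_eq => /eqP ->.
have I0 n : (0 <= \int[m2]_w (X2 w * s_ n (Z2 w))%:E)%E.
  by apply: integral_ge0 => w _; rewrite lee_fin mulr_ge0.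
have nd : nondecreasing_seq (fun n => \int[m2]_w (X2 w * s_ n (Z2 w))%:E)%E.
  move=> i j ij; apply: ge0_le_integral => //.
  - by move=> w _; rewrite lee_fin mulr_ge0.
  - exact: mXs.
  - exact: mXs.
  - by move=> w _; rewrite lee_fin ler_wpM2l//; exact/lefP/nd_nnsfun_approx.
have Ile n : (\int[m2]_w (X2 w * s_ n (Z2 w))%:E <= \int[m2]_w (X2 w * h (Z2 w))%:E)%E.
  rewrite -(cvg_lim _ Cv)//; apply: lime_ge; first by apply/cvg_ex; eexists; exact: Cv.
  by exists n => // k /= nk; exact: nd.
have [I2_0|I2_0] := eqVneq (\int[m2]_w (X2 w * h (Z2 w))%:E)%E 0%E.
  rewrite I2_0 mule0; apply: cvg_near_cst; apply: nearW => n.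
  have := Ile n; rewrite I2_0 => le0.
  have -> : (\int[m2]_w (X2 w * s_ n (Z2 w))%:E = 0)%E by apply: le_anti; rewrite le0 I0.
  by rewrite mule0.
have I2pos : (0 < \int[m2]_w (X2 w * h (Z2 w))%:E)%E.
  rewrite lt0e I2_0 /=; apply: integral_ge0 => w _; rewrite lee_fin mulr_ge0//.
rewrite gt0_mulye//.
have [n0 In0] : exists n, (0 < \int[m2]_w (X2 w * s_ n (Z2 w))%:E)%E.
  apply: contrapT => /forallNP N; move: I2_0; apply/negP/negPn/eqP.
  apply: (cvg_unique _ Cv) => //; apply: cvg_near_cst; apply: nearW => n.
  by have /negP := N n; rewrite -leNgt => le0; apply: le_anti; rewrite le0 I0.
apply: cvg_near_cst; exists n0 => // n /= n0n.
by rewrite gt0_mulye// (lt_le_trans In0)// nd.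
Qed.
(** A pi-lambda argument. Stability under complement needs [D] to have total mass 1 under [P2],
    which is the case [setT] of the hypothesis. *)
Lemma density_of_pi_system (R : realType) (d : measure_display)
    (T : measurableType d) (P1 P2 : probability T R) (D : T -> R) (G : set (set T)) :
  measurable_fun setT D -> (forall w, 0 <= D w) ->
  setI_closed G -> G `<=` measurable -> G setT ->
  (forall A, G A -> P1 A = \int[P2]_w (\1_A w * D w)%:E)%E ->
  forall A, <<s G >> A -> (P1 A = \int[P2]_w (\1_A w * D w)%:E)%E.
Proof.
move=> mD D0 GI Gm GT GE.
have mDA A : measurable A -> measurable_fun setT (fun w => (\1_A w * D w)%:E).
  by move=> mA; apply/measurable_EFinP/measurable_funM.
have DA A : measurable A ->
    (\int[P2]_w (\1_A w * D w)%:E = \int[P2]_(w in A) (D w)%:E)%E.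
  move=> mA; rewrite [RHS]integral_mkcond; apply: eq_integral => w _.
  by rewrite patchE indicE; case: (w \in A); rewrite ?mul1r ?mul0r.
suff : <<s G >> `<=` [set A | measurable A /\ (P1 A = \int[P2]_w (\1_A w * D w)%:E)%E].
  by move=> H A /H[].
apply: lambda_system_subset => //; last by move=> A GA; split; [exact: Gm|exact: GE].
apply/dynkin_lambda_system; split.
- by split=> //; exact: GE.
- move=> A [mA PA]; split; first exact: measurableC.
  have eT : (\int[P2]_w (\1_A w * D w)%:E + \int[P2]_w (\1_(~` A) w * D w)%:E = 1)%E.
    rewrite -ge0_integralD//; last first.
    - by apply: mDA; exact: measurableC.
    - by move=> w _; rewrite lee_fin mulr_ge0.
    - exact: mDA.
    - by move=> w _; rewrite lee_fin mulr_ge0.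
    rewrite -(@probability_setT _ _ _ P1) GE//; apply: eq_integral => w _.
    rewrite -EFinD -mulrDl !indicE in_setC in_setT.
    by case: (w \in A); rewrite ?addr0 ?add0r.
  rewrite probability_setC// PA -[X in (X - _)%E]eT addeAC subee ?add0e//.
  by rewrite -PA; exact: fin_num_measure.
- move=> F tF mF; split; first by apply: bigcupT_measurable => k; have [] := mF k.
  have mFk k : measurable (F k) by have [] := mF k.
  rewrite measure_semi_bigcup//; last exact: bigcupT_measurable.
  rewrite DA; last exact: bigcupT_measurable.
  rewrite ge0_integral_bigcup//; last first.
    by move=> w _; rewrite lee_fin.
    by apply: measurable_funTS; exact/measurable_EFinP.
  by apply: eq_eseriesr => k _; rewrite -DA//; have [] := mF k.
Qed.

(** * Second-order bounds for exponential moments *)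

Lemma expR_le_taylor2 (R : realType) (x : R) : expR x <= 1 + x + x ^+ 2 * expR `|x|.
Proof.
have H1 : 1 + x <= expR x := expR_ge1Dx x.
have H2 : expR x - 1 <= x * expR x.
  have : 1 - x <= expR (- x) by exact: expR_ge1Dx.
  have e0 := expR_gt0 x.
  rewrite -(ler_pM2r e0) -expRD addNr expR0 mulrBl mul1r => H.
  by rewrite lerBlDr -lerBlDl.
have H3 : expR x - 1 - x <= x * (expR x - 1) by rewrite mulrBr mulr1; lra.
suff : x * (expR x - 1) <= x ^+ 2 * expR `|x| by lra.
rewrite expr2 -mulrA; have [x0|x0] := leP 0 x.
  by rewrite ger0_norm// ler_wpM2l.
rewrite ler_wnM2l//; first exact: ltW.
have e1 : 1 <= expR `|x| by rewrite -[leLHS]expR0 ler_expR.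
have : x * expR `|x| <= x * 1 by rewrite ler_wnM2l// ltW.
lra.
Qed.

(** The remainder carries l^2 exp (r |l|). Since (r |l|)^2 / 2 <= exp (r |l|), it is at most 2 / r^2
    times exp (2 r |l|), which the two exponentials on the right dominate; these can be integrated
    when 2 r is in the domain of the moment generating function. *)
Lemma expR_le_taylor2_exp (R : realType) (r s l : R) : 0 < r -> `|s| <= r ->
  expR (s * l) <= 1 + s * l + s ^+ 2 *
    (2 / r ^+ 2 * (expR (2 * r * l) + expR (- (2 * r) * l))).
Proof.
move=> r0 sr.
apply: (le_trans (expR_le_taylor2 _ (s * l))); rewrite lerD2l exprMn -(mulrA (s ^+ 2)).
rewrite ler_wpM2l ?sqr_ge0//.
have t0 : 0 <= r * `|l| by rewrite mulr_ge0// ltW.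
have H1 : expR `|s * l| <= expR (r * `|l|).
  by rewrite ler_expR normrM ler_wpM2r.
have H2 : l ^+ 2 <= 2 / r ^+ 2 * expR (r * `|l|).
  have := expR_ge1Dxn 1 t0; rewrite (_ : 2`! = 2)%N// exprMn real_normK ?num_real// => H.
  rewrite -(ler_pM2l (_ : 0 < r ^+ 2 / 2)) ?divr_gt0 ?exprn_gt0//.
  set E := expR _ in H *.
  by rewrite (_ : r ^+ 2 / 2 * (2 / r ^+ 2 * E) = E); [lra|field; rewrite gt_eqF].
have H3 : expR (r * `|l|) * expR (r * `|l|) <= expR (2 * r * l) + expR (- (2 * r) * l).
  rewrite -expRD; have [l0|l0] := leP 0 l.
    by rewrite ger0_norm// (_ : r * l + r * l = 2 * r * l) ?lerDl ?expR_ge0//; ring.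
  by rewrite ltr0_norm// (_ : r * - l + r * - l = - (2 * r) * l) ?lerDr ?expR_ge0//; ring.
have e0 := expR_ge0 (r * `|l|).
apply: (le_trans (ler_pM _ _ H2 H1)); rewrite ?sqr_ge0 ?expR_ge0//.
by rewrite -(mulrA (2 / r ^+ 2)) ler_wpM2l// divr_ge0// sqr_ge0.
Qed.

Lemma mgf_le_taylor2 (R : realType) (d : measure_display) (Y : measurableType d)
    (mu : {measure set Y -> \bar R}) (p L : Y -> R) (e : R) :
  measurable_fun setT p -> measurable_fun setT L -> (forall y, 0 <= p y) ->
  (\int[mu]_y (p y)%:E = 1)%E -> 0 < e ->
  (forall s : R, `|s| < e -> (\int[mu]_y (p y * expR (s * L y))%:E < +oo)%E) ->
  exists2 C, 0 <= C & forall s, `|s| <= e / 4 ->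
    (\int[mu]_y (p y * expR (s * L y))%:E <=
     (1 + s * fine (\int[mu]_y (p y * L y)%:E)%E + C * s ^+ 2)%:E)%E.
Proof.
move=> mp mL p0 p1 e0 mgf.
pose I s y := p y * expR (s * L y).
have I0 s y : 0 <= I s y by rewrite mulr_ge0 ?expR_ge0.
have mI s : measurable_fun setT (I s).
  apply: measurable_funM => //; apply: (measurableT_comp (@measurable_expR R)).
  exact: measurable_funM.
have iI s : `|s| < e -> mu.-integrable setT (EFin \o I s).
  move=> se; apply/integrableP; split; first exact/measurable_EFinP.
  by under eq_integral do rewrite /= ger0_norm//; exact: mgf.
have ip : mu.-integrable setT (EFin \o p).
  apply/integrableP; split; first exact/measurable_EFinP.
  by under eq_integral do rewrite /= ger0_norm//; rewrite p1 ltry.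
(* The exponents 2 r and - 2 r that dominate the remainder then stay inside the interval where the
   moment generating function is finite. *)
pose r := e / 4.
have r0 : 0 < r by rewrite divr_gt0.
have e2 : `|2 * r| < e by rewrite gtr0_norm ?mulr_gt0// /r; lra.
have e2' : `|- (2 * r)| < e by rewrite normrN.
pose pL y := p y * L y.
pose IJ y := I (2 * r) y + I (- (2 * r)) y.
have ipL : mu.-integrable setT (EFin \o pL).
  apply: (le_integrable measurableT (g := EFin \o (fun y => (2 * r)^-1 * (I (2 * r) y + I (- (2 * r)) y)))).
  - by apply/measurable_EFinP; exact: measurable_funM.
  - move=> y _ /=; rewrite lee_fin [leRHS]ger0_norm; last first.
      by rewrite mulr_ge0 ?addr_ge0// invr_ge0 mulr_ge0// ltW.
    rewrite normrM ger0_norm// /I -mulrDr mulrCA ler_wpM2l//.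
    rewrite [leRHS]mulrC ler_pdivlMr ?mulr_gt0// mulrC.
    have x1 := expR_ge1Dx (2 * r * L y); have x2 := expR_ge1Dx (- (2 * r) * L y).
    have y1 := expR_ge0 (2 * r * L y); have y2 := expR_ge0 (- (2 * r) * L y).
    by rewrite -[X in X * `|_|](@gtr0_norm _ (2 * r)) ?mulr_gt0// -normrM ler_norml; lra.
  - rewrite (_ : _ \o _ = (fun y => ((2 * r)%R^-1)%:E * (((EFin \o I (2 * r)%R) \+ (EFin \o I (- (2 * r))%R)) y)%E)%E)//.
    by apply: integrableZl => //; apply: integrableD => //; exact: iI.
pose K := 2 / r ^+ 2.
have K0 : 0 <= K by rewrite divr_ge0// sqr_ge0.
pose J := fine (\int[mu]_y (I (2 * r) y + I (- (2 * r)) y)%:E)%E.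
have iJ : mu.-integrable setT (EFin \o IJ).
  by rewrite (_ : _ \o _ = ((EFin \o I (2 * r)%R) \+ (EFin \o I (- (2 * r))%R))%E)//;
     apply: integrableD => //; exact: iI.
exists (K * J).
  by rewrite mulr_ge0// fine_ge0// integral_ge0// => y _; rewrite lee_fin addr_ge0.
move=> s sr.
have -> : ((1 + s * fine (\int[mu]_y (p y * L y)%:E)%E + K * J * s ^+ 2)%R%:E =
  \int[mu]_y ((EFin \o p) y + s%:E * (EFin \o pL) y +
   (s ^+ 2 * K)%R%:E * (EFin \o IJ) y))%E.
  rewrite integralD//; last 2 first.
  - by apply: integrableD => //; exact: integrableZl.
  - exact: integrableZl.
  rewrite integralD//; last exact: integrableZl.
  rewrite !integralZl// p1.
  rewrite -[in RHS](fineK (integrable_fin_num measurableT ipL)).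
  rewrite -[X in (_ + _ * X)%E](fineK (integrable_fin_num measurableT iJ)).
  by rewrite -/J -!EFinM -!EFinD; congr (_%:E); rewrite [s ^+ 2 * K]mulrC mulrAC.
apply: le_integral => //.
- by apply: iI; rewrite (le_lt_trans sr)//; lra.
- apply: integrableD => //; last exact: integrableZl.
  by apply: integrableD => //; exact: integrableZl.
- move=> y _ /=; rewrite -!EFinM -!EFinD lee_fin.
  have := expR_le_taylor2_exp _ r s (L y) r0 sr.
  move=> /(ler_wpM2l (p0 y)) /le_trans; apply.
  by rewrite le_eqVlt; apply/orP; left; apply/eqP; rewrite /IJ /pL /I -/K; ring.
Qed.

(** * Potentials of a ranking of the cells *)

Section Potential.
Variables (R : realType) (M : nat) (m : 'I_M) (S : 'I_M -> R) (sel : {set 'I_M}).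

(** When [S] is the vector of accumulated log-likelihood ratios, this is the power s of the
    likelihood ratio of hypothesis [j] to hypothesis [m]. *)
Definition wt (s : R) (j : 'I_M) : R := expR (s * (S j - S m)).

Definition pot1 (s : R) : R := \sum_(j | j != m) wt s j.

(* If the top-ranked cell is neither the target nor observed, [pot1] need not
   decrease; this potential of pairs does, and it dominates [pot1] there. *)
Definition pot2 (s : R) : R :=
  \sum_(i | i != m) \sum_(j | (j != m) && (j != i)) wt s i * wt s j.

Definition drift (c : R) (j : 'I_M) : R := if j \in sel then c else 1.

(** [u] and [v] are the one-step factors of an observed empty cell and of the observed target; with
    the moment generating functions put in, this is the conditional expectation of the next [pot1].
    In [pot2_next] the target occurs in both weights of a pair, so [v] is there taken at the
    exponent - 2 s. *)
Definition pot1_next (s u v : R) : R :=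
  \sum_(j | j != m) wt s j * (drift u j * drift v m).

Definition pot2_next (s u v : R) : R :=
  \sum_(i | i != m) \sum_(j | (j != m) && (j != i))
     wt s i * wt s j * (drift u i * drift u j * drift v m).

Lemma wt_ge0 s j : 0 <= wt s j. Proof. exact: expR_ge0. Qed.

Lemma pot1_ge0 s : 0 <= pot1 s.
Proof. by apply: sumr_ge0 => j _; exact: wt_ge0. Qed.

Lemma pot2_ge0 s : 0 <= pot2 s.
Proof.
by apply: sumr_ge0 => i _; apply: sumr_ge0 => j _; rewrite mulr_ge0 ?wt_ge0.
Qed.

Lemma drift_le1 c j : c <= 1 -> drift c j <= 1.
Proof. by rewrite /drift; case: ifP. Qed.

Lemma drift_ge0 c j : 0 <= c -> 0 <= drift c j.
Proof. by rewrite /drift; case: ifP. Qed.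

Lemma pot1_next_le s u v : 0 <= u <= 1 -> 0 <= v ->
  pot1_next s u v <= drift v m * pot1 s.
Proof.
move=> /andP[u0 u1] v0; rewrite mulr_sumr; apply: ler_sum => j _.
rewrite mulrA [leRHS]mulrC ler_wpM2r ?drift_ge0//.
by rewrite ler_piMr ?wt_ge0 ?drift_le1.
Qed.

Lemma wt_mono s i j : 0 <= s -> S i <= S j -> wt s i <= wt s j.
Proof. by move=> s0 ij; rewrite ler_expR ler_wpM2l// lerD2r. Qed.

(** Once the common part over [A] is removed, both sides are sums over the pairs formed by an
    element of [A] and one of [T] outside [A], compared term by term. *)
Lemma sum_top_ge (T A : {set 'I_M}) (x : 'I_M -> R) : A \subset T ->
  (forall i j, i \in A -> j \in T -> j \notin A -> x j <= x i) ->
  #|A|%:R * \sum_(j in T) x j <= #|T|%:R * \sum_(i in A) x i.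
Proof.
move=> AT dom.
rewrite (big_setID A)/= (finset.setIidPr AT).
rewrite -(cardsID A T) (finset.setIidPr AT) natrD mulrDl mulrDr lerD2l.
have E (B : {set 'I_M}) (y : R) : #|B|%:R * y = \sum_(i in B) y.
  by rewrite mulr_natl sumr_const.
rewrite !E (eq_bigr (fun i => \sum_(j in T :\: A) x j))//.
rewrite [leRHS](eq_bigr (fun j => \sum_(i in A) x i))//.
rewrite [leRHS]exchange_big/=; apply: ler_sum => i iA; apply: ler_sum => j.
by rewrite inE => /andP[jA jT]; exact: dom.
Qed.

Hypothesis M2 : (2 <= M)%N.

Lemma M1_gt0 : 0 < (M.-1)%:R :> R.
Proof. by rewrite ltr0n; case: M M2 => [|[]]. Qed.

Definition share : R := #|sel :\ m|%:R / (M.-1)%:R.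

(** The observed empty cells have the largest weights among the empty ones, so they carry at least
    the fraction [share] of [pot1], and that part is multiplied by [u]. *)
Lemma pot1_next_dominated s u v : 0 <= s -> 0 <= u <= 1 -> 0 <= v ->
  (forall i j, i \in sel -> j \notin sel -> i != m -> j != m -> S j <= S i) ->
  pot1_next s u v <= (1 - (1 - u) * share) * drift v m * pot1 s.
Proof.
move=> s0 /andP[u0 u1] v0 dom.
have -> : pot1_next s u v = drift v m * \sum_(j | j != m) wt s j * drift u j.
  by rewrite mulr_sumr; apply: eq_bigr => j _; ring.
rewrite [_ * drift v m]mulrC -mulrA ler_wpM2l ?drift_ge0//.
have E : \sum_(j | j != m) wt s j * drift u j =
    pot1 s - (1 - u) * \sum_(j in sel :\ m) wt s j.
  rewrite mulr_sumr /pot1 (bigID (mem sel))/= [in RHS](bigID (mem sel))/=.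
  have eS F : \sum_(i in sel :\ m) F i = \sum_(i | (i != m) && (i \in sel)) F i :> R.
    by apply: eq_bigl => i; rewrite !inE.
  rewrite eS addrAC -sumrB; congr (_ + _).
    by apply: eq_bigr => j /andP[_ js]; rewrite /drift js; ring.
  by apply: eq_bigr => j /andP[_ /negbTE js]; rewrite /drift js mulr1.
rewrite E [leRHS]mulrBl mul1r lerD2l lerN2 -mulrA ler_wpM2l ?subr_ge0//.
have -> : pot1 s = \sum_(j in [set~ m]%SET) wt s j by apply: eq_bigl => j; rewrite !inE.
have card : #|[set~ m]%SET| = M.-1 by rewrite cardsC1 card_ord.
rewrite /share mulrAC ler_pdivrMr ?M1_gt0// [leRHS]mulrC -card.
apply: sum_top_ge.
  by apply/fintype.subsetP => j; rewrite !inE => /andP[].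
move=> i j; rewrite !inE => /andP[im isel] jm; rewrite jm/= => jsel.
by apply: wt_mono => //; exact: dom.
Qed.

Lemma wt2_le_pot2 s i j : i != m -> j != m -> j != i -> wt s i * wt s j <= pot2 s.
Proof.
move=> im jm ji; rewrite /pot2 (bigD1 i)//= (bigD1 j)/=; last by rewrite jm.
rewrite -addrA lerDl addr_ge0//.
  by apply: sumr_ge0 => k _; rewrite mulr_ge0 ?wt_ge0.
by apply: sumr_ge0 => k _; apply: sumr_ge0 => l _; rewrite mulr_ge0 ?wt_ge0.
Qed.

Lemma sum_le_M (Q : pred 'I_M) (x : 'I_M -> R) (c : R) : 0 <= c ->
  (forall i, Q i -> x i <= c) -> \sum_(i | Q i) x i <= M%:R * c.
Proof.
move=> c0 H; apply: (@le_trans _ _ (\sum_(i | Q i) c)); first exact: ler_sum.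
rewrite big_mkcond/=; apply: (@le_trans _ _ (\sum_(i < M) c)).
  by apply: ler_sum => i _; case: ifP.
by rewrite sumr_const card_ord mulr_natl.
Qed.

(* Each pair of unobserved cells is dominated by a pair with one observed
   cell, so pairs meeting [sel] carry a fixed fraction of [pot2]. *)
Lemma pot2_next_le s u v m1 : 0 <= s -> 0 <= u <= 1 -> 0 <= v <= 1 ->
  (m \notin sel -> (exists k, k \in sel) /\
    (forall i j, i \in sel -> j \notin sel -> j != m1 -> S j <= S i)) ->
  pot2_next s u v <= Num.max v (1 - (1 - u) / (M%:R ^+ 2)) * pot2 s.
Proof.
move=> s0 /andP[u0 u1] /andP[v0 v1] H.
have [msel|msel] := boolP (m \in sel).
  apply: (@le_trans _ _ (v * pot2 s)); last first.
    by rewrite ler_wpM2r ?pot2_ge0// le_max lexx.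
  rewrite /pot2_next /pot2 mulr_sumr; apply: ler_sum => i _.
  rewrite mulr_sumr; apply: ler_sum => j _.
  rewrite [leRHS]mulrC ler_wpM2l ?mulr_ge0 ?wt_ge0// {3}/drift msel.
  rewrite -[leRHS]mul1r ler_wpM2r// -[leRHS]mulr1.
  by rewrite ler_pM ?drift_ge0 ?drift_le1.
have {H}[[k0 k0sel] dom] := H msel.
have k0m : k0 != m by apply: contraNneq msel => <-.
apply: (@le_trans _ _ ((1 - (1 - u) / (M%:R ^+ 2)) * pot2 s)); last first.
  by rewrite ler_wpM2r ?pot2_ge0// le_max lexx orbT.
pose meet i j := (i \in sel) || (j \in sel).
pose W := \sum_(i | i != m) \sum_(j | (j != m) && (j != i))
   (if meet i j then wt s i * wt s j else 0).
have W0 : 0 <= W.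
  apply: sumr_ge0 => i _; apply: sumr_ge0 => j _; case: ifP => // _.
  by rewrite mulr_ge0 ?wt_ge0.
have leW i j : i != m -> j != m -> j != i -> meet i j -> wt s i * wt s j <= W.
  move=> im jm ji mij; rewrite /W (bigD1 i)//= (bigD1 j)/=; last by rewrite jm.
  rewrite mij -addrA lerDl addr_ge0//.
    by apply: sumr_ge0 => k _; case: ifP => // _; rewrite mulr_ge0 ?wt_ge0.
  apply: sumr_ge0 => k _; apply: sumr_ge0 => l _; case: ifP => // _.
  by rewrite mulr_ge0 ?wt_ge0.
(* At most one cell of an unobserved pair is [m1]; a cell other than [m1] is dominated by [k0], and
   replacing it by [k0] gives a pair counted in [W]. *)
have allW i j : i != m -> j != m -> j != i -> wt s i * wt s j <= W.
  move=> im jm ji; have [mij|] := boolP (meet i j); first exact: leW.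
  rewrite negb_or => /andP[isel jsel].
  have ik0 : i != k0 by apply: contraNneq isel => ->.
  have jk0 : j != k0 by apply: contraNneq jsel => ->.
  have [im1|im1] := eqVneq i m1.
    have jm1 : j != m1 by rewrite -im1.
    apply: (@le_trans _ _ (wt s i * wt s k0)).
      by rewrite ler_wpM2l ?wt_ge0//; apply: wt_mono => //; exact: dom.
    by apply: leW => //; rewrite 1?eq_sym// /meet k0sel orbT.
  apply: (@le_trans _ _ (wt s k0 * wt s j)).
    by rewrite ler_wpM2r ?wt_ge0//; apply: wt_mono => //; exact: dom.
  by apply: leW => //; rewrite /meet k0sel.
have potW : pot2 s <= M%:R ^+ 2 * W.
  rewrite expr2 -mulrA; apply: sum_le_M; first by rewrite mulr_ge0.
  by move=> i im; apply: sum_le_M => // j /andP[jm ji]; exact: allW.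
have nextW : pot2_next s u v <= pot2 s - (1 - u) * W.
  rewrite /pot2_next /pot2 /W mulr_sumr -sumrB; apply: ler_sum => i _.
  rewrite mulr_sumr -sumrB; apply: ler_sum => j _.
  rewrite {3}/drift (negbTE msel) mulr1 /meet.
  set x := wt s i * wt s j.
  have x0 : 0 <= x by rewrite mulr_ge0 ?wt_ge0.
  have uu : u * u <= u by rewrite ler_piMr.
  rewrite /drift; case: (i \in sel); case: (j \in sel) => /=; last by lra.
  - have := ler_wpM2l x0 uu; lra.
  - lra.
  - lra.
apply: (le_trans nextW); rewrite [leRHS]mulrBl mul1r lerD2l lerN2 -mulrA.
rewrite ler_wpM2l ?subr_ge0// mulrC ler_pdivrMr 1?mulrC//.
by rewrite exprn_gt0// ltr0n ltnW.
Qed.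

(** Two cells rank at least as high as the target, so their weights are at least 1; multiplying any
    weight by that of one of the two, distinct from its own cell, makes it a term of [pot2]. *)
Lemma pot1_le_pot2 s k0 m1 : 0 <= s -> k0 != m -> m1 != m -> m1 != k0 ->
  S m <= S k0 -> S m <= S m1 -> pot1 s <= M%:R * pot2 s.
Proof.
move=> s0 k0m m1m m1k0 Sk0 Sm1.
have ge1 j : S m <= S j -> 1 <= wt s j.
  by move=> H; rewrite -[leLHS]expR0 ler_expR mulr_ge0// subr_ge0.
apply: sum_le_M; first exact: pot2_ge0.
move=> j jm; have [->|jk0] := eqVneq j k0.
  apply: le_trans (wt2_le_pot2 s _ _ k0m m1m m1k0).
  by rewrite ler_peMr ?wt_ge0// ge1.
apply: le_trans (wt2_le_pot2 s _ _ jm k0m _); last by rewrite eq_sym.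
by rewrite ler_peMr ?wt_ge0// ge1.
Qed.

(** Weights at least 1 grow with the exponent, and the weights below 1 are covered by that of
    [j0]. *)
Lemma pot1_le_pot1 s s' j0 : 0 <= s <= s' -> j0 != m -> S m <= S j0 ->
  pot1 s <= M%:R * pot1 s'.
Proof.
move=> /andP[s0 ss'] j0m Sj0.
have s'0 : 0 <= s' := le_trans s0 ss'.
have le_pot j : j != m -> wt s' j <= pot1 s'.
  move=> jm; rewrite /pot1 (bigD1 j)//= lerDl.
  by apply: sumr_ge0 => k _; exact: wt_ge0.
apply: sum_le_M; first exact: pot1_ge0.
move=> j jm; have [Sj|Sj] := leP (S m) (S j).
  by apply: le_trans (le_pot j jm); rewrite ler_expR ler_wpM2r// subr_ge0.
apply: le_trans (le_pot j0 j0m); apply: (@le_trans _ _ 1).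
  by rewrite -[leRHS]expR0 ler_expR mulr_ge0_le0// subr_le0 ltW.
by rewrite -[leLHS]expR0 ler_expR mulr_ge0// subr_ge0.
Qed.

End Potential.

(** * The score gap, and the choice of constants *)

(** Turns the gap computed by sorting into pairwise comparisons with any maximal index [k0]. A
    second index must exist: otherwise the second entry of the list would be the default 0. *)
Lemma gap_sort (R : realType) (I : finType) (S : I -> R) (k0 : I) (a : R) :
  (exists j, j != k0) -> (forall k, S k <= S k0) ->
  let s := sort (fun x y : R => y <= x) [seq S k | k <- enum I] in
  (a <= nth 0 s 0 - nth 0 s 1) <-> (forall j, j != k0 -> a <= S k0 - S j).
Proof.
move=> [j0 j0k] top s.
pose ge := fun x y : R => y <= x.
have ge_tr : transitive ge by move=> x y z yx zy; exact: le_trans zy yx.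
have ge_total : total ge by move=> x y; exact: le_total.
have ge_anti : antisymmetric ge by move=> x y; rewrite andbC => /le_anti.
pose r := [seq S k | k <- enum I & k != k0].
have pE : perm_eq [seq S k | k <- enum I] (S k0 :: r).
  rewrite -[S k0 :: r]/(map S (k0 :: [seq k <- enum I | k != k0])) perm_map//.
  rewrite -rem_filter ?enum_uniq//; apply: perm_to_rem.
  by rewrite mem_enum.
have sE : s = S k0 :: sort ge r.
  apply: (@sorted_eq _ ge) => //.
  - exact: sort_sorted.
  - have := sort_sorted ge_total r; rewrite /= path_sortedE// => ->.
    rewrite andbT all_sort; apply/allP => x /mapP[k _ ->]; exact: top.
  - rewrite perm_sort; apply: (perm_trans pE).
    by rewrite perm_cons perm_sym perm_sort.
rewrite sE /=; case E : (sort ge r) => [|x r'].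
  have : S j0 \in sort ge r by rewrite mem_sort; apply/mapP; exists j0; rewrite // mem_filter j0k mem_enum.
  by rewrite E.
have xtop j : j != k0 -> S j <= x.
  move=> jk; have : S j \in sort ge r by rewrite mem_sort; apply/mapP; exists j; rewrite // mem_filter jk mem_enum.
  have := sort_sorted ge_total r; rewrite E /= path_sortedE// => /andP[/allP H _].
  by rewrite inE => /orP[/eqP ->//|/H].
have [j1 j1k xE] : exists2 j, j != k0 & x = S j.
  have : x \in sort ge r by rewrite E mem_head.
  by rewrite mem_sort => /mapP[k]; rewrite mem_filter => /andP[kk0 _] ->; exists k.
rewrite /=; split; last by rewrite xE; exact.
by move=> ax j jk; apply: (le_trans ax); rewrite lerD2l lerN2 xtop.
Qed.

Lemma mul_expRN_le (R : realType) (k a : R) : 0 < k -> 0 < a ->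
  a * expR (- (k * a)) <= 2 / (k ^+ 2 * a).
Proof.
move=> k0 a0; have ka0 : 0 <= k * a by rewrite mulr_ge0 ?ltW.
have := expR_ge1Dxn 1 ka0; rewrite (_ : 2`! = 2)%N// exprMn => H.
have E0 := expR_gt0 (k * a).
rewrite expRN ler_pdivlMr ?mulr_gt0 ?exprn_gt0// mulrAC ler_pdivrMr//.
have -> : a * (k ^+ 2 * a) = 2 * (k ^+ 2 * a ^+ 2 / 2) by field.
by rewrite ler_pM2l//; lra.
Qed.

(* Choice of the threshold [b] and the horizon [n0] in the lower bound, with
   a = - log c; the subtracted sum bounds the probability of stopping by [n0]. *)
Lemma stop_mass_le (R : realType) (I eta s K1 Mr : R) :
  0 < I -> 0 < eta < 1 -> 0 < s -> 0 <= K1 -> 0 <= Mr ->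
  exists2 A0 : R, 0 < A0 & forall a, A0 <= a ->
  let G := I * (1 + eta / 4) in let d := eta / 8 in let b := (1 - d) * a in
  let n0 := Num.truncn ((1 - 2 * d) * a / G) in let alpha := K1 * a * expR (- a) in
  (1 - eta) * (a / I) <= n0.+1%:R *
    (1 - (alpha + n0.+1%:R * expR (- (s * b) + s * G * n0%:R) + expR b * (Mr * alpha))).
Proof.
move=> I0 /andP[eta0 eta1] s0 K10 Mr0.
(* [d] is the relative distance kept between [b] and a, and between the drift up to [n0] and [b].
   Apart from a factor a, the three error terms decay in a at the rates 1, s d and d, hence at least
   at the rate [k]. *)
pose d := eta / 8; pose k := Num.min d (s * d).
have d0 : 0 < d by rewrite divr_gt0.
have d1 : 2 * d < 1 by rewrite /d; lra.
have k0 : 0 < k by rewrite lt_min d0 mulr_gt0.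
(* [D] adds the coefficients of the three terms in units of a exp (- k a): K1, then I^-1 + 1, which
   bounds (n0 + 1) / a, and Mr K1. The threshold [A1] solves 2 D / (k^2 a) = eta / 4 for a. *)
pose D := K1 + I^-1 + 1 + Mr * K1.
have Iv0 : 0 < I^-1 by rewrite invr_gt0.
have MK : 0 <= Mr * K1 by rewrite mulr_ge0.
have D0 : 0 < D by rewrite /D; lra.
pose A1 := 8 * D / (k ^+ 2 * eta).
have A10 : 0 < A1 by rewrite divr_gt0 ?mulr_gt0 ?exprn_gt0.
exists (1 + A1); first by rewrite addr_gt0.
move=> a aA; have a1 : 1 <= a by lra.
have a0 : 0 < a by lra.
cbv zeta; rewrite -/d; set G := I * _; set b := (1 - d) * a.
set n0 := Num.truncn _; set alpha := K1 * a * expR (- a).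
have G0 : 0 < G by rewrite mulr_gt0// addr_gt0// divr_gt0.
have IG : I <= G by rewrite ler_peMr ?(ltW I0)// lerDl divr_ge0// ltW.
have d2 : 0 <= 1 - 2 * d by lra.
have da0 : 0 <= (1 - 2 * d) * a by exact: mulr_ge0 d2 (ltW a0).
have aG0 : 0 <= (1 - 2 * d) * a / G by exact: divr_ge0 da0 (ltW G0).
have n0_le : n0%:R <= (1 - 2 * d) * a / G by rewrite truncn_le.
have n0_ge : (1 - 2 * d) * a / G <= n0.+1%:R by rewrite ltW// truncnS_gt.
have Gn0 : G * n0%:R <= (1 - 2 * d) * a by rewrite mulrC -ler_pdivlMr.
have n0a : n0.+1%:R <= (I^-1 + 1) * a.
  rewrite -natr1 mulrDl mul1r lerD//; apply: (le_trans n0_le).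
  rewrite mulrC; apply: ler_pM => //; first by rewrite invr_ge0 ltW.
    by rewrite lef_pV2 ?posrE.
  by rewrite ler_piMl ?(ltW a0)//; lra.
pose E := expR (- (k * a)).
have E0 : 0 < E by exact: expR_gt0.
have kd : k <= d by rewrite ge_min lexx.
have ksd : k <= s * d by rewrite ge_min lexx orbT.
have t2 : n0.+1%:R * expR (- (s * b) + s * G * n0%:R) <= (I^-1 + 1) * a * E.
  apply: ler_pM; rewrite ?ler0n ?expR_ge0//.
  rewrite ler_expR.
  have H1 : s * (G * n0%:R) <= s * ((1 - 2 * d) * a) by rewrite ler_pM2l.
  have H2 : k * a <= s * d * a by rewrite ler_pM2r.
  have -> : s * G * n0%:R = s * (G * n0%:R) by rewrite mulrA.
  have -> : - (s * b) = - (s * ((1 - 2 * d) * a)) - s * d * a by rewrite /b; ring.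
  lra.
have alpha0 : 0 <= alpha by rewrite !mulr_ge0 ?expR_ge0 ?(ltW a0).
have t1 : alpha <= K1 * a * E.
  rewrite ler_wpM2l ?mulr_ge0 ?(ltW a0)// ler_expR lerN2 ler_piMl ?(ltW a0)//.
  by apply: (le_trans kd); lra.
have t3 : expR b * (Mr * alpha) <= Mr * K1 * a * E.
  have -> : expR b * (Mr * alpha) = Mr * K1 * a * (expR b * expR (- a)) by rewrite /alpha; ring.
  rewrite ler_wpM2l ?mulr_ge0 ?(ltW a0)// -expRD ler_expR.
  have -> : b + - a = - (d * a) by rewrite /b; ring.
  by rewrite lerN2 ler_pM2r.
have aE : D * (a * E) <= eta / 4.
  apply: (@le_trans _ _ (D * (2 / (k ^+ 2 * a)))).
    by rewrite ler_wpM2l ?(ltW D0)// mul_expRN_le.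
  have A1a : A1 <= a by lra.
  move: A1a; rewrite /A1 ler_pdivrMr ?mulr_gt0 ?exprn_gt0// => A1a.
  rewrite mulrA ler_pdivrMr ?mulr_gt0 ?exprn_gt0//.
  have -> : eta / 4 * (k ^+ 2 * a) = (a * (k ^+ 2 * eta)) / 4 by ring.
  rewrite ler_pdivlMr//; lra.
set q := alpha + _ + _.
have qle : q <= eta / 4.
  apply: le_trans aE; have -> : D * (a * E) = K1 * a * E + (I^-1 + 1) * a * E + Mr * K1 * a * E.
    by rewrite /D; ring.
  by rewrite /q !lerD.
apply: (@le_trans _ _ ((1 - 2 * d) * a / G * (1 - eta / 4))); last first.
  by apply: ler_pM => //; lra.
have -> : (1 - 2 * d) * a / G * (1 - eta / 4) =
    ((1 - 2 * d) * (1 - eta / 4) / (1 + eta / 4)) * (a / I).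
  by rewrite /G; field; rewrite !gt_eqF//; lra.
rewrite ler_pM2r ?divr_gt0// ler_pdivlMr; last lra.
have : 0 <= eta * eta by rewrite mulr_ge0 ?ltW.
rewrite /d => ee.
have -> : (1 - eta) * (1 + eta / 4) = 1 - 3 / 4 * eta - eta * eta / 4 by field.
have -> : (1 - 2 * (eta / 8)) * (1 - eta / 4) = 1 - eta / 2 + eta * eta / 16 by field.
lra.
Qed.

(** The reduced drift I (1 - eta / 4) costs a factor at most 1 + eta / 2; the remaining eta / 2
    absorbs the constant [B] once a is large. *)
Lemma inflated_time_le (R : realType) (I eta B a : R) : 0 < I -> 0 < eta < 1 -> 0 < a ->
  2 * B * I / eta <= a -> a / (I - I * (eta / 4)) + B <= (1 + eta) * (a / I).
Proof.
move=> I0 /andP[eta0 eta1] a0 Ba.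
have -> : (1 + eta) * (a / I) = (1 + eta / 2) * (a / I) + eta / 2 * (a / I).
  by field; rewrite gt_eqF.
apply: lerD.
  have -> : I - I * (eta / 4) = I * (1 - eta / 4) by ring.
  have -> : a / (I * (1 - eta / 4)) = (1 - eta / 4)^-1 * (a / I).
    by rewrite invfM mulrA mulrC.
  rewrite ler_pM2r ?divr_gt0// -[leLHS]mul1r ler_pdivrMr; last lra.
  have : 0 <= eta * (1 - eta) by rewrite mulr_ge0 ?subr_ge0 ?(ltW eta0) ?(ltW eta1).
  have -> : (1 + eta / 2) * (1 - eta / 4) = 1 + eta / 8 + eta * (1 - eta) / 8 by field.
  lra.
rewrite mulrA ler_pdivlMr//; move: Ba; rewrite ler_pdivrMr//; lra.
Qed.

(** * The observation model *)

Section Observations.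
Variables (R : realType) (M : nat).
Variables (dY : measure_display) (Y : measurableType dY) (mu : {measure set Y -> \bar R}).
Variables (f g : Y -> R).
Variables (dO : measure_display) (Omega : measurableType dO).
Variable (P : 'I_M -> probability Omega R).
Variables (dV : measure_display) (TV : measurableType dV) (Q : probability TV R).
Variables (Z : nat -> 'I_M -> Omega -> Y) (V : Omega -> TV).

Definition dens (m k : 'I_M) : Y -> R := if k == m then g else f.

(* Generators of the information on all cells, observed or not, at times < N.
   It contains the history [F] of any policy and is independent of [Z N]. *)
Definition past (N : nat) : set (set Omega) :=
  [set E | exists A B, [/\ measurable A, forall t k, measurable (B t k) &
     E = V @^-1` A `&` [set w | forall t k, (t < N)%N -> B t k (Z t k w)]]].

Hypotheses (mf : measurable_fun setT f) (mg : measurable_fun setT g).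
Hypotheses (f0 : forall y, 0 <= f y) (g0 : forall y, 0 <= g y).
Hypotheses (f1 : (\int[mu]_y (f y)%:E = 1)%E) (g1 : (\int[mu]_y (g y)%:E = 1)%E).
Hypotheses (mZ : forall t k, measurable_fun setT (Z t k)) (mV : measurable_fun setT V).
Hypothesis model : forall (m : 'I_M) (N : nat) (A : set TV) (B : nat -> 'I_M -> set Y),
     measurable A -> (forall t k, measurable (B t k)) ->
     fine (P m (V @^-1` A `&` [set w | forall t k, (t < N)%N -> B t k (Z t k w)]))
     = fine (Q A) * \prod_(t < N) \prod_(k < M)
         fine (\int[mu]_(y in B t k) ((if k == m then g else f) y)%:E)%E.

Lemma mdens m k : measurable_fun setT (dens m k).
Proof. by rewrite /dens; case: ifP. Qed.

Lemma dens_ge0 m k y : 0 <= dens m k y.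
Proof. by rewrite /dens; case: ifP. Qed.

Lemma dens_int1 m k : (\int[mu]_y (dens m k y)%:E = 1)%E.
Proof. by rewrite /dens; case: ifP. Qed.

Lemma dens_indic m k B : measurable B ->
  (\int[mu]_y (dens m k y * \1_B y)%:E =
   (fine (\int[mu]_(y in B) (dens m k y)%:E))%:E)%E.
Proof.
move=> mB.
have -> : (\int[mu]_y (dens m k y * \1_B y)%:E = \int[mu]_(y in B) (dens m k y)%:E)%E.
  rewrite [RHS]integral_mkcond; apply: eq_integral => y _.
  by rewrite patchE indicE; case: (y \in B); rewrite ?mulr1 ?mulr0.
have md : measurable_fun setT (fun y => (dens m k y)%:E).
  by apply/measurable_EFinP; exact: mdens.
rewrite fineK// ge0_fin_numE; last first.
  by apply: integral_ge0 => y _; rewrite lee_fin dens_ge0.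
have := ge0_subset_integral mu mB measurableT md.
move=> /(_ (fun y _ => dens_ge0 m k y)) /(_ (fun _ _ => I)) le1.
by rewrite (le_lt_trans le1)// dens_int1 ltry.
Qed.

Lemma past_setI N : setI_closed (past N).
Proof.
move=> _ _ [A [B [mA mB ->]]] [A' [B' [mA' mB' ->]]].
exists (A `&` A'), (fun t k => B t k `&` B' t k); split.
- exact: measurableI.
- by move=> t k; exact: measurableI.
- apply/seteqP; split=> w /=.
    by move=> [[wA wB] [wA' wB']]; split => // t k tN; split; [exact: wB|exact: wB'].
  by move=> [[wA wA'] wB]; split; split => // t k tN; have [] := wB t k tN.
Qed.

Lemma past_mono N N' : (N <= N')%N -> past N `<=` past N'.
Proof.
move=> NN' _ [A [B [mA mB ->]]].
exists A, (fun t k => if (t < N)%N then B t k else setT); split => //.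
- by move=> t k; case: ifP.
- apply/seteqP; split=> w /= [wA wB]; split => // t k tN.
    by case: ifP => // tN0; exact: wB.
  by have := wB t k (leq_trans tN NN'); rewrite tN.
Qed.

Lemma measurable_cylinder N (B : nat -> 'I_M -> set Y) :
  (forall t k, measurable (B t k)) ->
  measurable [set w | forall t k, (t < N)%N -> B t k (Z t k w)].
Proof.
move=> mB.
rewrite (_ : mkset _ = \bigcap_(t in `I_N) \bigcap_(k in setT) (Z t k @^-1` B t k)); last first.
  apply/seteqP; split => w /= wB.
    by move=> t /= tN k _; exact: wB.
  by move=> t k tN; exact: (wB t tN k I).
apply: fin_bigcap_measurable; first exact: finite_II.
move=> t _; apply: fin_bigcap_measurable; first exact: finite_finset.
by move=> k _; rewrite -[_ @^-1` _]setTI; exact: mZ.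
Qed.

Lemma past_measurable N : past N `<=` measurable.
Proof.
move=> _ [A [B [mA mB ->]]]; apply: measurableI; last exact: measurable_cylinder.
by rewrite -[_ @^-1` _]setTI; exact: mV.
Qed.

Lemma spast_measurable N : <<s past N >> `<=` measurable.
Proof.
apply: smallest_sub; first exact: sigma_algebra_measurable.
exact: past_measurable.
Qed.

Lemma spast_mono N N' : (N <= N')%N -> <<s past N >> `<=` <<s past N' >>.
Proof. by move=> NN'; apply: sub_sigma_algebra2; exact: past_mono. Qed.

Lemma past_setT N : past N setT.
Proof.
exists setT, (fun _ _ => setT); split => //.
by rewrite preimage_setT setTI; apply/seteqP; split.
Qed.

Definition now (N : nat) (B : 'I_M -> set Y) := [set w | forall k, B k (Z N k w)].

Lemma measurable_now N B : (forall k, measurable (B k)) -> measurable (now N B).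
Proof.
move=> mB.
rewrite (_ : now N B = \bigcap_(k in setT) (Z N k @^-1` B k)); last first.
  by apply/seteqP; split => w /= wB => [k _|k]; [exact: wB|exact: wB].
apply: fin_bigcap_measurable; first exact: finite_finset.
by move=> k _; rewrite -[_ @^-1` _]setTI; exact: mZ.
Qed.

(** Both sides are finite measures in [A]; on the pi-system [past N] they agree by [model] at the
    horizons N and N.+1. *)
Lemma indep_now m N A (B : 'I_M -> set Y) : <<s past N >> A ->
  (forall k, measurable (B k)) ->
  (P m (A `&` now N B) =
   (\prod_(k < M) fine (\int[mu]_(y in B k) (dens m k y)%:E))%:E * P m A)%E.
Proof.
move=> GA mB; set c := \prod_(k < M) _.
have c0 : 0 <= c.
  apply: prodr_ge0 => k _; apply: fine_ge0.
  by apply: integral_ge0 => y _; rewrite lee_fin dens_ge0.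
have mE := measurable_now N _ mB.
pose m1 : {measure set Omega -> \bar R} := mrestr (P m) mE.
pose m2 : {measure set Omega -> \bar R} := mscale (NngNum c0) (P m).
suff : m1 A = m2 A by [].
apply: (g_sigma_algebra_measure_unique (past N) (past_measurable N) (fun=> setT)) => //.
- by move=> _; exact: past_setT.
- exact: bigcup_const.
- exact: past_setI.
- move=> _ [A' [B' [mA' mB' ->]]].
  set E := V @^-1` A' `&` _.
  change (P m (E `&` now N B) = c%:E * P m E)%E; rewrite {}/E.
  have Pfin E : measurable E -> P m E = (fine (P m E))%:E.
    by move=> mE'; rewrite fineK// fin_num_measure.
  have mV' : measurable (V @^-1` A').
    by rewrite -[_ @^-1` _]setTI; exact: mV.
  have mC := measurable_cylinder N _ mB'.
  rewrite Pfin; last by apply: measurableI => //; exact: measurableI.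
  rewrite [in RHS]Pfin; last exact: measurableI.
  rewrite -EFinM; congr (_%:E).
  rewrite model//.
  pose B2 t k := if (t < N)%N then B' t k else B k.
  have mB2 t k : measurable (B2 t k) by rewrite /B2; case: ifP.
  have := model m N.+1 A' B2 mA' mB2.
  rewrite big_ord_recr /= [X in _ = _ * (_ * X)](_ : _ = c); last first.
    by apply: eq_bigr => k _; rewrite /B2 ltnn.
  rewrite (eq_bigr (fun t : 'I_N => \prod_(k < M)
       fine (\int[mu]_(y in B' t k) ((if k == m then g else f) y)%:E)%E)); last first.
    by move=> t _; apply: eq_bigr => k _; rewrite /B2 ltn_ord.
  rewrite mulrA [RHS]mulrC => <-.
  congr (fine (P m _)); apply/seteqP; split => w /=.
    move=> [[wA wB'] wB]; split => // t k; rewrite ltnS leq_eqVlt => /orP[/eqP->|tN].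
      by rewrite /B2 ltnn; exact: wB.
    by rewrite /B2 tN; exact: wB'.
  move=> [wA wB]; split; [split => //|].
    by move=> t k tN; have := wB t k (ltnW tN); rewrite /B2 tN.
  by move=> k; have := wB N k (ltnSn N); rewrite /B2 ltnn.
- move=> _; rewrite /m1 /= /mrestr setTI.
  by rewrite (le_lt_trans (probability_le1 (P m) mE)) ?ltry.
Qed.

Lemma measurable_past_fun N (X : Omega -> R) :
  measurable_fun (setT : set (g_sigma_algebraType (past N))) X ->
  measurable_fun setT X.
Proof.
move=> mX _ B mB; apply: (@spast_measurable N); exact: (mX measurableT B mB).
Qed.

(** Independence of [Z N] from the past, in the form that replaces a conditional expectation. Both
    sides may be infinite. *)
Lemma step_now m N (X : Omega -> R) (h : 'I_M -> Y -> R) (H : 'I_M -> R) :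
  measurable_fun (setT : set (g_sigma_algebraType (past N))) X ->
  (forall w, 0 <= X w) ->
  (forall k, measurable_fun setT (h k)) -> (forall k y, 0 <= h k y) ->
  (forall k, \int[mu]_y (dens m k y * h k y)%:E = (H k)%:E)%E ->
  (\int[P m]_w (X w * \prod_(k < M) h k (Z N k w))%:E =
   (\prod_(k < M) H k)%:E * \int[P m]_w (X w)%:E)%E.
Proof.
move=> mX X0 mh h0 hH.
have H0 k : 0 <= H k.
  by rewrite -lee_fin -hH; apply: integral_ge0 => y _; rewrite lee_fin mulr_ge0// dens_ge0.
have {}mX' := measurable_past_fun _ _ mX.
(* Functions replace indicators one cell at a time: [r] counts the cells done. *)
suff Hr r : forall (h : 'I_M -> Y -> R) (H : 'I_M -> R), (forall k, measurable_fun setT (h k)) -> (forall k y, 0 <= h k y) ->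
  (forall k, \int[mu]_y (dens m k y * h k y)%:E = (H k)%:E)%E -> (forall k, 0 <= H k) ->
  (forall k : 'I_M, (r <= k)%N -> exists2 B, measurable B & h k = \1_B) ->
  (\int[P m]_w (X w * \prod_(k < M) h k (Z N k w))%:E =
   (\prod_(k < M) H k)%:E * \int[P m]_w (X w)%:E)%E.
  by apply: (Hr M) => // k; rewrite leqNgt ltn_ord.
elim: r => [|r IH] {mh h0 hH H0} h {}H mh h0 hH H0 hB.
  have {}hB k : exists B, measurable B /\ h k = \1_B.
    by have [B mB e] := hB k (leq0n _); exists B.
  have [B hB'] := choice hB.
  have mB k : measurable (B k) := (hB' k).1.
  have eB k : h k = \1_(B k) := (hB' k).2.
  have HE k : H k = fine (\int[mu]_(y in B k) (dens m k y)%:E)%E.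
    by apply: EFin_inj; rewrite -hH eB dens_indic.
  have eX w : X w * \prod_(k < M) h k (Z N k w) = \1_(now N B) w * X w.
    rewrite mulrC; congr (_ * _); rewrite indicE.
    have [wE|wE] := boolP (w \in now N B).
      by apply: big1 => k _; rewrite eB indicE mem_set//; move: wE; rewrite inE; exact.
    apply/eqP/prodf_eq0 => /=.
    move: wE; rewrite notin_setE => /existsNP[k wk].
    by exists k => //; rewrite eB indicE memNset.
  under eq_integral do rewrite eX.
  (* The identity, seen as a map into [Omega] with the smaller sigma-algebra, lets
     [ge0_integral_comp_ext] pass from events of the past to the function [X]. *)
  pose idp : Omega -> g_sigma_algebraType (past N) := id.
  have midp : measurable_fun setT idp.
    by move=> _ A mA; rewrite setTI; exact: spast_measurable mA.
  have mE := measurable_now N _ mB.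
  have -> : (\int[P m]_w (X w)%:E = \int[P m]_w (1 * X w)%:E)%E.
    by under [RHS]eq_integral do rewrite mul1r.
  apply: (ge0_integral_comp_ext _ _ _ _ _ _ _ (P m) (P m) idp idp (\1_(now N B)) (cst 1)) => //.
    by rewrite lee_fin prodr_ge0.
  move=> A mA; pose A' : set Omega := A.
  have mA' : measurable A' by apply: (@spast_measurable N).
  have -> : (\int[P m]_w (\1_(now N B) w * \1_A (idp w))%:E =
             \int[P m]_w (\1_(A' `&` now N B) w)%:E)%E.
    by apply: eq_integral => w _; rewrite indicI/= mulrC.
  have -> : (\int[P m]_w (cst 1 w * \1_A (idp w))%:E = \int[P m]_w (\1_A' w)%:E)%E.
    by apply: eq_integral => w _; rewrite mul1r.
  rewrite !integral_indic// ?setIT; [|exact: measurableI..].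
  apply: etrans (indep_now m N A' B mA mB) _.
  by congr (_%:E * _)%E; apply: eq_bigr => k _; rewrite HE.
have [rM|Mr] := ltnP r M; last first.
  by apply: IH => // k; rewrite leqNgt (leq_trans (ltn_ord k) Mr).
pose k0 := Ordinal rM.
(* The cell whose function is to be generalized is singled out; the other factors join the
   weight. *)
pose X1 w := X w * \prod_(k < M | k != k0) h k (Z N k w).
have eX w : X w * \prod_(k < M) h k (Z N k w) = X1 w * h k0 (Z N k0 w).
  by rewrite (bigD1 k0)//= /X1 mulrAC mulrA.
under eq_integral do rewrite eX.
pose C : \bar R := ((\prod_(k < M | k != k0) H k)%:E * \int[P m]_w (X w)%:E)%E.
have -> : ((\prod_(k < M) H k)%:E * \int[P m]_w (X w)%:E =
    C * \int[mu]_y (dens m k0 y * h k0 y)%:E)%E.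
  by rewrite hH /C [RHS]muleC muleA -EFinM (bigD1 k0).
apply: (ge0_integral_comp_ext _ _ _ _ _ _ _ (P m) mu (Z N k0) id X1 (dens m k0)) => //.
- apply: measurable_funM => //.
  under eq_fun do rewrite -big_filter.
  apply: measurable_prod => k _.
  exact: (measurableT_comp (mh k)).
- exact: mdens.
- by move=> w; rewrite mulr_ge0// prodr_ge0.
- exact: dens_ge0.
- rewrite mule_ge0 ?lee_fin ?prodr_ge0//.
  by apply: integral_ge0 => w _; rewrite lee_fin.
move=> B mB.
pose h' k := if k == k0 then \1_B else h k.
pose H' k := if k == k0 then fine (\int[mu]_(y in B) (dens m k0 y)%:E)%E else H k.
have hH' k : (\int[mu]_y (dens m k y * h' k y)%:E = (H' k)%:E)%E.
  by rewrite /h' /H'; case: eqP => [->|_] //; exact: dens_indic.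
have mh' k : measurable_fun setT (h' k) by rewrite /h'; case: eqP.
have h'0 k y : 0 <= h' k y by rewrite /h'; case: eqP.
have H'0 k : 0 <= H' k.
  rewrite /H'; case: eqP => // _; apply: fine_ge0.
  by apply: integral_ge0 => y _; rewrite lee_fin dens_ge0.
have h'B (k : 'I_M) : (r <= k)%N -> exists2 B, measurable B & h' k = \1_B.
  rewrite leq_eqVlt => /orP[/eqP rk|rk].
    by exists B; rewrite // /h' (_ : k = k0) ?eqxx//; apply: val_inj; rewrite /= -rk.
  by rewrite /h'; case: eqP => [_|_]; [exists B|exact: hB].
have := IH h' H' mh' h'0 hH' H'0 h'B.
have -> : \prod_(k < M) H' k = H' k0 * \prod_(k < M | k != k0) H k.
  by rewrite (bigD1 k0)//=; congr (_ * _); apply: eq_bigr => k /negbTE kk; rewrite /H' kk.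
have -> : (\int[P m]_w (X w * \prod_(k < M) h' k (Z N k w))%:E =
           \int[P m]_w (X1 w * \1_B (Z N k0 w))%:E)%E.
  apply: eq_integral => w _; rewrite (bigD1 k0)//= mulrCA mulrC; congr (_ * _)%:E.
    by congr (_ * _); apply: eq_bigr => k /negbTE kk; rewrite /h' kk.
  by rewrite /h' eqxx.
move=> ->; rewrite dens_indic// /H' eqxx /C.
by rewrite [RHS]muleC muleA -EFinM.
Qed.

Notation llr := (fun y => ln (g y / f y)).

(** By the conventions 0^-1 = 0 and ln 0 = 0, where one density vanishes the ratio is 0 and so is
    its logarithm. *)
Lemma llrE y : llr y = if (0 < f y) && (0 < g y) then ln (g y) - ln (f y) else 0.
Proof.
case: ifPn => [/andP[fy gy]|]; first by rewrite ln_div.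
rewrite negb_and -!leNgt => /orP[] le0.
  by rewrite (_ : f y = 0) ?invr0 ?mulr0 ?ln0//; apply: le_anti; rewrite le0 f0.
by rewrite (_ : g y = 0) ?mul0r ?ln0//; apply: le_anti; rewrite le0 g0.
Qed.

Lemma measurable_llr : measurable_fun setT llr.
Proof.
rewrite (_ : llr = fun y => if (0 < f y) && (0 < g y) then ln (g y) - ln (f y) else 0); last first.
  by apply/funext => y; exact: llrE.
apply: measurable_fun_ifT => //.
  by apply: measurable_and; apply: measurable_fun_ltr.
by apply: measurable_funB; exact: (measurableT_comp (@measurable_ln R)).
Qed.

Hypothesis f_ac_g : {ae mu, forall y, 0 < f y -> 0 < g y}.
Hypothesis g_ac_f : {ae mu, forall y, 0 < g y -> 0 < f y}.
Hypothesis M2 : (2 <= M)%N.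
Variables (Dgf Dfg C e0 : R).
Hypotheses (Dgf0 : 0 < Dgf) (Dfg0 : 0 < Dfg) (C0 : 0 < C) (e00 : 0 < e0).
Hypothesis Hf : forall s, `|s| <= e0 ->
  (\int[mu]_y (f y * expR (s * llr y))%:E <= (1 - s * Dfg + C * s ^+ 2)%:E)%E.
Hypothesis Hg : forall s, `|s| <= e0 ->
  (\int[mu]_y (g y * expR (s * llr y))%:E <= (1 + s * Dgf + C * s ^+ 2)%:E)%E.

(** * Histories of a selection rule and change of measure *)

Section Selection.
Variable phi : nat -> Omega -> {set 'I_M}.
Hypothesis phiF : forall n S, F Z V phi n [set w | phi n.+1 w = S].
Local Notation Fn := (F Z V phi).
Local Notation Sk := (Sstat Z f g phi).

Lemma spast_obs N t k B : (t < N)%N -> measurable B -> <<s past N >> (Z t k @^-1` B).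
Proof.
move=> tN mB; apply: sub_sigma_algebra.
exists setT, (fun t' k' => if (t' == t) && (k' == k) then B else setT); split => //.
  by move=> t' k'; case: ifP.
rewrite preimage_setT setTI; apply/seteqP; split=> w /= wB.
  by move=> t' k' _; case: ifP => // /andP[/eqP -> /eqP ->].
by have := wB t k tN; rewrite !eqxx.
Qed.

(** The range reaches n.+1 because the selection at time n.+1 is a function of the history up to
    time n. *)
Lemma F_select n s k : (1 <= s <= n.+1)%N -> Fn n [set w | k \in phi s w].
Proof.
case: s => // s sn.
have -> : [set w | k \in phi s.+1 w] =
    \bigcup_(S in [set S : {set 'I_M} | k \in S]) [set w | phi s.+1 w = S].
  by apply/seteqP; split => [w wk|w [S kS wS]]; [exists (phi s.+1 w)|rewrite /= wS].
apply: (@fin_bigcup_measurable _ (g_sigma_algebraType (hist_gen Z V phi n))).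
  exact: finite_finset.
move=> S _; have : (s <= n)%N by [].
move=> sn'; have := phiF s S; apply: sub_sigma_algebra2.
move=> A [[B H]|[[s' [k' [/andP[s1 s2] ->]]]|[s' [k' [B [/andP[s1 s2] H]]]]]].
- by left; exists B.
- by right; left; exists s', k'; rewrite s1 (leq_trans s2).
- by right; right; exists s', k', B; rewrite s1 (leq_trans s2).
Qed.

(** Strong induction: by [phiF] the selections up to time n are events of earlier histories, which
    lie in the past by induction. [past n.+1] covers the times up to n. *)
Lemma F_past n : Fn n `<=` <<s past n.+1 >>.
Proof.
have [k] := ubnP n; elim: k n => // k IH n nk.
have sel s S : (s < n)%N -> <<s past n.+1 >> [set w | phi s.+1 w = S].
  move=> sn; apply: (@spast_mono s.+1); first by rewrite ltnS ltnW.
  by apply: IH; [exact: leq_trans sn _|exact: phiF].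
have seli s j : (1 <= s <= n)%N -> <<s past n.+1 >> [set w | j \in phi s w].
  case: s => // s sn.
  have -> : [set w | j \in phi s.+1 w] =
      \bigcup_(S in [set S : {set 'I_M} | j \in S]) [set w | phi s.+1 w = S].
    by apply/seteqP; split => [w wk|w [S kS wS]]; [exists (phi s.+1 w)|rewrite /= wS].
  apply: (@fin_bigcup_measurable _ (g_sigma_algebraType (past n.+1))).
    exact: finite_finset.
  by move=> S _; exact: sel.
apply: smallest_sub; first exact: smallest_sigma_algebra.
move=> _ [[A [mA ->]]|[[s [j [sn ->]]]|[s [j [B [sn [mB ->]]]]]]].
- apply: sub_sigma_algebra; exists A, (fun _ _ => setT); split => //.
  by apply/seteqP; split => w //= [].
- exact: seli.
- have -> : [set w | j \in phi s w /\ B (Z s j w)] =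
     [set w | j \in phi s w] `&` (Z s j @^-1` B) by [].
  apply: (@measurableI _ (g_sigma_algebraType (past n.+1))); first exact: seli.
  by apply: spast_obs => //; case/andP: sn.
Qed.

Lemma F_measurable n : Fn n `<=` measurable.
Proof. by move=> A /F_past; exact: spast_measurable. Qed.

Lemma F_le n n' : (n <= n')%N -> Fn n `<=` Fn n'.
Proof.
move=> nn'; apply: sub_sigma_algebra2.
move=> A [[B H]|[[s' [k' [/andP[s1 s2] ->]]]|[s' [k' [B [/andP[s1 s2] H]]]]]].
- by left; exists B.
- by right; left; exists s', k'; rewrite s1 (leq_trans s2).
- by right; right; exists s', k', B; rewrite s1 (leq_trans s2).
Qed.

Lemma measurable_Sstat n k :
  measurable_fun (setT : set (g_sigma_algebraType (past n.+1))) (Sk n k).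
Proof.
rewrite /Sstat; under eq_fun do rewrite big_add1/= big_mkord.
apply: measurable_sum => t; apply: measurable_fun_ifT => //.
- apply: (measurable_fun_bool true); rewrite setTI.
  apply: (@spast_mono t.+1); first exact: leqW.
  by apply: F_past; apply: F_select; rewrite /= leqnn.
- move=> _ B mB; rewrite setTI.
  apply: (@spast_obs n.+1 t.+1 k (llr @^-1` B)) => //; first by rewrite ltnS.
  by rewrite -[_ @^-1` _]setTI; exact: measurable_llr.
Qed.

Definition expS (s : 'I_M -> R) n w := expR (\sum_k s k * Sk n k w).

Lemma expS_ge0 s n w : 0 <= expS s n w. Proof. exact: expR_ge0. Qed.

Lemma measurable_expS s n :
  measurable_fun (setT : set (g_sigma_algebraType (past n.+1))) (expS s n).
Proof.
apply: (measurableT_comp (@measurable_expR R)).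
apply: measurable_sum => k; apply: measurable_funM => //; exact: measurable_Sstat.
Qed.

Lemma SstatS n k w :
  Sk n.+1 k w = Sk n k w + (if k \in phi n.+1 w then llr (Z n.+1 k w) else 0).
Proof. by rewrite /Sstat big_nat_recr. Qed.

Lemma Sstat0 k w : Sk 0 k w = 0.
Proof. by rewrite /Sstat big_geq. Qed.

Lemma expSS s n w : expS s n.+1 w =
  expS s n w * \prod_(k in phi n.+1 w) expR (s k * llr (Z n.+1 k w)).
Proof.
rewrite /expS -expR_sum -expRD; congr expR.
rewrite [X in _ = _ + X]big_mkcond/= -big_split/=; apply: eq_bigr => k _.
by rewrite SstatS mulrDr; case: ifP; rewrite ?mulr0.
Qed.

(** On [A] the random selected set is the constant [S]; the cells outside [S] receive the function
    1, whose mean is 1. *)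
Lemma step_selected m n (A : set Omega) (S : {set 'I_M}) (s : 'I_M -> R)
    (h : 'I_M -> Y -> R) (H : 'I_M -> R) :
  <<s past n.+1 >> A -> (forall w, A w -> phi n.+1 w = S) ->
  (forall k, measurable_fun setT (h k)) -> (forall k y, 0 <= h k y) ->
  (forall k, \int[mu]_y (dens m k y * h k y)%:E = (H k)%:E)%E ->
  (\int[P m]_w (\1_A w * expS s n w * \prod_(k in S) h k (Z n.+1 k w))%:E =
   (\prod_(k in S) H k)%:E * \int[P m]_w (\1_A w * expS s n w)%:E)%E.
Proof.
move=> GA AS mh h0 hH.
rewrite [in RHS]big_mkcond/=.
under eq_integral do rewrite big_mkcond/=.
apply: (step_now m n.+1 (fun w => \1_A w * expS s n w)
  (fun k y => if k \in S then h k y else 1) (fun k => if k \in S then H k else 1)).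
- apply: measurable_funM; last exact: measurable_expS.
  exact: (@measurable_indic _ (g_sigma_algebraType (past n.+1))).
- by move=> w; rewrite mulr_ge0// expS_ge0.
- by move=> k; case: (k \in S).
- by move=> k y; case: (k \in S).
- move=> k; case: (k \in S); first exact: hH.
  by under eq_integral do rewrite mulr1; exact: dens_int1.
Qed.

Lemma measurable_selected n (S : {set 'I_M}) : <<s past n.+1 >> [set w | phi n.+1 w = S].
Proof. by apply: F_past; exact: phiF. Qed.

Lemma integral_selected m n (U : {set 'I_M} -> Omega -> R) :
  (forall S, measurable_fun setT (U S)) -> (forall S w, 0 <= U S w) ->
  (\int[P m]_w (U (phi n.+1 w) w)%:E =
   \sum_(S : {set 'I_M}) \int[P m]_w (\1_[set w | phi n.+1 w = S] w * U S w)%:E)%E.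
Proof.
move=> mU U0; rewrite -ge0_integral_sum//.
- apply: eq_integral => w _; rewrite (bigD1 (phi n.+1 w))//= big1 ?adde0.
    by rewrite indicE mem_set// mul1r.
  by move=> S SE; rewrite indicE memNset ?mul0r// => /= E; rewrite E eqxx in SE.
- move=> S; apply/measurable_EFinP/measurable_funM => //.
  by apply: measurable_indic; apply: spast_measurable; exact: measurable_selected.
- by move=> S w _; rewrite lee_fin mulr_ge0.
Qed.

Lemma measurable_expST s n : measurable_fun setT (expS s n).
Proof. by apply: (measurable_past_fun n.+1); exact: measurable_expS. Qed.

(** On each value of the selected set the product on the right is deterministic, so that expansions
    under two hypotheses can be compared term by term in [change_of_measure]. *)
Lemma step_split m n (A : set Omega) (s : 'I_M -> R)
    (h : 'I_M -> Y -> R) (H : 'I_M -> R) :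
  <<s past n.+1 >> A ->
  (forall k, measurable_fun setT (h k)) -> (forall k y, 0 <= h k y) ->
  (forall k, \int[mu]_y (dens m k y * h k y)%:E = (H k)%:E)%E ->
  (\int[P m]_w (\1_A w * expS s n w * \prod_(k in phi n.+1 w) h k (Z n.+1 k w))%:E =
   \sum_(S : {set 'I_M}) (\prod_(k in S) H k)%:E *
     \int[P m]_w (\1_(A `&` [set w | phi n.+1 w = S]) w * expS s n w)%:E)%E.
Proof.
move=> GA mh h0 hH.
have mA : measurable A by exact: spast_measurable GA.
rewrite (integral_selected m n
  (fun S w => \1_A w * expS s n w * \prod_(k in S) h k (Z n.+1 k w))); first last.
- by move=> S w; rewrite !mulr_ge0 ?expS_ge0// prodr_ge0.
- move=> S; apply: measurable_funM.
    by apply: measurable_funM => //; exact: measurable_expST.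
  under eq_fun do rewrite -big_filter.
  by apply: measurable_prod => k _; exact: (measurableT_comp (mh k)).
apply: eq_bigr => S _.
have GAS : <<s past n.+1 >> (A `&` [set w | phi n.+1 w = S]).
  apply: (@measurableI _ (g_sigma_algebraType (past n.+1))) => //.
  exact: measurable_selected.
rewrite -(step_selected m n _ S s h H GAS) => // [|w []//].
apply: eq_integral => w _; congr (_%:E); rewrite !mulrA; congr (_ * _ * _).
by rewrite indicI/= mulrC.
Qed.

Lemma step_split_drift m n (A : set Omega) (s : 'I_M -> R)
    (h : 'I_M -> Y -> R) (H : 'I_M -> R) :
  <<s past n.+1 >> A ->
  (forall k, measurable_fun setT (h k)) -> (forall k y, 0 <= h k y) ->
  (forall k, \int[mu]_y (dens m k y * h k y)%:E = (H k)%:E)%E ->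
  (\int[P m]_w (\1_A w * expS s n w * \prod_(k in phi n.+1 w) h k (Z n.+1 k w))%:E =
   \int[P m]_w (\1_A w * expS s n w * \prod_(k in phi n.+1 w) H k)%:E)%E.
Proof.
move=> GA mh h0 hH; rewrite (step_split _ _ _ _ _ H)//.
have mA : measurable A by exact: spast_measurable GA.
have H0 k : 0 <= H k.
  by rewrite -lee_fin -hH; apply: integral_ge0 => y _; rewrite lee_fin mulr_ge0// dens_ge0.
rewrite (integral_selected m n
  (fun S w => \1_A w * expS s n w * \prod_(k in S) H k)); first last.
- by move=> S w; rewrite !mulr_ge0 ?expS_ge0// prodr_ge0.
- move=> S; apply: measurable_funM => //.
  by apply: measurable_funM => //; exact: measurable_expST.
apply: eq_bigr => S _; rewrite -ge0_integralZl//; first last.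
- by rewrite lee_fin prodr_ge0.
- by move=> w _; rewrite lee_fin mulr_ge0// expS_ge0.
- apply/measurable_EFinP/measurable_funM; last exact: measurable_expST.
  apply: measurable_indic; apply: measurableI => //.
  by apply: spast_measurable; exact: measurable_selected.
apply: eq_integral => w _; rewrite -EFinM; congr (_%:E).
by rewrite indicI/=; ring.
Qed.

Lemma step_expS m n (A : set Omega) (s kappa : 'I_M -> R) :
  <<s past n.+1 >> A ->
  (forall k, \int[mu]_y (dens m k y * expR (s k * llr y))%:E = (kappa k)%:E)%E ->
  (\int[P m]_w (\1_A w * expS s n.+1 w)%:E =
   \int[P m]_w (\1_A w * expS s n w * \prod_(k in phi n.+1 w) kappa k)%:E)%E.
Proof.
move=> GA hk; rewrite -(step_split_drift _ _ _ _ (fun k y => expR (s k * llr y)))//.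
- by apply: eq_integral => w _; rewrite expSS mulrA.
- move=> k; apply: (measurableT_comp (@measurable_expR R)).
  by apply: measurable_funM => //; exact: measurable_llr.
Qed.

(** As exponents in [expS], these weights give the likelihood ratio of hypothesis [j] to hypothesis
    [m] on the observed data: the two models differ only at the cells [j] and [m]. *)
Definition tilt (j m k : 'I_M) : R := (k == j)%:R - (k == m)%:R.

(** Mutual absolute continuity leaves, up to a null set, only points where both densities are
    positive or both vanish. *)
Lemma tilt_dens j m k : j != m ->
  {ae mu, forall y, dens m k y * expR (tilt j m k * llr y) = dens j k y}.
Proof.
move=> jm; apply: filterS2 f_ac_g g_ac_f => y fg gf.
rewrite /dens /tilt.
have key : (f y == 0) && (g y == 0) || (0 < f y) && (0 < g y).
  move: fg gf; rewrite !lt0r f0 g0 !andbT.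
  case: (f y == 0); case: (g y == 0) => //=; first by move=> _ /(_ isT).
  by move=> /(_ isT).
case/orP: key => [/andP[/eqP fy /eqP gy]|/andP[fy gy]].
  by rewrite !(fun_if (fun h => h y)) fy gy !if_same mul0r.
have [->|kj] := eqVneq k j.
  rewrite (negbTE jm) subr0 mul1r lnK ?posrE ?divr_gt0//.
  by rewrite mulrC divfK ?gt_eqF.
have [_|km] := eqVneq k m; last by rewrite subr0 mul0r expR0 mulr1.
rewrite sub0r mulN1r expRN lnK ?posrE ?divr_gt0// invf_div.
by rewrite mulrC divfK ?gt_eqF.
Qed.

Lemma sum_tilt j m n w : \sum_k tilt j m k * Sk n k w = Sk n j w - Sk n m w.
Proof.
have H i : \sum_k (k == i)%:R * Sk n k w = Sk n i w.
  rewrite (bigD1 i)//= eqxx mul1r big1 ?addr0// => k /negbTE ->.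
  by rewrite mul0r.
by rewrite -(H j) -(H m) -sumrB; apply: eq_bigr => k _; rewrite -mulrBl.
Qed.

Lemma expS_tilt j m n w : expS (tilt j m) n w = expR (Sk n j w - Sk n m w).
Proof. by rewrite /expS sum_tilt. Qed.

Lemma expS0 s w : expS s 0 w = 1.
Proof. by rewrite /expS big1 ?expR0// => k _; rewrite Sstat0 mulr0. Qed.

Lemma V_law j m A : measurable A -> P j (V @^-1` A) = P m (V @^-1` A).
Proof.
move=> mA.
have E i : fine (P i (V @^-1` A)) = fine (Q A).
  have := model i 0 A (fun _ _ => setT) mA (fun _ _ => measurableT).
  by rewrite big_ord0 mulr1 => <-; congr (fine (P i _)); apply/seteqP; split => w //= [].
have mVA : measurable (V @^-1` A) by rewrite -[_ @^-1` _]setTI; exact: mV.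
by rewrite -(fineK (fin_num_measure (P j) _ mVA)) -(fineK (fin_num_measure (P m) _ mVA)) !E.
Qed.

Lemma tilt_indic j m k B : j != m -> measurable B ->
  (\int[mu]_y (dens m k y * (\1_B y * expR (tilt j m k * llr y)))%:E =
   (fine (\int[mu]_(y in B) (dens j k y)%:E))%:E)%E.
Proof.
move=> jm mB; rewrite -dens_indic//; apply: ge0_ae_eq_integral => //.
- apply/measurable_EFinP/measurable_funM; first exact: mdens.
  apply: measurable_funM => //; apply: (measurableT_comp (@measurable_expR R)).
  by apply: measurable_funM => //; exact: measurable_llr.
- by apply/measurable_EFinP/measurable_funM => //; exact: mdens.
- by move=> y _; rewrite lee_fin !mulr_ge0 ?dens_ge0 ?expR_ge0.
- by move=> y _; rewrite lee_fin !mulr_ge0 ?dens_ge0.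
- apply: filterS (tilt_dens j m k jm) => y E _.
  by rewrite mulrCA E mulrC.
Qed.

(* False for events of the larger [past]: only the observed cells contribute to
   the likelihood ratio. *)
Lemma change_of_measure j m n A : j != m -> Fn n A ->
  (P j A = \int[P m]_w (\1_A w * expS (tilt j m) n w)%:E)%E.
Proof.
move=> jm; elim: n A => [|n IH] A.
  (* At time 0 the history is generated by the randomization variable alone, whose law is the same
     under all hypotheses. *)
  apply: (density_of_pi_system _ _ _ (P j) (P m)).
  - exact: measurable_expST.
  - by move=> w; exact: expS_ge0.
  - move=> E E' [[B [mB ->]]|[[s [k [/andP[]]]]|[s [k [B [/andP[]]]]]]]; try by case: s.
    move=> [[B' [mB' ->]]|[[s [k [/andP[]]]]|[s [k [B'' [/andP[]]]]]]]; try by case: s.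
    by left; exists (B `&` B'); split => //; exact: measurableI.
  - by move=> E HE; apply: (@F_measurable 0); exact: sub_sigma_algebra.
  - by left; exists setT; rewrite preimage_setT.
  - move=> E [[B [mB ->]]|[[s [k [/andP[]]]]|[s [k [B'' [/andP[]]]]]]]; try by case: s.
    under eq_integral do rewrite expS0 mulr1.
    rewrite integral_indic// ?setIT; first exact: V_law.
    by rewrite -[_ @^-1` _]setTI; exact: mV.
(* [G] is a pi-system generating the history at time n.+1. *)
pose sel (B : 'I_M -> set Y) := [set w | forall k, k \in phi n.+1 w -> B k (Z n.+1 k w)].
pose G := [set E | exists A0 B, [/\ Fn n A0, forall k, measurable (B k) & E = A0 `&` sel B]].
have FT : Fn n setT by exact: (@measurableT _ (g_sigma_algebraType (hist_gen Z V phi n))).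
have selT : sel (fun=> setT) = setT by apply/seteqP; split.
have G1 A0 : Fn n A0 -> G A0.
  by move=> FA; exists A0, (fun=> setT); split => //; rewrite selT setIT.
have msel B : (forall k, measurable (B k)) -> Fn n.+1 (sel B).
  move=> mB.
  have -> : sel B = \bigcap_(k in setT) (~` [set w | k \in phi n.+1 w] `|`
       [set w | k \in phi n.+1 w /\ B k (Z n.+1 k w)]).
    apply/seteqP; split => w /= H k; last by move=> kw; case: (H k I) => // -[].
    move=> _; have [kw|kw] := boolP (k \in phi n.+1 w).
      by right; split => //; exact: H.
    by left; exact/negP.
  apply: (@fin_bigcap_measurable _ (g_sigma_algebraType (hist_gen Z V phi n.+1))).
    exact: finite_finset.
  move=> k _; apply: (@measurableU _ (g_sigma_algebraType (hist_gen Z V phi n.+1))).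
    apply: (@measurableC _ (g_sigma_algebraType (hist_gen Z V phi n.+1))).
    by apply: sub_sigma_algebra; right; left; exists n.+1, k; rewrite leqnn.
  by apply: sub_sigma_algebra; right; right; exists n.+1, k, (B k); rewrite leqnn.
have GF E : G E -> Fn n.+1 E.
  move=> [A0 [B [FA mB ->]]].
  apply: (@measurableI _ (g_sigma_algebraType (hist_gen Z V phi n.+1))).
    exact: (@F_le n n.+1).
  exact: msel.
have FG : Fn n.+1 `<=` <<s G >>.
  apply: smallest_sub; first exact: smallest_sigma_algebra.
  move=> E [[B [mB ->]]|[[s [k [/andP[s0 sn] ->]]]|[s [k [B [/andP[s0 sn] [mB ->]]]]]]].
  - by apply: sub_sigma_algebra; apply: G1; apply: sub_sigma_algebra; left; exists B.
  - by apply: sub_sigma_algebra; apply: G1; apply: F_select; rewrite s0.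
  (* The conjunction is split into a selection event and an implication; for s = n.+1 the latter is
     of the form [sel]. *)
  - have -> : [set w | k \in phi s w /\ B (Z s k w)] =
       [set w | k \in phi s w] `&` [set w | k \in phi s w -> B (Z s k w)].
      by apply/seteqP; split => w /= [? H]; split => //; exact: H.
    apply: (@measurableI _ (g_sigma_algebraType G)).
      by apply: sub_sigma_algebra; apply: G1; apply: F_select; rewrite s0.
    move: sn; rewrite leq_eqVlt => /orP[/eqP ->|]; last first.
      rewrite ltnS => sn; apply: sub_sigma_algebra; apply: G1.
      have -> : [set w | k \in phi s w -> B (Z s k w)] =
         ~` [set w | k \in phi s w] `|` [set w | k \in phi s w /\ B (Z s k w)].
        apply/seteqP; split => w /=.
          move=> H; have [kw|/negP kw] := boolP (k \in phi s w); last by left.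
          by right; split => //; exact: H.
        by move=> [//|[_ ?] _].
      apply: (@measurableU _ (g_sigma_algebraType (hist_gen Z V phi n))).
        apply: (@measurableC _ (g_sigma_algebraType (hist_gen Z V phi n))).
        by apply: F_select; rewrite s0 leqW.
      by apply: sub_sigma_algebra; right; right; exists s, k, B; rewrite s0 sn.
    apply: sub_sigma_algebra; exists setT, (fun k' => if k' == k then B else setT).
    split => //; first by move=> k'; case: ifP.
    rewrite setTI; apply/seteqP; split => w /= H.
      by move=> k'; case: eqP => // ->.
    by move=> kw; have := H k kw; rewrite eqxx.
move=> /FG; apply: density_of_pi_system.
- exact: measurable_expST.
- by move=> w; exact: expS_ge0.
- move=> _ _ [A1 [B1 [F1 m1 ->]]] [A2 [B2 [F2 m2 ->]]].
  exists (A1 `&` A2), (fun k => B1 k `&` B2 k); split.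
  + exact: (@measurableI _ (g_sigma_algebraType (hist_gen Z V phi n))).
  + by move=> k; exact: measurableI.
  + apply/seteqP; split => w /=.
      by move=> [[w1 H1] [w2 H2]]; split => // k kw; split; [exact: H1|exact: H2].
    by move=> [[w1 w2] H]; split; split => // k kw; have [] := H k kw.
- by move=> E /GF; exact: F_measurable.
- exact: G1.
- move=> _ [A0 [B [FA mB ->]]].
  have GA : <<s past n.+1 >> A0 by exact: F_past.
  have indB w : \1_(A0 `&` sel B) w =
      \1_A0 w * \prod_(k in phi n.+1 w) \1_(B k) (Z n.+1 k w) :> R.
    rewrite indicI/=; congr (_ * _); rewrite indicE.
    have [wE|wE] := boolP (w \in sel B).
      rewrite big1// => k kw; rewrite indicE mem_set//; move: wE; rewrite inE; exact.
    apply/esym/eqP/prodf_eq0 => /=.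
    move: wE; rewrite notin_setE => /existsNP[k /not_implyP[kw wk]].
    by exists k => //; rewrite indicE memNset.
  (* The tilted moments under [m] and the plain ones under [j] are the same numbers [H], so the two
     expansions differ only in the events of time n, where the induction hypothesis applies. The
     exponent 0 makes [expS] equal to 1, which lets [step_split] compute a probability. *)
  pose H k := fine (\int[mu]_(y in B k) (dens j k y)%:E)%E.
  transitivity (\int[P j]_w (\1_A0 w * expS (fun=> 0) n w *
      \prod_(k in phi n.+1 w) \1_(B k) (Z n.+1 k w))%:E)%E.
    rewrite -[A0 `&` sel B]setIT -integral_indic; [|by []|by apply: (@F_measurable n.+1); apply: GF; exists A0, B].
    apply: eq_integral => w _; rewrite indB /expS.
    by rewrite [\sum_k _]big1 ?expR0 ?mulr1// => k _; rewrite mul0r.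
  rewrite (step_split _ _ _ _ (fun k => \1_(B k)) H)//; last first.
    by move=> k; exact: dens_indic.
  transitivity (\int[P m]_w (\1_A0 w * expS (tilt j m) n w *
      \prod_(k in phi n.+1 w) (\1_(B k) (Z n.+1 k w) *
         expR (tilt j m k * llr (Z n.+1 k w))))%:E)%E; last first.
    apply: eq_integral => w _; rewrite indB expSS big_split/=; congr (_%:E); ring.
  rewrite (step_split _ _ _ _ (fun k y => \1_(B k) y * expR (tilt j m k * llr y)) H)//.
  + apply: eq_bigr => S _; congr (_ * _)%E.
    have FAS : Fn n (A0 `&` [set w | phi n.+1 w = S]).
      apply: (@measurableI _ (g_sigma_algebraType (hist_gen Z V phi n))) => //.
      exact: phiF.
    rewrite -IH// -[in RHS](setIT (A0 `&` _)) -integral_indic//; last exact: F_measurable FAS.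
    apply: eq_integral => w _; rewrite /expS.
    by rewrite [\sum_k _]big1 ?expR0 ?mulr1// => k _; rewrite mul0r.
  + move=> k; apply: measurable_funM => //; apply: (measurableT_comp (@measurable_expR R)).
    by apply: measurable_funM => //; exact: measurable_llr.
  + by move=> k; exact: tilt_indic.
Qed.

(** * Decay of the potentials under a policy *)

(* [U' n] stands for the conditional expectation of [U n.+1] given the past. *)
Definition step_pair m (U U' : nat -> Omega -> R) := forall n,
  [/\ measurable_fun setT (U n), measurable_fun setT (U' n),
      (forall w, 0 <= U n w), (forall w, 0 <= U' n w) &
      (\int[P m]_w (U n.+1 w)%:E = \int[P m]_w (U' n w)%:E)%E].

Lemma step_pair_decay m U U' (r u0 : R) : step_pair m U U' -> 0 <= r ->
  (forall n w, U' n w <= r * U n w) -> (forall w, U 0%N w = u0) ->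
  forall n, (\int[P m]_w (U n w)%:E <= (r ^+ n * u0)%:E)%E.
Proof.
move=> UU r0 UU' U0; elim => [|n IH].
  under eq_integral do rewrite U0.
  rewrite (@integral_cst _ _ _ (P m) setT measurableT u0%:E).
  by rewrite [X in (_ * X)%E](probability_setT (P m)) mule1 mul1r.
have [mU mU' U0' U'0 ->] := UU n.
apply: (@le_trans _ _ (\int[P m]_w (r%:E * (U n w)%:E))%E).
  apply: ge0_le_integral => //.
  - by move=> w _; rewrite lee_fin.
  - exact/measurable_EFinP.
  - by apply: measurable_funeM; exact/measurable_EFinP.
  - by move=> w _; rewrite -EFinM lee_fin.
rewrite ge0_integralZl//; last first.
- by move=> w _; rewrite lee_fin.
- exact/measurable_EFinP.
by rewrite exprS -mulrA EFinM lee_wpmul2l.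
Qed.

Lemma step_pair_sum m (I : finType) (Qp : pred I) (U U' : I -> nat -> Omega -> R) :
  (forall i, Qp i -> step_pair m (U i) (U' i)) ->
  step_pair m (fun n w => \sum_(i | Qp i) U i n w) (fun n w => \sum_(i | Qp i) U' i n w).
Proof.
move=> H.
pose V1 i := if Qp i then U i else fun _ _ => 0.
pose V2 i := if Qp i then U' i else fun _ _ => 0.
have H' i : step_pair m (V1 i) (V2 i).
  rewrite /V1 /V2; case: ifPn => [/H//|_] n; split => //.
have -> : (fun n w => \sum_(i | Qp i) U i n w) = (fun n w => \sum_i V1 i n w).
  apply/funext => n; apply/funext => w; rewrite big_mkcond; apply: eq_bigr => i _.
  by rewrite /V1; case: ifP.
have -> : (fun n w => \sum_(i | Qp i) U' i n w) = (fun n w => \sum_i V2 i n w).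
  apply/funext => n; apply/funext => w; rewrite big_mkcond; apply: eq_bigr => i _.
  by rewrite /V2; case: ifP.
move=> n; split.
- by apply: measurable_sum => i; have [] := H' i n.
- by apply: measurable_sum => i; have [] := H' i n.
- by move=> w; apply: sumr_ge0 => i _; have [_ _ + _ _] := H' i n; exact.
- by move=> w; apply: sumr_ge0 => i _; have [_ _ _ + _] := H' i n; exact.
under eq_integral do rewrite -sumEFin; under [in RHS]eq_integral do rewrite -sumEFin.
rewrite !ge0_integral_sum//; first by apply: eq_bigr => i _; have [] := H' i n.
- by move=> i; apply/measurable_EFinP; have [] := H' i n.
- by move=> i w _; rewrite lee_fin; have [_ _ _ + _] := H' i n; exact.
- by move=> i; apply/measurable_EFinP; have [] := H' i n.+1.
- by move=> i w _; rewrite lee_fin; have [_ _ + _ _] := H' i n.+1; exact.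
Qed.

Lemma step_pair_lin m (c : R) U U' V1 V2 : 0 <= c ->
  step_pair m U U' -> step_pair m V1 V2 ->
  step_pair m (fun n w => U n w + c * V1 n w) (fun n w => U' n w + c * V2 n w).
Proof.
move=> c0 HU HV n.
have [mU mU' U0 U'0 E] := HU n; have [mV1 mV2 V10 V20 EV] := HV n.
have [mUS _ US0 _ _] := HU n.+1; have [mVS _ VS0 _ _] := HV n.+1.
have main (A B : Omega -> R) : measurable_fun setT A -> measurable_fun setT B ->
    (forall w, 0 <= A w) -> (forall w, 0 <= B w) ->
    (\int[P m]_w (A w + c * B w)%:E =
     \int[P m]_w (A w)%:E + c%:E * \int[P m]_w (B w)%:E)%E.
  move=> mA mB A0 B0.
  rewrite -ge0_integralZl//; first last.
  - by move=> w _; rewrite lee_fin.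
  - exact/measurable_EFinP.
  rewrite -ge0_integralD//.
  - by move=> w _; rewrite lee_fin.
  - exact/measurable_EFinP.
  - by move=> w _; rewrite -EFinM lee_fin mulr_ge0.
  - by apply: measurable_funeM; exact/measurable_EFinP.
split.
- by apply: measurable_funD => //; exact: measurable_funM.
- by apply: measurable_funD => //; exact: measurable_funM.
- by move=> w; rewrite addr_ge0// mulr_ge0.
- by move=> w; rewrite addr_ge0// mulr_ge0.
- by rewrite !main// E EV.
Qed.

Definition mgf_f s := fine (\int[mu]_y (f y * expR (s * llr y))%:E)%E.
Definition mgf_g s := fine (\int[mu]_y (g y * expR (s * llr y))%:E)%E.

Lemma mgf_f_ge0 s : 0 <= mgf_f s.
Proof.
apply: fine_ge0; apply: integral_ge0 => y _.
by rewrite lee_fin mulr_ge0 ?expR_ge0.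
Qed.

Lemma mgf_g_ge0 s : 0 <= mgf_g s.
Proof.
apply: fine_ge0; apply: integral_ge0 => y _.
by rewrite lee_fin mulr_ge0 ?expR_ge0.
Qed.

Lemma mgf_f0 : mgf_f 0 = 1.
Proof. by rewrite /mgf_f; under eq_integral do rewrite mul0r expR0 mulr1; rewrite f1. Qed.

Lemma mgf_fE s : `|s| <= e0 -> (\int[mu]_y (f y * expR (s * llr y))%:E = (mgf_f s)%:E)%E.
Proof.
move=> /Hf H; rewrite fineK// ge0_fin_numE; first exact: le_lt_trans H (ltry _).
by apply: integral_ge0 => y _; rewrite lee_fin mulr_ge0 ?expR_ge0.
Qed.

Lemma mgf_gE s : `|s| <= e0 -> (\int[mu]_y (g y * expR (s * llr y))%:E = (mgf_g s)%:E)%E.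
Proof.
move=> /Hg H; rewrite fineK// ge0_fin_numE; first exact: le_lt_trans H (ltry _).
by apply: integral_ge0 => y _; rewrite lee_fin mulr_ge0 ?expR_ge0.
Qed.

Lemma mgf_f_le s : `|s| <= e0 -> mgf_f s <= 1 - s * Dfg + C * s ^+ 2.
Proof. by move=> se; rewrite -lee_fin -mgf_fE//; exact: Hf. Qed.

Lemma mgf_g_le s : `|s| <= e0 -> mgf_g s <= 1 + s * Dgf + C * s ^+ 2.
Proof. by move=> se; rewrite -lee_fin -mgf_gE//; exact: Hg. Qed.

Definition mgf_at m (s : 'I_M -> R) k := if k == m then mgf_g (s k) else mgf_f (s k).

Lemma mgf_atE m s k : `|s k| <= e0 ->
  (\int[mu]_y (dens m k y * expR (s k * llr y))%:E = (mgf_at m s k)%:E)%E.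
Proof. by move=> se; rewrite /dens /mgf_at; case: ifP => _; [exact: mgf_gE|exact: mgf_fE]. Qed.

Lemma mgf_at_ge0 m s k : 0 <= mgf_at m s k.
Proof. by rewrite /mgf_at; case: ifP => _; [exact: mgf_g_ge0|exact: mgf_f_ge0]. Qed.

Lemma mgf_at_target m s : mgf_at m s m = mgf_g (s m).
Proof. by rewrite /mgf_at eqxx. Qed.

Lemma mgf_at_other m s k : k != m -> mgf_at m s k = mgf_f (s k).
Proof. by rewrite /mgf_at => /negbTE ->. Qed.

Lemma drift1 (sel : {set 'I_M}) (k : 'I_M) : drift R M sel 1 k = 1.
Proof. exact: if_same. Qed.

Lemma prod_selectedE n w (c : 'I_M -> R) :
  \prod_(k in phi n.+1 w) c k = \prod_k drift _ _ (phi n.+1 w) (c k) k.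
Proof. by rewrite big_mkcond. Qed.

Lemma step_pair_expS m s : (forall k, `|s k| <= e0) ->
  step_pair m (expS s) (fun n w => expS s n w * \prod_(k in phi n.+1 w) mgf_at m s k).
Proof.
move=> se n; split.
- exact: measurable_expST.
- apply: measurable_funM; first exact: measurable_expST.
  under eq_fun do rewrite prod_selectedE.
  apply: measurable_prod => k _; apply: measurable_fun_ifT => //.
  apply: (measurable_fun_bool true); rewrite setTI.
  by apply: (@F_measurable n); apply: F_select; rewrite /= leqnn.
- by move=> w; exact: expS_ge0.
- move=> w; rewrite mulr_ge0 ?expS_ge0// prodr_ge0// => k _; exact: mgf_at_ge0.
have GT : <<s past n.+1 >> setT.
  exact: (@measurableT _ (g_sigma_algebraType (past n.+1))).
have := step_expS m n setT s (mgf_at m s) GT (fun k => mgf_atE m s k (se k)).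
under eq_integral do rewrite indicT mul1r.
by move=> ->; under eq_integral do rewrite indicT mul1r.
Qed.

Lemma expS_scale_tilt s j m n w :
  expS (fun k => s * tilt j m k) n w = wt _ _ m (fun k => Sk n k w) s j.
Proof.
rewrite /expS /wt -sum_tilt mulr_sumr; congr expR.
by apply: eq_bigr => k _; rewrite mulrA.
Qed.

Lemma expS_scale_tilt2 s i j m n w :
  expS (fun k => s * (tilt i m k + tilt j m k)) n w =
  wt _ _ m (fun k => Sk n k w) s i * wt _ _ m (fun k => Sk n k w) s j.
Proof.
rewrite /expS /wt -expRD -mulrDr -!sum_tilt -big_split/= mulr_sumr; congr expR.
by apply: eq_bigr => k _; rewrite -mulrDl mulrA.
Qed.

Lemma tilt_self j m : j != m -> tilt j m j = 1.
Proof. by move=> jm; rewrite /tilt eqxx (negbTE jm) subr0. Qed.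

Lemma tilt_target j m : j != m -> tilt j m m = -1.
Proof. by move=> jm; rewrite /tilt eqxx eq_sym (negbTE jm) sub0r. Qed.

Lemma tilt_other j m k : k != j -> k != m -> tilt j m k = 0.
Proof. by move=> /negbTE kj /negbTE km; rewrite /tilt kj km subr0. Qed.

(** A term of [pot1] has exponent s at [j], - s at the target and 0 elsewhere. *)
Lemma step_pair_pot1 m s : `|s| <= e0 ->
  step_pair m (fun n w => pot1 _ _ m (fun k => Sk n k w) s)
    (fun n w => pot1_next _ _ m (fun k => Sk n k w) (phi n.+1 w) s (mgf_f s) (mgf_g (- s))).
Proof.
move=> se.
have -> : (fun n w => pot1 _ _ m (fun k => Sk n k w) s) =
    (fun n w => \sum_(j | j != m) expS (fun k => s * tilt j m k) n w).
  apply/funext => n; apply/funext => w; apply: eq_bigr => j _.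
  by rewrite expS_scale_tilt.
have -> : (fun n w => pot1_next _ _ m (fun k => Sk n k w) (phi n.+1 w) s (mgf_f s) (mgf_g (- s))) =
    (fun n w => \sum_(j | j != m) expS (fun k => s * tilt j m k) n w *
       \prod_(k in phi n.+1 w) mgf_at m (fun k => s * tilt j m k) k).
  apply/funext => n; apply/funext => w; apply: eq_bigr => j jm.
  rewrite expS_scale_tilt prod_selectedE (bigD1 j)//= (bigD1 m)/=; last by rewrite eq_sym.
  rewrite [X in _ * (_ * (_ * X))]big1 ?mulr1; last first.
    move=> k /andP[kj km].
    by rewrite (mgf_at_other _ _ _ km) (tilt_other _ _ _ kj km) mulr0 mgf_f0 drift1.
  rewrite (mgf_at_other _ _ _ jm) mgf_at_target (tilt_self _ _ jm) (tilt_target _ _ jm).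
  by rewrite mulr1 mulrN1.
apply: step_pair_sum => j jm; apply: step_pair_expS => k.
have [->|kj] := eqVneq k j; first by rewrite tilt_self// mulr1.
have [->|km] := eqVneq k m; first by rewrite tilt_target// mulrN1 normrN.
by rewrite tilt_other// mulr0 normr0 ltW.
Qed.

(** Both weights of a pair refer to the target, whose exponent is therefore - 2 s. *)
Lemma step_pair_pot2 m s : `|2 * s| <= e0 ->
  step_pair m (fun n w => pot2 _ _ m (fun k => Sk n k w) s)
    (fun n w => pot2_next _ _ m (fun k => Sk n k w) (phi n.+1 w) s (mgf_f s) (mgf_g (- (2 * s)))).
Proof.
move=> se.
have se1 : `|s| <= e0.
  by apply: le_trans se; rewrite normrM ler_peMl// ger0_norm// ler1n.
have -> : (fun n w => pot2 _ _ m (fun k => Sk n k w) s) =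
    (fun n w => \sum_(i | i != m) \sum_(j | (j != m) && (j != i))
        expS (fun k => s * (tilt i m k + tilt j m k)) n w).
  apply/funext => n; apply/funext => w; apply: eq_bigr => i _; apply: eq_bigr => j _.
  by rewrite expS_scale_tilt2.
have -> : (fun n w => pot2_next _ _ m (fun k => Sk n k w) (phi n.+1 w) s (mgf_f s) (mgf_g (- (2 * s)))) =
    (fun n w => \sum_(i | i != m) \sum_(j | (j != m) && (j != i))
       expS (fun k => s * (tilt i m k + tilt j m k)) n w *
       \prod_(k in phi n.+1 w) mgf_at m (fun k => s * (tilt i m k + tilt j m k)) k).
  apply/funext => n; apply/funext => w; apply: eq_bigr => i im; apply: eq_bigr => j.
  move=> /andP[jm ji]; have ij : i != j by rewrite eq_sym.
  rewrite expS_scale_tilt2 prod_selectedE (bigD1 i)//= (bigD1 j)//= (bigD1 m)/=; last first.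
    by rewrite ![m == _]eq_sym im jm.
  rewrite big1 ?mulr1; last first.
    move=> k /andP[/andP[ki kj] km].
    rewrite (mgf_at_other _ _ _ km) (tilt_other _ _ _ ki km) (tilt_other _ _ _ kj km).
    by rewrite addr0 mulr0 mgf_f0 drift1.
  rewrite (mgf_at_other _ _ _ jm) (mgf_at_other _ _ _ im) mgf_at_target.
  rewrite (tilt_self _ _ jm) (tilt_self _ _ im) (tilt_target _ _ jm) (tilt_target _ _ im).
  rewrite (tilt_other _ _ _ ji jm) (tilt_other _ _ _ ij im).
  rewrite addr0 add0r mulr1 (_ : s * (-1 - 1) = - (2 * s)); last by ring.
  by rewrite !mulrA.
apply: step_pair_sum => i im; apply: step_pair_sum => j /andP[jm ji]; apply: step_pair_expS => k.
have ij : i != j by rewrite eq_sym.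
have [->|km] := eqVneq k m.
  by rewrite !tilt_target// (_ : s * (-1 - 1) = - (2 * s)) ?normrN//; ring.
have [->|ki] := eqVneq k i; first by rewrite tilt_self// tilt_other// addr0 mulr1.
have [->|kj] := eqVneq k j; first by rewrite tilt_self// tilt_other// add0r mulr1.
by rewrite !tilt_other// addr0 mulr0 normr0 ltW.
Qed.

(* Drift of the mean over j <> m of S_m - S_j when [sel] is observed. *)
Definition rate (m : 'I_M) (sel : {set 'I_M}) : R :=
  share R M m sel * Dfg + (if m \in sel then Dgf else 0).

(** The target is left out of the comparison because the sum [pot1] runs over the other cells. *)
Definition dominated (m : 'I_M) (S : 'I_M -> R) (sel : {set 'I_M}) := forall i j,
  i \in sel -> j \notin sel -> i != m -> j != m -> S j <= S i.

Lemma share_ge0 m sel : 0 <= share R M m sel.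
Proof. by rewrite divr_ge0. Qed.

Lemma share_le1 m sel : share R M m sel <= 1.
Proof.
rewrite /share ler_pdivrMr ?M1_gt0// mul1r ler_nat.
have -> : M.-1 = #|[set~ m]%SET| by rewrite cardsC1 card_ord.
by apply/subset_leq_card/fintype.subsetP => j; rewrite !inE => /andP[].
Qed.

Lemma share_card m (sel : {set 'I_M}) :
  share R M m sel = (#|sel| - (m \in sel))%:R / (M.-1)%:R.
Proof. by rewrite /share (cardsD1 m sel) addKn. Qed.

Definition rate_min := Num.min Dgf (Dfg / (M.-1)%:R).

Lemma rate_min_gt0 : 0 < rate_min.
Proof. by rewrite lt_min Dgf0/= divr_gt0// M1_gt0. Qed.

Lemma rate_min_le_Dfg : rate_min <= Dfg.
Proof.
have M1 : 1 <= (M.-1)%:R :> R by rewrite ler1n; case: M M2 => [|[]].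
by rewrite ge_min ler_pdivrMr ?M1_gt0// ler_peMr ?orbT// ltW.
Qed.

Lemma rate_ge m (sel : {set 'I_M}) : (0 < #|sel|)%N -> rate_min <= rate m sel.
Proof.
move=> sel0; rewrite /rate ge_min; case: (boolP (m \in sel)) => msel.
  by apply/orP; left; rewrite lerDr mulr_ge0 ?share_ge0// ltW.
apply/orP; right; rewrite addr0 share_card (negbTE msel) subn0 mulrAC.
by rewrite ler_pM2r ?invr_gt0 ?M1_gt0// ler_peMl ?(ltW Dfg0)// ler1n.
Qed.

Lemma expRN_mono (s a b x : R) : 0 <= s -> a <= b -> expR (- (s * b) + x) <= expR (- (s * a) + x).
Proof. by move=> s0 ab; rewrite ler_expR lerD2r lerN2 ler_wpM2l. Qed.

Lemma mgf_f_le1 s : 0 < s <= e0 -> C * s <= Dfg -> mgf_f s <= 1.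
Proof.
move=> /andP[s0 se] Cs; have := mgf_f_le s; rewrite gtr0_norm// => /(_ se).
have : s * (C * s) <= s * Dfg by rewrite ler_pM2l.
rewrite expr2; lra.
Qed.

Lemma drift_mgf_g_le m (sel : {set 'I_M}) s : 0 < s <= e0 ->
  drift R M sel (mgf_g (- s)) m <=
  expR (- (s * (if m \in sel then Dgf else 0)) + C * s ^+ 2).
Proof.
move=> /andP[s0 se]; rewrite /drift; case: ifP => _.
  apply: (@le_trans _ _ (1 + (- (s * Dgf) + C * s ^+ 2))); last exact: expR_ge1Dx.
  have := mgf_g_le (- s); rewrite normrN gtr0_norm// => /(_ se).
  by rewrite sqrrN mulNr addrA.
by rewrite mulr0 oppr0 add0r -[leLHS]expR0 ler_expR mulr_ge0 ?sqr_ge0// ltW.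
Qed.

(** The factor of the empty cells and that of the target are each bounded through 1 + x <= exp x
    with an error C s^2, hence the 2 in the exponent. *)
Lemma pot1_next_le_rate m S sel s : 0 < s <= e0 -> C * s <= Dfg -> dominated m S sel ->
  pot1_next R M m S sel s (mgf_f s) (mgf_g (- s)) <=
  expR (- (s * rate m sel) + 2 * C * s ^+ 2) * pot1 R M m S s.
Proof.
move=> se Cs dom; have /andP[s0 se'] := se.
have u1 := mgf_f_le1 _ se Cs.
apply: (le_trans (pot1_next_dominated _ _ _ _ _ M2 s _ _ (ltW s0) _ (mgf_g_ge0 _) dom)).
  by rewrite mgf_f_ge0.
rewrite ler_wpM2r ?pot1_ge0//.
have -> : - (s * rate m sel) + 2 * C * s ^+ 2 =
   (- (s * (share R M m sel * Dfg)) + C * s ^+ 2) +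
   (- (s * (if m \in sel then Dgf else 0)) + C * s ^+ 2).
  by rewrite /rate; set dg := (if _ then _ else _); ring.
rewrite expRD; apply: ler_pM => //.
- rewrite subr_ge0; apply: (@le_trans _ _ (1 * 1)); last by rewrite mulr1.
  by rewrite ler_pM ?subr_ge0 ?share_ge0 ?share_le1// lerBlDr lerDl mgf_f_ge0.
- by rewrite drift_ge0// mgf_g_ge0.
- apply: (@le_trans _ _ (1 + (- (s * (share R M m sel * Dfg)) + C * s ^+ 2))); last exact: expR_ge1Dx.
  have := mgf_f_le s; rewrite gtr0_norm// => /(_ se') H.
  have q0 := share_ge0 m sel; have q1 := share_le1 m sel.
  set q := share R M m sel in q0 q1 *.
  have H1 : q * (mgf_f s - 1) <= q * (- (s * Dfg) + C * s ^+ 2) by rewrite ler_wpM2l//; lra.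
  have Cs2 : 0 <= C * s ^+ 2 by rewrite mulr_ge0 ?sqr_ge0// ltW.
  have H2 : q * (C * s ^+ 2) <= 1 * (C * s ^+ 2) by rewrite ler_wpM2r.
  have -> : 1 - (1 - mgf_f s) * q = 1 + q * (mgf_f s - 1) by ring.
  have : q * (- (s * Dfg) + C * s ^+ 2) = - (s * (q * Dfg)) + q * (C * s ^+ 2) by ring.
  lra.
- exact: drift_mgf_g_le.
Qed.

(** The bound e0 / 2 admits the exponent 2 s of [pot2]; the other one keeps the quadratic errors, at
    most 4 C s^2, below half of the drift s [rate_min]. *)
Definition crude_s := Num.min (e0 / 2) (rate_min / (8 * C)).

Lemma crude_s_gt0 : 0 < crude_s.
Proof. by rewrite lt_min divr_gt0//= divr_gt0 ?rate_min_gt0// mulr_gt0. Qed.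

Lemma crude_s_props s : 0 < s <= crude_s ->
  [/\ 0 < s <= e0, 2 * s <= e0, C * s <= Dfg & 8 * (C * s) <= rate_min].
Proof.
move=> /andP[s0]; rewrite le_min ler_pdivlMr// => /andP[se].
rewrite ler_pdivlMr ?mulr_gt0// => sr.
have r8 : 8 * (C * s) <= rate_min by lra.
have Cs0 : 0 <= C * s by rewrite mulr_ge0 ?ltW.
have rD := rate_min_le_Dfg.
by split; lra.
Qed.

(* A potential with the fixed exponent [crude_s] that decays in every
   configuration, at a rate that need not be optimal. *)
Definition crude (m : 'I_M) (S : 'I_M -> R) B := pot1 R M m S crude_s + B * pot2 R M m S crude_s.

Definition crude_next (m : 'I_M) (S : 'I_M -> R) sel B :=
  pot1_next R M m S sel crude_s (mgf_f crude_s) (mgf_g (- crude_s)) +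
  B * pot2_next R M m S sel crude_s (mgf_f crude_s) (mgf_g (- (2 * crude_s))).

Definition outranked2 (m : 'I_M) (S : 'I_M -> R) := exists k0 m1,
  [/\ k0 != m, m1 != m, m1 != k0, S m <= S k0 & S m <= S m1].

(** When the target is unobserved, at most one unobserved cell, [m1], may rank above observed ones:
    the DGF rule skips at most the top cell. *)
Definition near_top (m : 'I_M) (S : 'I_M -> R) (sel : {set 'I_M}) := exists m1,
  m \notin sel -> (exists k, k \in sel) /\
    (forall i j, i \in sel -> j \notin sel -> j != m1 -> S j <= S i).

(** [pot2] shrinks in all cases. So does [pot1] unless the target is unobserved and outranked by two
    cells; then [pot1] is at most M times [pot2], and the weight [B] lets the decay of [pot2] pay
    for it. *)
Lemma crude_decay m : exists2 B : R, 0 <= B & exists2 r : R, 0 < r < 1 &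
  forall S (sel : {set 'I_M}), (0 < #|sel|)%N ->
    dominated m S sel \/ m \in sel \/ outranked2 m S -> near_top m S sel ->
    crude_next m S sel B <= r * crude m S B.
Proof.
have [/andP[s0 se] se2 Cs r8] := crude_s_props crude_s (introT andP (conj crude_s_gt0 (lexx _))).
have ss : 0 < crude_s <= e0 by rewrite s0.
set s := crude_s in s0 se se2 Cs r8 ss *.
pose u := mgf_f s; pose v := mgf_g (- s); pose v2 := mgf_g (- (2 * s)).
have Cs2 : C * s ^+ 2 = s * (C * s) by ring.
have sD : 0 < s * Dfg by rewrite mulr_gt0.
have rmin0 := rate_min_gt0.
have rD : rate_min <= Dgf by rewrite ge_min lexx.
have srm : s * (8 * (C * s)) <= s * rate_min by rewrite ler_pM2l.
have srmD : s * rate_min <= s * Dfg by rewrite ler_pM2l// rate_min_le_Dfg.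
have srmD' : s * rate_min <= s * Dgf by rewrite ler_pM2l.
have srm0 : 0 < s * rate_min by rewrite mulr_gt0.
have sCs0 : 0 <= s * (C * s) by rewrite !mulr_ge0// ltW.
have u01 : 0 <= u <= 1 by rewrite mgf_f_ge0 mgf_f_le1.
have ult : u < 1.
  have := mgf_f_le s; rewrite gtr0_norm// => /(_ se); rewrite -/u Cs2; lra.
pose r1 := expR (- (s * rate_min) + 2 * C * s ^+ 2).
have r1lt : r1 < 1 by rewrite -[ltRHS]expR0 ltr_expR -mulrA Cs2; lra.
have r10 : 0 < r1 by exact: expR_gt0.
have vr1 : v <= r1.
  apply: (@le_trans _ _ (1 + (- (s * rate_min) + 2 * C * s ^+ 2))); last exact: expR_ge1Dx.
  have := mgf_g_le (- s); rewrite normrN gtr0_norm// => /(_ se).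
  rewrite -/v sqrrN -mulrA Cs2; lra.
have v2lt : v2 < 1.
  have := mgf_g_le (- (2 * s)); rewrite normrN gtr0_norm ?mulr_gt0// => /(_ se2).
  rewrite -/v2 sqrrN exprMn mulrCA (_ : 2 ^+ 2 = 4) ?Cs2; last by ring.
  lra.
pose r2 := Num.max v2 (1 - (1 - u) / M%:R ^+ 2).
have Mpos : 0 < M%:R :> R by rewrite ltr0n ltnW.
have r2lt : r2 < 1.
  by rewrite gt_max v2lt ltrBlDr ltrDl divr_gt0 ?subr_gt0 ?exprn_gt0.
have r20 : 0 <= r2 by rewrite le_max mgf_g_ge0.
(* Half of what B [pot2] loses in a step covers M [pot2]; the other half leaves the ratio (1 + r2) /
   2. *)
pose B := 2 * M%:R / (1 - r2).
have B0 : 0 < B by rewrite divr_gt0 ?mulr_gt0// subr_gt0.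
pose r := Num.max r1 ((1 + r2) / 2).
exists B; first exact: ltW.
exists r; first by rewrite lt_max r10 gt_max r1lt /=; lra.
move=> S sel sel0 mid [m1 top].
have P1 := pot1_ge0 R M m S s; have P2 := pot2_ge0 R M m S s.
have next2 : pot2_next R M m S sel s u v2 <= r2 * pot2 R M m S s.
  apply: (pot2_next_le _ _ _ _ _ M2 s u v2 m1 (ltW s0) u01) => //.
  by rewrite mgf_g_ge0 ltW.
have BM : B * (1 - r2) = 2 * M%:R by rewrite /B divfK// subr_eq0 gt_eqF.
have next1 : pot1_next R M m S sel s u v <= r1 * pot1 R M m S s + M%:R * pot2 R M m S s.
  have [msel|msel] := boolP (m \in sel).
    apply: (@le_trans _ _ (r1 * pot1 R M m S s)); last by rewrite lerDl mulr_ge0// ltW.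
    apply: (le_trans (pot1_next_le R M m S sel s u v u01 (mgf_g_ge0 _))).
    by rewrite ler_wpM2r// /drift msel.
  case: mid => [dom|[msel'|[k0 [m2 [k0m m2m m2k0 Sk0 Sm2]]]]].
  - apply: (@le_trans _ _ (r1 * pot1 R M m S s)); last by rewrite lerDl mulr_ge0// ltW.
    apply: (le_trans (pot1_next_le_rate _ _ _ _ ss Cs dom)).
    rewrite ler_wpM2r//; apply: expRN_mono; first exact: ltW.
    exact: rate_ge.
  - by rewrite msel' in msel.
  - have le12 := pot1_le_pot2 R M m S s k0 m2 (ltW s0) k0m m2m m2k0 Sk0 Sm2.
    apply: (le_trans (pot1_next_le R M m S sel s u v u01 (mgf_g_ge0 _))).
    rewrite /drift (negbTE msel) mul1r; apply: (le_trans le12).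
    by rewrite lerDr mulr_ge0// ltW.
rewrite /crude_next /crude -/s -/u -/v -/v2.
have rr1 : r1 * pot1 R M m S s <= r * pot1 R M m S s by rewrite ler_wpM2r// le_max lexx.
have rr2 : (1 + r2) / 2 * (B * pot2 R M m S s) <= r * (B * pot2 R M m S s).
  by rewrite ler_wpM2r// ?le_max ?lexx ?orbT// mulr_ge0// ltW.
have Bnext2 : B * pot2_next R M m S sel s u v2 <= B * (r2 * pot2 R M m S s).
  by rewrite ler_wpM2l// ltW.
have E : (1 + r2) / 2 * (B * pot2 R M m S s) =
   B * (r2 * pot2 R M m S s) + (B * (1 - r2)) / 2 * pot2 R M m S s by field.
rewrite BM in E.
have E2 : 2 * M%:R / 2 * pot2 R M m S s = M%:R * pot2 R M m S s by congr (_ * _); field.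
rewrite mulrDr; lra.
Qed.

(** What the decay of the potentials uses of the DGF rule. By the second clause the rate [I] is
    reached unless another cell ranks at least as high as the target. *)
Definition dgf_like (m : 'I_M) (I : R) (S : 'I_M -> R) (sel : {set 'I_M}) :=
  [/\ (0 < #|sel|)%N,
      dominated m S sel /\ rate m sel = I \/ (exists2 j, j != m & S m <= S j),
      dominated m S sel \/ m \in sel \/ outranked2 m S &
      near_top m S sel].

(* The optimal rate is missed only if some S_j >= S_m; then [pot1] with the small
   exponent [s] is at most M times [crude], whose decay does not depend on [s]. *)
Lemma potential_decay m (I eps : R) : 0 < I -> 0 < eps ->
  exists s B B0 : R, [/\ 0 < s <= e0, 0 <= B, 0 <= B0 &
    forall S (sel : {set 'I_M}), dgf_like m I S sel ->
    pot1_next R M m S sel s (mgf_f s) (mgf_g (- s)) + B * crude_next m S sel B0 <=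
    expR (- (s * (I - eps))) * (pot1 R M m S s + B * crude m S B0)].
Proof.
move=> I0 eps0.
have [B0 B0pos [r0 /andP[r0pos r0lt] crudeH]] := crude_decay m.
(* The second bound makes the quadratic error 2 C s^2 at most s eps. The third gives s I <= (1 - r0)
   / 2, so that the required ratio [rho] stays above (1 + r0) / 2 and [crude] decays faster than
   required. *)
pose s := Num.min crude_s (Num.min (eps / (2 * C)) ((1 - r0) / (2 * I))).
have s0 : 0 < s.
  by rewrite lt_min crude_s_gt0/= lt_min !divr_gt0 ?mulr_gt0 ?subr_gt0.
have sc : s <= crude_s by rewrite ge_min lexx.
have s1 : 2 * C * s <= eps.
  rewrite mulrC -ler_pdivlMr ?mulr_gt0//.
  by rewrite /s ge_min; apply/orP; right; rewrite ge_min lexx.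
have s2 : s * I <= (1 - r0) / 2.
  rewrite (_ : (1 - r0) / 2 = (1 - r0) / (2 * I) * I); last by field; rewrite gt_eqF.
  rewrite ler_pM2r//.
  by rewrite /s ge_min; apply/orP; right; rewrite ge_min lexx orbT.
have [ss se2 Cs _] : [/\ 0 < s <= e0, 2 * s <= e0, C * s <= Dfg & 8 * (C * s) <= rate_min].
  by apply: crude_s_props; rewrite s0.
have /andP[_ se] := ss.
pose rho := expR (- (s * (I - eps))).
have rho_ge : (1 + r0) / 2 <= rho.
  apply: (@le_trans _ _ (1 + - (s * (I - eps)))); last exact: expR_ge1Dx.
  have : 0 <= s * eps by rewrite mulr_ge0 ?ltW.
  rewrite mulrBr; lra.
(* The surplus decay of B [crude] covers M [crude], which bounds the small-exponent [pot1] while the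
   ranking is wrong. *)
pose B := 2 * M%:R / (1 - r0).
have Bpos : 0 <= B by rewrite divr_ge0 ?mulr_ge0// subr_ge0 ltW.
have BM : B * (1 - r0) = 2 * M%:R by rewrite /B divfK// subr_eq0 gt_eqF.
exists s, B, B0; split=> // S sel [sel0 fast mid top]; rewrite -/rho.
  have cr : crude_next m S sel B0 <= r0 * crude m S B0.
    exact: crudeH.
  have P1 := pot1_ge0 R M m S s.
  have P1c := pot1_ge0 R M m S crude_s; have P2c := pot2_ge0 R M m S crude_s.
  have Pc : 0 <= crude m S B0 by rewrite addr_ge0// mulr_ge0.
  have P1crude : pot1 R M m S crude_s <= crude m S B0 by rewrite lerDl mulr_ge0.
  have Bcr : B * crude_next m S sel B0 <= B * (r0 * crude m S B0) by rewrite ler_wpM2l.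
  have Brho : (1 + r0) / 2 * (B * crude m S B0) <= rho * (B * crude m S B0).
    by rewrite ler_wpM2r// mulr_ge0.
  have E : (1 + r0) / 2 * (B * crude m S B0) = B * (r0 * crude m S B0) +
     M%:R * crude m S B0.
    have -> : (1 + r0) / 2 * (B * crude m S B0) = B * (r0 * crude m S B0) +
      (B * (1 - r0)) / 2 * crude m S B0 by field.
    by rewrite BM; congr (_ + _ * _); field.
  have Mc : 0 <= M%:R * crude m S B0 by rewrite mulr_ge0.
  have rho0 : 0 <= rho * pot1 R M m S s by rewrite mulr_ge0// expR_ge0.
  rewrite [leRHS]mulrDr; case: fast => [[dom rE]|[j jm Sj]].
    have H := pot1_next_le_rate m S sel s ss Cs dom.
    have H2 : expR (- (s * rate m sel) + 2 * C * s ^+ 2) * pot1 R M m S s <=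
        rho * pot1 R M m S s.
      rewrite ler_wpM2r// ler_expR rE.
      have : s * (2 * C * s) <= s * eps by rewrite ler_pM2l.
      rewrite expr2 mulrBr; lra.
    lra.
  have H : pot1_next R M m S sel s (mgf_f s) (mgf_g (- s)) <= pot1 R M m S s.
    apply: (le_trans (pot1_next_le R M m S sel s _ _ _ (mgf_g_ge0 _))).
      by rewrite mgf_f_ge0 mgf_f_le1.
    rewrite ler_piMl// drift_le1//.
    have := mgf_g_le (- s); rewrite normrN gtr0_norm// => /(_ se).
    rewrite sqrrN; have : s * (8 * (C * s)) <= s * Dgf.
      rewrite ler_pM2l//.
      have [_ _ _ r8] := crude_s_props s (introT andP (conj s0 sc)).
      by rewrite (le_trans r8)// ge_min lexx.
    have : 0 <= s * (C * s) by rewrite !mulr_ge0 ?ltW.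
    rewrite expr2; lra.
  have H2 := pot1_le_pot1 R M m S s crude_s j.
  have {}H2 : pot1 R M m S s <= M%:R * pot1 R M m S crude_s.
    by apply: H2 => //; rewrite (ltW s0).
  have H3 : M%:R * pot1 R M m S crude_s <= M%:R * crude m S B0 by rewrite ler_wpM2l.
  lra.
Qed.

(** Value of the combined potential at time 0, where every weight is 1. *)
Definition pot_init (m : 'I_M) (B B0 : R) : R := \sum_(j < M | j != m) (1 : R) +
  B * (\sum_(j < M | j != m) 1 +
       B0 * \sum_(i < M | i != m) \sum_(j < M | (j != m) && (j != i)) 1).

Lemma pot_init_ge0 m B B0 : 0 <= B -> 0 <= B0 -> 0 <= pot_init m B B0.
Proof.
move=> B_ge0 B0_ge0; rewrite addr_ge0 ?sumr_ge0// mulr_ge0// addr_ge0 ?sumr_ge0// mulr_ge0//.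
by apply: sumr_ge0 => i _; exact: sumr_ge0.
Qed.

Lemma pot1_tail m (I eps s B B0 : R) : 0 < s <= e0 -> 0 <= B -> 0 <= B0 ->
  (forall S (sel : {set 'I_M}), dgf_like m I S sel ->
    pot1_next R M m S sel s (mgf_f s) (mgf_g (- s)) + B * crude_next m S sel B0 <=
    expR (- (s * (I - eps))) * (pot1 R M m S s + B * crude m S B0)) ->
  (forall n w, dgf_like m I (fun k => Sk n k w) (phi n.+1 w)) ->
  forall n, (\int[P m]_w (pot1 R M m (fun k => Sk n k w) s)%:E <=
      (pot_init m B B0 * expR (- (s * (I - eps))) ^+ n)%:E)%E.
Proof.
move=> /andP[s0 se] B_ge0 B0_ge0 decayS dgf.
have [/andP[c0 ce] ce2 _ _] := crude_s_props crude_s (introT andP (conj crude_s_gt0 (lexx _))).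
pose rho := expR (- (s * (I - eps))).
pose U n w := pot1 R M m (fun k => Sk n k w) s + B * crude m (fun k => Sk n k w) B0.
pose U' n w := pot1_next R M m (fun k => Sk n k w) (phi n.+1 w) s (mgf_f s) (mgf_g (- s)) +
   B * crude_next m (fun k => Sk n k w) (phi n.+1 w) B0.
have UU' : step_pair m U U'.
  apply: step_pair_lin => //; first by apply: step_pair_pot1; rewrite gtr0_norm.
  apply: step_pair_lin => //; first by apply: step_pair_pot1; rewrite gtr0_norm.
  by apply: step_pair_pot2; rewrite gtr0_norm// mulr_gt0.
have decay n w : U' n w <= rho * U n w by exact: decayS.
have U0 w : U 0%N w = pot_init m B B0.
  have W (s' : R) j : wt R M m (fun k => Sk 0 k w) s' j = 1.
    by rewrite /wt !Sstat0 subrr mulr0 expR0.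
  rewrite /U /pot_init /crude /pot1 /pot2; congr (_ + _ * (_ + _ * _)).
  - by apply: eq_bigr => j _; exact: W.
  - by apply: eq_bigr => j _; exact: W.
  - by apply: eq_bigr => i _; apply: eq_bigr => j _; rewrite !W mulr1.
move=> n; have := step_pair_decay m U U' rho _ UU' (expR_ge0 _) decay U0 n.
rewrite [rho ^+ n * _]mulrC.
apply: le_trans; have [mU _ _ _ _] := UU' n.
apply: ge0_le_integral => //.
- by move=> w _; rewrite lee_fin pot1_ge0.
- apply/measurable_EFinP.
  have se' : `|s| <= e0 by rewrite gtr0_norm.
  by have [] := step_pair_pot1 m s se' n.
- exact/measurable_EFinP.
- move=> w _; rewrite lee_fin /U lerDl mulr_ge0// /crude.
  by rewrite addr_ge0 ?pot1_ge0// mulr_ge0 ?pot2_ge0.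
Qed.

(** * Likelihood ratio bounds and growth of the mean score gap *)

Lemma change_of_measure_le j m n A (a : R) : j != m -> Fn n A ->
  (forall w, A w -> a <= Sk n j w - Sk n m w) ->
  (P m A <= (expR (- a))%:E * P j A)%E.
Proof.
move=> jm FA H; rewrite (change_of_measure m j n A)//; last by rewrite eq_sym.
have mA : measurable A by exact: F_measurable FA.
rewrite -[A in (_ * P j A)%E]setIT -integral_indic// -ge0_integralZl//; first last.
  exact/measurable_EFinP.
apply: ge0_le_integral => //.
- by move=> w _; rewrite lee_fin mulr_ge0// expS_ge0.
- by apply/measurable_EFinP/measurable_funM => //; exact: measurable_expST.
- by apply: measurable_funeM; exact/measurable_EFinP.
move=> w _; rewrite -EFinM lee_fin mulrC indicE.
have [wA|] := boolP (w \in A); last by rewrite !mulr0.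
rewrite !mulr1 expS_tilt ler_expR -opprB lerN2.
by apply: H; move: wA; rewrite inE.
Qed.

(* With these exponents, [expS] is the exponential of [s] times the mean over
   j <> m of S_m - S_j. *)
Definition mean_weight (m : 'I_M) (s : R) (k : 'I_M) : R :=
  if k == m then s else - (s / (M.-1)%:R).

Lemma sum_other m (x : R) : \sum_(k < M | k != m) x = (M.-1)%:R * x.
Proof.
have -> : \sum_(k < M | k != m) x = \sum_(k in [set~ m]%SET) x.
  by apply: eq_bigl => k; rewrite !inE.
by rewrite sumr_const cardsC1 card_ord mulr_natl.
Qed.

Lemma expS_mean_weight_ge m s n w (b : R) : 0 <= s ->
  (forall j, j != m -> b <= Sk n m w - Sk n j w) ->
  expR (s * b) <= expS (mean_weight m s) n w.
Proof.
move=> s0 H; rewrite /expS ler_expR (bigD1 m)//= /mean_weight eqxx.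
have M1 := M1_gt0 R M M2.
have -> : s * Sk n m w = \sum_(j | j != m) s / (M.-1)%:R * Sk n m w.
  by rewrite sum_other; field; rewrite gt_eqF.
rewrite -big_split/=.
have -> : s * b = \sum_(j < M | j != m) s / (M.-1)%:R * b.
  by rewrite sum_other; field; rewrite gt_eqF.
apply: ler_sum => j jm; rewrite (negbTE jm) mulNr -mulrBr ler_wpM2l ?divr_ge0//.
exact: H.
Qed.

(** By 1 + x <= exp x, each observed cell contributes its weighted drift and an error at most C s^2;
    the drifts add up to [rate], and at most [M] cells are observed. *)
Lemma prod_mean_weight_le m (sel : {set 'I_M}) s : 0 < s <= e0 ->
  \prod_(k in sel) mgf_at m (mean_weight m s) k <=
  expR (s * rate m sel + M%:R * (C * s ^+ 2)).
Proof.
move=> /andP[s0 se]; have M1 := M1_gt0 R M M2.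
have Cs0 : 0 <= C * s ^+ 2 by rewrite mulr_ge0 ?sqr_ge0// ltW.
pose c k := s * (if k == m then Dgf else Dfg / (M.-1)%:R) + C * s ^+ 2.
apply: (@le_trans _ _ (\prod_(k in sel) expR (c k))).
  apply: ler_prod => k _; rewrite mgf_at_ge0 /=.
  have [->|km] := eqVneq k m.
    rewrite mgf_at_target /mean_weight /c eqxx.
    apply: le_trans (expR_ge1Dx _); rewrite addrA.
    by apply: mgf_g_le; rewrite gtr0_norm.
  rewrite mgf_at_other// /mean_weight /c (negbTE km).
  have q : s / (M.-1)%:R <= s.
    rewrite ler_pdivrMr// ler_peMr ?(ltW s0)// ler1n; case: M M2 => [|[]]//.
  have q0 : 0 < s / (M.-1)%:R by rewrite divr_gt0.
  apply: le_trans (expR_ge1Dx _).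
  have := mgf_f_le (- (s / (M.-1)%:R)); rewrite normrN gtr0_norm//.
  move=> /(_ (le_trans q se)) /le_trans; apply.
  rewrite mulNr opprK sqrrN -addrA lerD2l; apply: lerD.
    by rewrite mulrA mulrAC.
  by rewrite ler_pM2l// ler_sqr ?nnegrE// ltW.
rewrite -expR_sum ler_expR big_split/= -mulr_sumr; apply: lerD.
  rewrite ler_pM2l// /rate /share.
  have -> : \sum_(k in sel) (if k == m then Dgf else Dfg / (M.-1)%:R) =
     \sum_(k in sel :\ m) Dfg / (M.-1)%:R + (if m \in sel then Dgf else 0).
    have [msel|msel] := boolP (m \in sel).
      rewrite (bigD1 m)//= eqxx addrC; congr (_ + _); apply: eq_big => k.
        by rewrite !inE andbC.
      by move=> /andP[_ /negbTE ->].
    rewrite addr0; apply: eq_big => k; first by rewrite !inE; case: eqP => // ->; rewrite (negbTE msel).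
    by move=> ksel; case: eqP => // km; rewrite -km ksel in msel.
  by rewrite sumr_const lerD2r -[leLHS]mulr_natl mulrCA [leLHS]mulrC.
rewrite sumr_const -[leLHS]mulr_natl ler_wpM2r// ler_nat.
by rewrite (leq_trans (max_card _))// card_ord.
Qed.

Lemma mean_weight_growth m (I eps s : R) : 0 < s <= e0 -> M%:R * C * s <= eps ->
  (forall n w, rate m (phi n.+1 w) <= I) -> forall n,
    (\int[P m]_w (expS (mean_weight m s) n w)%:E <= (expR (s * (I + eps)) ^+ n)%:E)%E.
Proof.
move=> /andP[s0 se] sM rI.
have M1 := M1_gt0 R M M2.
have q : s / (M.-1)%:R <= s.
  rewrite ler_pdivrMr// ler_peMr ?(ltW s0)// ler1n; case: M M2 => [|[]]//.
have sk k : `|mean_weight m s k| <= e0.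
  rewrite /mean_weight; case: eqP => _; first by rewrite gtr0_norm.
  by rewrite normrN gtr0_norm ?divr_gt0// (le_trans q).
move=> n.
have := step_pair_decay m _ _ (expR (s * (I + eps))) 1 (step_pair_expS m _ sk) (expR_ge0 _) _ _ n.
rewrite mulr1; apply; last by move=> w; exact: expS0.
move=> k w; rewrite mulrC ler_wpM2r ?expS_ge0//.
apply: (le_trans (prod_mean_weight_le m _ s _)); first by rewrite s0.
rewrite ler_expR [leRHS]mulrDr; apply: lerD; first by rewrite ler_pM2l.
rewrite expr2 (_ : _ * (_ * _) = s * (M%:R * C * s)); last by ring.
by rewrite ler_pM2l.
Qed.

(* On A, either all S_m - S_j are at least b, which the first term pays for, or
   some S_m - S_j < b, and then the likelihood ratio of j to m exceeds exp (- b). *)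
Lemma stopped_correct_le m n A (s b : R) : 0 < s -> Fn n A ->
  (P m A <= (expR (- (s * b)))%:E * \int[P m]_w (expS (mean_weight m s) n w)%:E +
     (expR b)%:E * \sum_(j | j != m) P j A)%E.
Proof.
move=> s0 FA; have mA : measurable A by exact: F_measurable FA.
have -> : (\sum_(j | j != m) P j A = \sum_(j <- [seq j <- index_enum 'I_M | j != m])
     \int[P m]_w (\1_A w * expS (tilt j m) n w)%:E)%E.
  by rewrite big_filter; apply: eq_bigr => j jm; exact: change_of_measure.
have mW j : measurable_fun setT (fun w => (\1_A w * expS (tilt j m) n w)%:E).
  by apply/measurable_EFinP/measurable_funM => //; exact: measurable_expST.
have mE : measurable_fun setT (fun w => (expS (mean_weight m s) n w)%:E).
  by apply/measurable_EFinP; exact: measurable_expST.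
rewrite -ge0_integral_sum//; last by move=> j w _; rewrite lee_fin mulr_ge0// expS_ge0.
have mS : measurable_fun setT (fun w => \sum_(j <- [seq j <- index_enum 'I_M | j != m])
     (\1_A w * expS (tilt j m) n w)%:E)%E by exact: emeasurable_sum.
have S0 w : (0 <= \sum_(j <- [seq j <- index_enum 'I_M | j != m])
     (\1_A w * expS (tilt j m) n w)%:E)%E.
  by apply: sume_ge0 => j _; rewrite lee_fin mulr_ge0// expS_ge0.
rewrite -!ge0_integralZl ?lee_fin ?expR_ge0//; last first.
  by move=> w _; rewrite lee_fin expS_ge0.
rewrite -ge0_integralD//; first last.
- exact: measurable_funeM.
- by move=> w _; rewrite mule_ge0// lee_fin expR_ge0.
- exact: measurable_funeM.
- by move=> w _; rewrite mule_ge0// lee_fin expR_ge0.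
rewrite -[A in X in (X <= _)%E]setIT -integral_indic//.
apply: ge0_le_integral => //.
- exact/measurable_EFinP.
- by apply: emeasurable_funD; exact: measurable_funeM.
move=> w _; rewrite sumEFin -!EFinM -EFinD lee_fin indicE.
have E0 : 0 <= expR (- (s * b)) * expS (mean_weight m s) n w by rewrite mulr_ge0 ?expR_ge0.
have [wA|wA] := boolP (w \in A); last first.
  by rewrite addr_ge0// mulr_ge0 ?expR_ge0//; apply: sumr_ge0 => j _; rewrite mul0r.
rewrite big_filter; under eq_bigr do rewrite mul1r.
have [[j [jm jb]]|N] := pselect (exists j, j != m /\ Sk n m w - Sk n j w < b).
  rewrite (bigD1 j)//= mulrDr -[leLHS]add0r; apply: lerD => //.
  rewrite -[leLHS]addr0; apply: lerD.
    by rewrite expS_tilt -expRD -[leLHS]expR0 ler_expR; lra.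
  by rewrite mulr_ge0 ?expR_ge0//; apply: sumr_ge0 => k _; exact: expS_ge0.
rewrite -[leLHS]addr0; apply: lerD; last first.
  by rewrite mulr_ge0 ?expR_ge0//; apply: sumr_ge0 => k _; exact: expS_ge0.
have H := expS_mean_weight_ge m s n w b (ltW s0).
rewrite -[leLHS]expR0 (_ : 0 = - (s * b) + s * b); last by ring.
rewrite expRD ler_wpM2l ?expR_ge0//; apply: H => j jm; rewrite leNgt; apply/negP => jb.
by apply: N; exists j.
Qed.

(** * Stopping times and errors *)

Section Stopping.
Variables (tau : Omega -> \bar R) (delta : Omega -> 'I_M).
Hypothesis tauV : forall w, tau w = +oo%E \/ exists n : nat, tau w = (n.+1)%:R%:E.
Hypothesis tauF : forall n : nat, Fn n [set w | tau w = n%:R%:E].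
Hypothesis deltaF : forall (n : nat) j, Fn n [set w | tau w = n%:R%:E /\ delta w = j].

Definition stop_at n j := [set w | tau w = n%:R%:E /\ delta w = j].
Definition err m := [set w | (tau w < +oo)%E /\ delta w != m].

Lemma err_bigcup m : err m =
  \bigcup_n \bigcup_(j in [set j | j != m]) stop_at n j.
Proof.
apply/seteqP; split => w.
  move=> [tw dw]; case: (tauV w) => [E|[n E]]; first by rewrite E ltxx in tw.
  by exists n.+1 => //; exists (delta w).
by move=> [n _ [j /= jm [E dE]]]; rewrite /err /= E ltry dE.
Qed.

Lemma measurable_stop n j : measurable (stop_at n j).
Proof. by apply: (@F_measurable n); exact: deltaF. Qed.

Lemma measurable_err m : measurable (err m).
Proof.
rewrite err_bigcup; apply: bigcupT_measurable => n.
apply: fin_bigcup_measurable; first exact: finite_finset.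
by move=> j _; exact: measurable_stop.
Qed.

Lemma tau_ge0 w : (0 <= tau w)%E.
Proof. by case: (tauV w) => [->|[n ->]]; rewrite ?lee_fin. Qed.

Lemma measurable_tau : measurable_fun setT tau.
Proof.
move=> _ B mB; rewrite setTI.
have mn n : measurable [set w | tau w = n%:R%:E] by apply: (@F_measurable n); exact: tauF.
have -> : tau @^-1` B =
   (\bigcup_(n in [set n : nat | B n%:R%:E]) [set w | tau w = n%:R%:E]) `|`
   (if `[< B +oo%E >] then ~` \bigcup_n [set w | tau w = n%:R%:E] else set0).
  apply/seteqP; split => w /=.
    move=> Bw; case: (tauV w) => [E|[n E]].
      right; rewrite ifT; last by apply/asboolP; rewrite -E.
      by move=> [n _ /=]; rewrite E.
    by left; exists n.+1 => //=; rewrite -E.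
  move=> [[n /= Bn ->]//|]; case: ifPn => // /asboolP Boo N.
  case: (tauV w) => [->//|[n E]]; exfalso; apply: N.
  by exists n.+1.
apply: measurableU; first by apply: bigcup_measurable => n _; exact: mn.
case: ifP => // _; apply: measurableC; exact: bigcupT_measurable.
Qed.

(** Stops at different times are disjoint, so summing over the times costs no factor [N]. *)
Lemma sum_stop_le (m j : 'I_M) N : m != j ->
  (\sum_(n < N) P m (stop_at n j) <= P m (err m))%E.
Proof.
move=> mj.
have tI : trivIset setT (fun n => stop_at n j).
  apply/trivIsetP => i k _ _ ik; apply/seteqP; split => w //= [[Ei _] [Ek _]].
  by move: ik; rewrite Ek in Ei; case: Ei => /eqP; rewrite eqr_nat eq_sym => ->.
rewrite -(measure_bigsetU (P m) (F := fun n => stop_at n j))//; last by move=> n; exact: measurable_stop.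
apply: le_measure; rewrite ?inE.
- by apply: bigsetU_measurable => n _; exact: measurable_stop.
- exact: measurable_err.
rewrite err_bigcup -(bigcup_mkord N (fun n => stop_at n j)) => w [n _ H]; exists n => //; exists j => //=.
by rewrite eq_sym.
Qed.

Definition stop_by n0 := [set w | (tau w <= n0%:R%:E)%E].

Lemma measurable_stop_by n0 : measurable (stop_by n0).
Proof.
rewrite /stop_by -[X in measurable X]setTI; apply: emeasurable_fun_le => //.
exact: measurable_tau.
Qed.

(** Markov's inequality: off [stop_by n0] the stopping time, an integer or infinite, is at least
    n0.+1. *)
Lemma Etau_ge m n0 (q : R) : (P m (stop_by n0) <= q%:E)%E ->
  ((n0.+1%:R * (1 - q))%:E <= \int[P m]_w tau w)%E.
Proof.
move=> Hq; have mS := measurable_stop_by n0.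
apply: (@le_trans _ _ (\int[P m]_w (n0.+1%:R%:E * (\1_(~` stop_by n0) w)%:E))%E).
  rewrite ge0_integralZl//; last first.
    by apply/measurable_EFinP; apply: measurable_indic; exact: measurableC.
  rewrite integral_indic// ?setIT; last exact: measurableC.
  rewrite EFinM lee_wpmul2l ?lee_fin//.
  apply: (@le_trans _ _ (1 - P m (stop_by n0))%E); first by rewrite EFinB leeB.
  by rewrite le_eqVlt; apply/orP; left; apply/eqP/esym; exact: (probability_setC (P m) mS).
apply: ge0_le_integral => //.
- apply: measurable_funeM; apply/measurable_EFinP.
  by apply: measurable_indic; exact: measurableC.
- exact: measurable_tau.
move=> w _; rewrite indicE; have [|] := boolP (w \in ~` stop_by n0); last first.
  by rewrite mule0 tau_ge0.
rewrite inE /stop_by /= => H; rewrite mule1.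
case: (tauV w) => [->|[n E]]; first by rewrite leey.
rewrite E lee_fin ler_nat ltnNge; apply/negP => nn; apply: H.
by rewrite E lee_fin ler_nat.
Qed.

(** tau is at most n1 plus the number of n >= n1 with tau > n; each such n is counted by [X n], and
    the means form a geometric tail. *)
Lemma Etau_le m n1 (X : nat -> Omega -> R) (x r : R) :
  (forall n, measurable_fun setT (X n)) -> (forall n w, 0 <= X n w) ->
  (forall n w, (n1 <= n)%N -> ~ (tau w <= n%:R%:E)%E -> 1 <= X n w) ->
  0 < r < 1 -> 0 <= x ->
  (forall n, \int[P m]_w (X n w)%:E <= (x * r ^+ n)%:E)%E ->
  (\int[P m]_w tau w <= (n1%:R + x * r ^+ n1 / (1 - r))%:E)%E.
Proof.
move=> mX X0 XH /andP[r0 r1] x0 HX.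
pose Y' k w := (X (n1 + k)%N w)%:E.
have mY k : measurable_fun setT (Y' k) by exact/measurable_EFinP.
have Y0 k w : (0 <= Y' k w)%E by rewrite lee_fin.
apply: (@le_trans _ _ (\int[P m]_w (n1%:R%:E + \sum_(k <oo) Y' k w))%E).
  apply: ge0_le_integral => //.
  - by move=> w _; exact: tau_ge0.
  - exact: measurable_tau.
  - by apply: emeasurable_funD => //; apply: ge0_emeasurable_sum.
  move=> w _.
  have S0 : (0 <= \sum_(k <oo) Y' k w)%E by exact: nneseries_ge0.
  (* A finite [tau] is itself such an [N]; for an infinite one, all [N] together force the series to
     diverge. *)
  have key N : (N%:R%:E <= tau w)%E -> (N%:R%:E <= n1%:R%:E + \sum_(k <oo) Y' k w)%E.
    move=> HN; apply: (@le_trans _ _ (n1%:R%:E + \sum_(0 <= k < (N - n1)) Y' k w)%E); last first.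
      by rewrite leeD2l// nneseries_lim_ge.
    apply: (@le_trans _ _ (n1%:R%:E + \sum_(0 <= k < (N - n1)) 1)%E).
      rewrite big_mkord sumEFin -EFinD lee_fin sumr_const card_ord -natrD ler_nat.
      by rewrite -leq_subLR.
    rewrite leeD2l// big_mkord big_mkord; apply: lee_sum => k _.
    rewrite lee_fin; apply: XH; first exact: leq_addr.
    apply/negP; rewrite -ltNge; apply: lt_le_trans HN.
    rewrite lte_fin ltr_nat; have := ltn_ord k; rewrite ltn_subRL.
    by [].
  case: (tauV w) => [E|[n E]]; last by rewrite E key// E.
  rewrite E leye_eq; apply/eqP/eqyP => A A0.
  apply: (le_trans _ (key (Num.truncn A).+1 _)); last by rewrite E leey.
  by rewrite lee_fin ltW// truncnS_gt.
rewrite ge0_integralD//; last 2 first.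
- by move=> w _; exact: nneseries_ge0.
- by apply: ge0_emeasurable_sum.
rewrite integral_nneseries//.
rewrite (@integral_cst _ _ _ (P m) setT measurableT n1%:R%:E).
rewrite [X in (_ * X + _)%E](probability_setT (P m)) mule1 EFinD leeD2l//.
apply: lime_le; first by apply: is_cvg_nneseries => k _ _; exact: integral_ge0.
apply: nearW => N /=.
apply: (@le_trans _ _ (\sum_(0 <= k < N) (x * r ^+ (n1 + k))%:E)%E).
  by apply: lee_sum => k _; exact: HX.
rewrite sumEFin lee_fin.
have -> : \sum_(0 <= k < N) x * r ^+ (n1 + k) = x * r ^+ n1 * \sum_(0 <= k < N) r ^+ k.
  by rewrite mulr_sumr; apply: eq_bigr => k _; rewrite exprD mulrA.
rewrite ler_wpM2l ?mulr_ge0 ?exprn_ge0 ?(ltW r0)//.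
rewrite -[leRHS]mul1r ler_pdivlMr ?subr_gt0// big_mkord.
rewrite [leLHS](_ : _ = 1 - r ^+ N); last by rewrite -[RHS]opprB subrX1; ring.
by rewrite gerBl exprn_ge0// ltW.
Qed.

(** A stop by [n0] is an error or a stop with decision [m] at some n <= n0, bounded by
    [stopped_correct_le]. Under [j] these stops have total probability at most that of an error, so
    only the middle term carries a factor n0.+1. *)
Lemma stop_by_le m n0 (s b G : R) : 0 < s -> 0 <= G ->
  (forall n, (\int[P m]_w (expS (mean_weight m s) n w)%:E <= (expR (s * G) ^+ n)%:E)%E) ->
  (P m (stop_by n0) <= P m (err m) +
     (n0.+1%:R * expR (- (s * b) + s * G * n0%:R))%:E +
     (expR b)%:E * \sum_(j | j != m) P j (err j))%E.
Proof.
move=> s0 G0 HW.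
have mst n : measurable (stop_at n m) by exact: measurable_stop.
have mbig : measurable (\big[setU/set0]_(n < n0.+1) stop_at n m).
  by apply: bigsetU_measurable => n _.
have sub : stop_by n0 `<=` err m `|` \big[setU/set0]_(n < n0.+1) stop_at n m.
  move=> w; rewrite /stop_by /=; case: (tauV w) => [->//|[n E]].
  rewrite E lee_fin ler_nat => nn0; have [dm|dm] := eqVneq (delta w) m.
    by right; rewrite -(bigcup_mkord n0.+1 (fun n => stop_at n m)); exists n.+1.
  by left; rewrite /err /= E ltry.
apply: (@le_trans _ _ (P m (err m `|` \big[setU/set0]_(n < n0.+1) stop_at n m))).
  apply: le_measure; rewrite ?inE //; first exact: measurable_stop_by.
  by apply: measurableU => //; exact: measurable_err.
apply: (@le_trans _ _ (P m (err m) + \sum_(n < n0.+1) P m (stop_at n m))%E).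
  apply: (le_trans (measureU2 (P m) (measurable_err m) mbig)).
  by rewrite leeD2l// (Boole_inequality (P m) (A := fun n => stop_at n m)).
rewrite -addeA leeD2l//.
apply: (@le_trans _ _ (\sum_(n < n0.+1) ((expR (- (s * b) + s * G * n0%:R))%:E +
    (expR b)%:E * \sum_(j | j != m) P j (stop_at n m)))%E).
  apply: lee_sum => n _.
  apply: (le_trans (stopped_correct_le m n _ s b s0 (deltaF n m))).
  rewrite leeD2r//; apply: (@le_trans _ _ ((expR (- (s * b)))%:E * (expR (s * G) ^+ n)%:E)%E).
    by rewrite lee_wpmul2l ?lee_fin ?expR_ge0.
  rewrite -EFinM lee_fin -expRM_natr -expRD ler_expR lerD2l.
  by rewrite ler_wpM2l ?mulr_ge0 ?(ltW s0)// ler_nat -ltnS.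
rewrite big_split/= leeD//.
  by rewrite sumEFin lee_fin sumr_const card_ord mulr_natl.
rewrite -ge0_sume_distrr; last by move=> n _; exact: sume_ge0.
rewrite lee_wpmul2l ?lee_fin ?expR_ge0// exchange_big/=.
by apply: lee_sum => j jm; exact: sum_stop_le.
Qed.

(** For each wrong decision [j] the disjoint events [stop_at n j] have total probability at most 1
    under [P j], hence at most [c] under [P m]. *)
Lemma err_le m (c : R) : 0 <= c ->
  (forall j n, j != m -> (P m (stop_at n j) <= c%:E * P j (stop_at n j))%E) ->
  (P m (err m) <= (M%:R * c)%:E)%E.
Proof.
move=> c0 H.
have tI j : trivIset setT (fun n => stop_at n j).
  apply/trivIsetP => i k _ _ ik; apply/seteqP; split => w //= [[Ei _] [Ek _]].
  by move: ik; rewrite Ek in Ei; case: Ei => /eqP; rewrite eqr_nat eq_sym => ->.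
have mU j : measurable (\bigcup_n stop_at n j).
  by apply: bigcupT_measurable => n; exact: measurable_stop.
have Pj j : j != m -> (P m (\bigcup_n stop_at n j) <= c%:E)%E.
  move=> jm; rewrite (measure_semi_bigcup (P m))//; last by move=> n; exact: measurable_stop.
  apply: (@le_trans _ _ (\sum_(n <oo) c%:E * P j (stop_at n j))%E).
    by apply: lee_nneseries => // n _; exact: H.
  rewrite nneseriesZl; last by move=> n _; exact: measure_ge0.
  rewrite -(measure_semi_bigcup (P j))//; last by move=> n; exact: measurable_stop.
  rewrite -[leRHS]mule1 lee_wpmul2l ?lee_fin//.
  exact: (probability_le1 (P j)).
apply: (@le_trans _ _ (P m (\big[setU/set0]_(j <- [seq j <- index_enum 'I_M | j != m]) \bigcup_n stop_at n j))).
  apply: le_measure; rewrite ?inE.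
  - exact: measurable_err.
  - by rewrite big_filter; apply: bigsetU_measurable.
  rewrite err_bigcup => w [n _ [j /= jm H']].
  by rewrite big_filter (bigD1 j)//=; left; exists n.
apply: (@le_trans _ _ (\sum_(j <- [seq j <- index_enum 'I_M | j != m]) P m (\bigcup_n stop_at n j))%E).
  elim: [seq _ <- _ | _] => [|j r IH]; first by rewrite !big_nil measure0.
  rewrite !big_cons; apply: (le_trans (measureU2 (P m) (mU j) _)).
    by elim: r {IH} => [|i r IH]; rewrite ?big_nil ?big_cons//; exact: measurableU.
  by rewrite leeD2l.
rewrite big_filter.
apply: (@le_trans _ _ (\sum_(j < M | j != m) c%:E)%E); first exact: lee_sum.
rewrite sumEFin lee_fin; apply: sum_le_M => //.
Qed.

End Stopping.

End Selection.

(** * The optimal rate and the DGF selection *)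

Lemma IstarE K : (1 <= K <= M)%N -> let x := Dfg / (M.-1)%:R in
  Istar M K Dgf Dfg = if K == M then Dgf + (K.-1)%:R * x
    else Num.max (K%:R * x) (Dgf + (K.-1)%:R * x).
Proof.
move=> /andP[K1 KM]; rewrite /Istar; case: eqP => [->|_]; last by rewrite !mulrA.
by congr (_ + _); field; rewrite gt_eqF ?M1_gt0.
Qed.

Lemma rateE m (sel : {set 'I_M}) : let x := Dfg / (M.-1)%:R in
  rate m sel = if m \in sel then Dgf + (#|sel|.-1)%:R * x else #|sel|%:R * x.
Proof.
rewrite /= /rate share_card; case: (m \in sel); rewrite ?subn1 ?subn0 ?addr0.
  by rewrite addrC mulrAC mulrA.
by rewrite mulrAC mulrA.
Qed.

Lemma mem_card_full m (sel : {set 'I_M}) : #|sel| = M -> m \in sel.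
Proof.
move=> cS; have /eqP -> : sel == [set: 'I_M]%SET by rewrite eqEcard finset.subsetT cardsT card_ord cS leqnn.
by rewrite inE.
Qed.

(** Given its size, a selection affects [rate] only through whether it contains the target: these
    two cases are the two terms of the maximum, and for K = M the target is always observed. *)
Lemma rate_le_Istar m K (sel : {set 'I_M}) : (1 <= K <= M)%N -> #|sel| = K ->
  rate m sel <= Istar M K Dgf Dfg.
Proof.
move=> K1M cK; rewrite IstarE// rateE cK; case: eqP => [KM|_].
  by rewrite mem_card_full// cK.
by case: ifP; rewrite le_max lexx ?orbT.
Qed.

Lemma Istar_gt0 K : (1 <= K <= M)%N -> 0 < Istar M K Dgf Dfg.
Proof.
move=> K1M; have [M0 cM] : exists sel : {set 'I_M}, #|sel| = K.
  exists [set i : 'I_M | (i < K)%N]%SET; case/andP: K1M => _ KM.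
  rewrite -sum1dep_card (eq_bigl (fun i : 'I_M => (i < K)%N))//.
  by rewrite (big_ord_narrow KM) /= sum1_card card_ord.
have m : 'I_M by exists 0; exact: ltnW.
apply: lt_le_trans (rate_le_Istar m _ _ K1M cM).
apply: lt_le_trans rate_min_gt0 (rate_ge m M0 _).
by rewrite cM; case/andP: K1M.
Qed.

(** If the top K cells are observed, the target is among them, at the optimal rate, or ranks no
    higher than an observed cell. If the top cell [m1] is skipped, the optimal rate is the one
    without the target, reached when [m1] is the target; otherwise [m1] ranks at least as high as
    the target, and so do all observed cells when the target is unobserved, which gives
    [outranked2]. *)
Lemma selection_dgf_like m K (S : 'I_M -> R) (sel : {set 'I_M}) :
  (1 <= K <= M)%N -> #|sel| = K ->
  (if (Dgf >= Dfg / (M.-1)%:R) || (K == M) then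
     forall k k', k \in sel -> k' \notin sel -> S k' <= S k
   else exists m1, [/\ m1 \notin sel, (forall k, S k <= S m1) &
     (forall k k', k \in sel -> k' \notin sel -> k' != m1 -> S k' <= S k)]) ->
  dgf_like m (Istar M K Dgf Dfg) S sel.
Proof.
move=> K1M cK; have /andP[K1 KM] := K1M.
have [k ksel] : exists k, k \in sel by apply/set0Pn; rewrite -card_gt0 cK.
have KE : K%:R = (K.-1)%:R + 1 :> R by rewrite natr1 prednK.
case: ifPn => [cond dom|].
  have dom' : dominated m S sel by move=> i j isel jsel _ _; exact: dom.
  split; [by rewrite cK| |by left|by exists m; move=> _; split; [exists k|move=> i j *; exact: dom]].
  have [msel|msel] := boolP (m \in sel); last first.
    right; exists k; last exact: dom.
    by apply: contraNneq msel => <-.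
  left; split => //; rewrite IstarE// rateE cK msel; case: eqP => // KM'.
  move: cond => /orP[D|/eqP//]; apply/esym/max_idPr.
  by rewrite KE mulrDl mul1r addrC lerD2r.
rewrite negb_or -ltNge => /andP[D KM'] [m1 [m1sel m1top dom]].
have m1k : m1 != k by apply: contraNneq m1sel => ->.
split; [by rewrite cK| | |by exists m1; move=> _; split; [exists k|exact: dom]].
  have [mm1|mm1] := eqVneq m m1; last by right; exists m1; rewrite // eq_sym.
  left; split; first by move=> i j isel jsel _ jm; apply: dom => //; rewrite -mm1.
  rewrite IstarE// rateE cK mm1 (negbTE m1sel) (negbTE KM'); apply/esym/max_idPl.
  by rewrite KE mulrDl mul1r [leRHS]addrC lerD2r ltW.
have [mm1|mm1] := eqVneq m m1.
  by left; move=> i j isel jsel _ jm; apply: dom => //; rewrite -mm1.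
right; have [msel|msel] := boolP (m \in sel); [by left|right].
exists k, m1; split => //; first by apply: contraNneq msel => <-.
  by rewrite eq_sym.
exact: dom.
Qed.

(** * Risk bounds *)

Variables (K : nat) (pi : 'I_M -> R).
Hypothesis K1M : (1 <= K <= M)%N.
Hypotheses (pi0 : forall m, 0 < pi m) (pi1 : \sum_(m < M) pi m = 1).

Local Notation I := (Istar M K Dgf Dfg).

Lemma I_gt0 : 0 < I. Proof. exact: Istar_gt0. Qed.

(** The values being integers, an element at distance less than 1 from the infimum attains it. *)
Lemma ereal_inf_nat (A : set nat) (n : nat) :
  ereal_inf [set (k%:R : R)%:E | k in A] = n%:R%:E -> A n.
Proof.
move=> E.
have : (ereal_inf [set (k%:R : R)%:E | k in A] < n.+1%:R%:E)%E by rewrite E lte_fin ltr_nat.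
move=> /ereal_inf_lt[_ [k Ak <-]]; rewrite lte_fin ltr_nat ltnS => kn.
have : (ereal_inf [set (k%:R : R)%:E | k in A] <= k%:R%:E)%E.
  by apply: ereal_inf_lbound; exists k.
by rewrite E lee_fin ler_nat => nk; rewrite (@anti_leq n k) ?nk.
Qed.

Lemma other_cell (m : 'I_M) : exists j : 'I_M, j != m.
Proof.
have : (0 < #|[set~ m]%SET|)%N by rewrite cardsC1 card_ord; case: M M2 => [|[]].
by rewrite card_gt0 => /set0Pn[j]; rewrite !inE; exists j.
Qed.

(** * Upper bound for the DGF policy *)

Section DGF.
Variables (c : R) (p : policy R M Omega).
Hypothesis c01 : 0 < c < 1.
Hypothesis p_adm : admissible Z V K p.
Hypothesis p_dgf : is_DGF Z K Dgf Dfg f g c p.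

Local Notation phi := (pol_phi p).
Local Notation tau := (pol_tau p).
Local Notation S := (Sstat Z f g (pol_phi p)).

Lemma adm_card n w : #|phi n w| = K. Proof. by case: p_adm. Qed.
Lemma adm_phi n X : F Z V phi n [set w | phi n.+1 w = X].
Proof. by case: p_adm. Qed.
Lemma adm_tauV w : tau w = +oo%E \/ exists n : nat, tau w = (n.+1)%:R%:E.
Proof. by case: p_adm => _ _ H _ _; exact: H. Qed.
Lemma adm_tau n : F Z V phi n [set w | tau w = n%:R%:E].
Proof. by case: p_adm => _ _ _ H _; exact: H. Qed.
Lemma adm_delta n j : F Z V phi n [set w | tau w = n%:R%:E /\ pol_delta p w = j].
Proof. by case: p_adm => _ _ _ _ H; exact: H. Qed.

Lemma dgf_err m : (P m (err tau (pol_delta p) m) <= (M%:R * c)%:E)%E.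
Proof.
have /andP[c0 c1] := c01; have [_ tauE dtop] := p_dgf.
apply: (err_le phi adm_phi tau (pol_delta p) adm_tauV adm_delta); first exact: ltW.
move=> j n jm.
have -> : c = expR (- (- ln c)) by rewrite opprK lnK.
apply: (change_of_measure_le phi adm_phi); [exact: jm|exact: adm_delta|].
move=> w [tw dw].
have top := dtop w n tw; rewrite dw in top.
have [_ gap] : (1 <= n)%N /\ - ln c <= DeltaS Z f g phi n w.
  by apply: (@ereal_inf_nat [set n | (1 <= n)%N /\ - ln c <= DeltaS Z f g phi n w]); rewrite -tauE.
have := (gap_sort R _ (fun k => S n k w) j (- ln c) (other_cell j) top).1 gap.
by apply; rewrite eq_sym.
Qed.

(** By contraposition: a potential below c^s bounds every weight, so every gap S_m - S_j is at least
    - ln c and the policy has stopped by time n. *)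
Lemma dgf_continue m s n w : 0 < s -> (1 <= n)%N -> ~ (tau w <= n%:R%:E)%E ->
  1 <= expR (s * - ln c) * pot1 R M m (fun k => S n k w) s.
Proof.
have /andP[c0 c1] := c01; have [_ tauE _] := p_dgf.
move=> s0 n1 Nt; rewrite leNgt; apply/negP => lt1; apply: Nt.
have a0 : 0 < - ln c by rewrite oppr_gt0 ln_lt0.
have gap j : j != m -> - ln c <= S n m w - S n j w.
  move=> jm.
  have wle : wt R M m (fun k => S n k w) s j <= pot1 R M m (fun k => S n k w) s.
    by rewrite /pot1 (bigD1 j)//= lerDl; apply: sumr_ge0 => k _; exact: wt_ge0.
  have : expR (s * - ln c) * wt R M m (fun k => S n k w) s j < expR 0.
    by rewrite expR0; apply: le_lt_trans lt1; rewrite ler_wpM2l ?expR_ge0.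
  rewrite /wt -expRD ltr_expR -mulrDr pmulr_rlt0// => ?; lra.
have top k : S n k w <= S n m w.
  have [->//|km] := eqVneq k m; have := gap k km; lra.
rewrite tauE; apply: ereal_inf_lbound; exists n => //=; split => //.
exact: (gap_sort R _ (fun k => S n k w) m (- ln c) (other_cell m) top).2.
Qed.

Lemma dgf_stopping_time m (eps s B B0 : R) : 0 < eps < I ->
  0 < s <= e0 -> 0 <= B -> 0 <= B0 ->
  (forall S (sel : {set 'I_M}), dgf_like m I S sel ->
    pot1_next R M m S sel s (mgf_f s) (mgf_g (- s)) + B * crude_next m S sel B0 <=
    expR (- (s * (I - eps))) * (pot1 R M m S s + B * crude m S B0)) ->
  (\int[P m]_w tau w <= (- ln c / (I - eps) + 1 +
     pot_init m B B0 / (1 - expR (- (s * (I - eps)))))%:E)%E.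
Proof.
move=> /andP[eps0 epsI] ss B_ge0 B0_ge0 decay.
have /andP[c0 c1] := c01; have [sel_dgf _ _] := p_dgf.
have /andP[s0 se] := ss.
have a0 : 0 < - ln c by rewrite oppr_gt0 ln_lt0.
have G0 : 0 < I - eps by rewrite subr_gt0.
set a := - ln c in a0 *; set G := I - eps in G0 *.
pose r := expR (- (s * G)); pose u0 := pot_init m B B0.
have u0_ge0 : 0 <= u0 by exact: pot_init_ge0.
have r01 : 0 < r < 1 by rewrite expR_gt0 -[ltRHS]expR0 ltr_expR oppr_lt0 mulr_gt0.
(* By time [n1] the decay of the potential offsets the prefactor: exp (s a) r^n1 <= 1. *)
pose n1 := (Num.truncn (a / G)).+1.
have aG : 0 <= a / G by rewrite divr_ge0 ?ltW.
have n1_le : n1%:R <= a / G + 1 by rewrite /n1 -natr1 lerD2r truncn_le.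
have n1_ge : a / G <= n1%:R by rewrite ltW// truncnS_gt.
have like n w : dgf_like m I (fun k => S n k w) (phi n.+1 w).
  by apply: selection_dgf_like => //; [exact: adm_card|exact: sel_dgf].
have tail n := pot1_tail phi adm_phi m I eps s B B0 ss B_ge0 B0_ge0 decay like n.
have mpot n : measurable_fun setT (fun w => pot1 R M m (fun k => S n k w) s).
  have se' : `|s| <= e0 by rewrite gtr0_norm.
  by have [] := step_pair_pot1 phi adm_phi m s se' n.
have := Etau_le phi adm_phi tau adm_tauV adm_tau m n1
  (fun n w => expR (s * a) * pot1 R M m (fun k => S n k w) s) (expR (s * a) * u0) r.
move=> H; apply: (le_trans (H _ _ _ r01 _ _)).
- by move=> n; apply: measurable_funM.
- by move=> n w; rewrite mulr_ge0 ?expR_ge0 ?pot1_ge0.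
- by move=> n w nn1; apply: dgf_continue => //; exact: leq_trans nn1.
- by rewrite mulr_ge0 ?expR_ge0.
- move=> n; under eq_integral do rewrite EFinM.
  rewrite ge0_integralZl ?lee_fin ?expR_ge0//; last 2 first.
  - exact/measurable_EFinP.
  - by move=> w _; rewrite lee_fin pot1_ge0.
  by rewrite -mulrA EFinM lee_wpmul2l ?lee_fin ?expR_ge0//; exact: tail.
rewrite lee_fin -/u0 -/r; apply: lerD => //.
have /andP[r0 r1] := r01.
rewrite ler_pM2r ?invr_gt0 ?subr_gt0// mulrAC -[leRHS]mul1r ler_wpM2r//.
rewrite /r -expRM_natr -expRD -[leRHS]expR0 ler_expR.
rewrite mulNr -mulrA -mulrBr mulr_ge0_le0 ?(ltW s0)// subr_le0 mulrC.
by rewrite -ler_pdivrMr.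
Qed.

End DGF.

Lemma dgf_upper eps : 0 < eps < I -> exists2 B : R, 0 <= B &
  forall c p, 0 < c < 1 -> admissible Z V K p -> is_DGF Z K Dgf Dfg f g c p ->
  (bayes_risk P pi c p <= (c * (- ln c / (I - eps) + B))%:E)%E.
Proof.
move=> epsI; have /andP[eps0 _] := epsI.
have perm m : exists Bm : R, 0 <= Bm /\
    forall c p, 0 < c < 1 -> admissible Z V K p -> is_DGF Z K Dgf Dfg f g c p ->
    (risk_m P c p m <= (c * (- ln c / (I - eps) + Bm))%:E)%E.
  have [s [B [B0 [ss B_ge0 B0_ge0 decay]]]] := potential_decay m I eps I_gt0 eps0.
  (* [M] comes from the error probability, 1 from rounding the number of steps up, the quotient from
     the geometric tail. *)
  exists (M%:R + 1 + pot_init m B B0 / (1 - expR (- (s * (I - eps))))); split.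
    have /andP[s0 _] := ss; have /andP[_ eI] := epsI.
    rewrite addr_ge0// divr_ge0 ?pot_init_ge0// subr_ge0 -[leRHS]expR0 ler_expR.
    by rewrite oppr_le0 mulr_ge0 ?(ltW s0)// subr_ge0 ltW.
  move=> c p c01 adm dgf; have /andP[c0 c1] := c01.
  have H1 := dgf_err c p c01 adm dgf m.
  have H2 := dgf_stopping_time c p c01 adm dgf m eps s B B0 epsI ss B_ge0 B0_ge0 decay.
  apply: (@le_trans _ _ ((M%:R * c)%:E + c%:E * (- ln c / (I - eps) + 1 +
     pot_init m B B0 / (1 - expR (- (s * (I - eps)))))%:E)%E).
    by apply: leeD; [exact: H1|rewrite lee_wpmul2l ?lee_fin ?(ltW c0)].
  rewrite -EFinM -EFinD lee_fin le_eqVlt; apply/orP; left; apply/eqP.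
  by set X := pot_init _ _ _ / _; set Y' := - ln c / _; ring.
have [Bm HBm] := choice perm.
have Bm0 m : 0 <= Bm m by have [] := HBm m.
exists (\sum_m Bm m); first exact: sumr_ge0.
move=> c p c01 adm dgf; have /andP[c0 c1] := c01.
apply: (@le_trans _ _ (\sum_(m < M) (pi m * (c * (- ln c / (I - eps) + \sum_i Bm i)))%:E)%E).
  apply: lee_sum => m _; rewrite EFinM lee_wpmul2l ?lee_fin ?(ltW (pi0 m))//.
  have [_ H] := HBm m; apply: (le_trans (H c p c01 adm dgf)).
  rewrite lee_fin ler_wpM2l ?(ltW c0)// lerD2l (bigD1 m)//= lerDl.
  exact: sumr_ge0.
by rewrite sumEFin -mulr_suml pi1 mul1r.
Qed.

(** * Lower bound for an arbitrary admissible policy *)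

Lemma lower_tau p m (alpha eps s b : R) n0 : admissible Z V K p ->
  0 < s <= e0 -> M%:R * C * s <= eps -> 0 <= alpha ->
  (forall j, (P j (err (pol_tau p) (pol_delta p) j) <= alpha%:E)%E) ->
  ((n0.+1%:R * (1 - (alpha + n0.+1%:R * expR (- (s * b) + s * (I + eps) * n0%:R) +
       expR b * (M%:R * alpha))))%:E <= \int[P m]_w pol_tau p w)%E.
Proof.
move=> adm ss sM alpha0 Herr; have /andP[s0 _] := ss.
apply: (Etau_ge (pol_phi p) (adm_phi p adm) (pol_tau p) (adm_tauV p adm) (adm_tau p adm)).
have MC : 0 <= M%:R * C * s by rewrite !mulr_ge0 ?(ltW C0) ?(ltW s0).
have G0 : 0 <= I + eps by rewrite addr_ge0 ?(ltW I_gt0)// (le_trans MC).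
have HW : forall n, (\int[P m]_w (expS (pol_phi p) (mean_weight m s) n w)%:E <=
    (expR (s * (I + eps)) ^+ n)%:E)%E.
  apply: (mean_weight_growth (pol_phi p) (adm_phi p adm) m I eps s ss sM) => n w.
  by apply: rate_le_Istar => //; exact: (adm_card p adm).
apply: (le_trans (stop_by_le (pol_phi p) (adm_phi p adm) (pol_tau p) (pol_delta p)
  (adm_tauV p adm) (adm_tau p adm) (adm_delta p adm) m n0 s b (I + eps) s0 G0 HW)).
rewrite !EFinD; apply: leeD; first exact: leeD.
rewrite EFinM lee_wpmul2l ?lee_fin ?expR_ge0//.
apply: (@le_trans _ _ (\sum_(j < M | j != m) alpha%:E)%E); first exact: lee_sum.
by rewrite sumEFin lee_fin; exact: sum_le_M.
Qed.

Lemma bayes_lower eta : 0 < eta < 1 -> exists2 A0 : R, 0 < A0 &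
  forall c p, 0 < c < 1 -> A0 <= - ln c -> admissible Z V K p ->
  (((1 - eta) * (c * (- ln c / I)))%:E <= bayes_risk P pi c p)%E.
Proof.
move=> eta01; have /andP[eta0 eta1] := eta01.
have Ipos := I_gt0.
have M0 : 0 < M%:R :> R by rewrite ltr0n ltnW.
pose eps := I * (eta / 4).
have eps0 : 0 < eps by rewrite mulr_gt0// divr_gt0.
(* The exponent is so small that the mean gap grows at most at the rate I (1 + eta / 4) of
   [stop_mass_le]. *)
pose s := Num.min e0 (eps / (M%:R * C)).
have s0 : 0 < s by rewrite lt_min e00 divr_gt0// mulr_gt0.
have se : s <= e0 by rewrite ge_min lexx.
have sM : M%:R * C * s <= eps.
  by rewrite mulrC -ler_pdivlMr ?mulr_gt0// ge_min lexx orbT.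
(* 1 / (I pi_m) turns a risk of at most c a / I into a bound on the error under hypothesis m; the
   sum serves all hypotheses. *)
pose K1 := \sum_(m < M) (I * pi m)^-1.
have K1m m : (I * pi m)^-1 <= K1.
  rewrite /K1 (bigD1 m)//= lerDl; apply: sumr_ge0 => j _.
  by rewrite invr_ge0 mulr_ge0 ?ltW.
have K10 : 0 <= K1 by apply: sumr_ge0 => j _; rewrite invr_ge0 mulr_ge0 ?ltW.
have [A0 A00 HA] := stop_mass_le R I eta s K1 M%:R Ipos eta01 s0 K10 (ltW M0).
exists A0 => // c p c01 Aa adm; have /andP[c0 c1] := c01.
set a := - ln c in Aa *.
have a0 : 0 < a := lt_le_trans A00 Aa.
have cE : c = expR (- a) by rewrite opprK lnK.
(* A policy violating the bound has risk below c a / I, which makes all its error probabilities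
   small. *)
rewrite leNgt; apply/negP => lt_risk.
have tau0 m : (0 <= \int[P m]_w pol_tau p w)%E.
  by apply: integral_ge0 => w _; exact: (tau_ge0 _ (adm_tauV p adm)).
have err0 m : (0 <= P m (err (pol_tau p) (pol_delta p) m))%E by exact: measure_ge0.
have risk0 m : (0 <= (pi m)%:E * risk_m P c p m)%E.
  by rewrite mule_ge0 ?lee_fin ?(ltW (pi0 m))// adde_ge0 ?mule_ge0 ?lee_fin ?(ltW c0)//; exact: err0.
have risk_le m : ((pi m)%:E * risk_m P c p m <= bayes_risk P pi c p)%E.
  rewrite /bayes_risk (bigD1 m)//= leeDl//.
  by apply: sume_ge0 => j _; exact: risk0.
have Herr j : (P j (err (pol_tau p) (pol_delta p) j) <= (K1 * a * expR (- a))%:E)%E.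
  have merr := measurable_err (pol_phi p) (adm_phi p adm) (pol_tau p) (pol_delta p)
    (adm_tauV p adm) (adm_delta p adm) j.
  have H1 : ((pi j)%:E * P j (err (pol_tau p) (pol_delta p) j) <= (c * (a / I))%:E)%E.
    apply: (@le_trans _ _ ((pi j)%:E * risk_m P c p j)%E).
      rewrite lee_wpmul2l ?lee_fin ?(ltW (pi0 j))// /risk_m leeDl//.
      by rewrite mule_ge0 ?lee_fin ?(ltW c0).
    apply: (le_trans (risk_le j)); apply: (le_trans (ltW lt_risk)).
    rewrite lee_fin ler_piMl ?mulr_ge0 ?(ltW c0) ?(ltW a0) ?invr_ge0 ?(ltW Ipos)//.
    by rewrite gerBl ltW.
  move: H1; rewrite -(fineK (fin_num_measure (P j) _ merr)) -EFinM !lee_fin.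
  set x := fine _ => H1.
  have -> : K1 * a * expR (- a) = c * a * K1 by rewrite cE; ring.
  apply: (@le_trans _ _ (c * a * (I * pi j)^-1)); last first.
    by rewrite ler_wpM2l ?mulr_ge0 ?(ltW c0) ?(ltW a0).
  have := ler_wpM2l (ltW (_ : 0 < (pi j)^-1)) H1; rewrite invr_gt0 pi0 => /(_ isT).
  rewrite mulrA mulVf ?gt_eqF// mul1r => /le_trans; apply.
  by rewrite le_eqVlt; apply/orP; left; apply/eqP; field; rewrite !gt_eqF.
have Etau m : (((1 - eta) * (a / I))%:E <= \int[P m]_w pol_tau p w)%E.
  have ss : 0 < s <= e0 by rewrite s0.
  have alpha0 : 0 <= K1 * a * expR (- a) by rewrite !mulr_ge0 ?expR_ge0 ?(ltW a0).
  pose n0 := Num.truncn ((1 - 2 * (eta / 8)) * a / (I * (1 + eta / 4))).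
  have := lower_tau p m (K1 * a * expR (- a)) eps s ((1 - eta / 8) * a) n0 adm ss sM alpha0 Herr.
  apply: le_trans; rewrite lee_fin.
  have -> : I + eps = I * (1 + eta / 4) by rewrite /eps mulrDr mulr1.
  exact: HA.
move: lt_risk; apply/negP; rewrite -leNgt.
apply: (@le_trans _ _ (\sum_(m < M) (pi m * ((1 - eta) * (c * (a / I))))%:E)%E).
  by rewrite sumEFin -mulr_suml pi1 mul1r.
apply: lee_sum => m _; rewrite EFinM lee_wpmul2l ?lee_fin ?(ltW (pi0 m))//.
apply: (@le_trans _ _ (c%:E * \int[P m]_w pol_tau p w)%E); last first.
  by rewrite /risk_m leeDr//; exact: err0.
by rewrite mulrCA EFinM lee_wpmul2l ?lee_fin ?(ltW c0).
Qed.

Lemma dgf_upper_ratio eta : 0 < eta < 1 -> exists2 A0 : R, 0 < A0 &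
  forall c p, 0 < c < 1 -> A0 <= - ln c -> admissible Z V K p ->
  is_DGF Z K Dgf Dfg f g c p ->
  (bayes_risk P pi c p <= ((1 + eta) * (c * (- ln c / I)))%:E)%E.
Proof.
move=> /andP[eta0 eta1]; have Ipos := I_gt0.
have epsI : 0 < I * (eta / 4) < I.
  by rewrite mulr_gt0 ?divr_gt0//= gtr_pMr//; lra.
have [B B_ge0 HB] := dgf_upper _ epsI.
have BI : 0 <= 2 * B * I / eta by rewrite divr_ge0 ?(ltW eta0)// !mulr_ge0 ?(ltW Ipos).
exists (1 + 2 * B * I / eta); first lra.
move=> c p c01 Aa adm dgf; have /andP[c0 c1] := c01.
apply: (le_trans (HB c p c01 adm dgf)); rewrite lee_fin [leRHS]mulrCA ler_pM2l//.
by apply: inflated_time_le => //; lra.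
Qed.

End Observations.

(** * Passage to the limit in the cost *)

Theorem theorem1
  (R : realType) (M K : nat)
  (dY : measure_display) (Y : measurableType dY) (mu : {measure set Y -> \bar R})
  (f g : Y -> R)
  (dO : measure_display) (Omega : measurableType dO)
  (P : 'I_M -> probability Omega R)
  (dV : measure_display) (TV : measurableType dV) (Q : probability TV R)
  (Z : nat -> 'I_M -> Omega -> Y) (V : Omega -> TV)
  (pi : 'I_M -> R)
  (pol : R -> policy R M Omega) :
  (* cells and sensors *)
  (2 <= M)%N -> (1 <= K <= M)%N ->
  (* priors *)
  (forall m, 0 < pi m < 1) -> \sum_(m < M) pi m = 1 ->
  (* f and g are probability densities w.r.t. mu *)
  measurable_fun setT f -> measurable_fun setT g ->
  (forall y, 0 <= f y) -> (forall y, 0 <= g y) ->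
  (\int[mu]_y (f y)%:E = 1)%E -> (\int[mu]_y (g y)%:E = 1)%E ->
  (* 0 < D(g||f) < oo and 0 < D(f||g) < oo *)
  (0 < KL mu g f < +oo)%E -> (0 < KL mu f g < +oo)%E ->
  (* finite MGF of log(g/f) near 0 under f and under g *)
  (exists2 e : R, 0 < e & forall s : R, `|s| < e ->
     (\int[mu]_y (f y * expR (s * ln (g y / f y)))%:E < +oo)%E /\
     (\int[mu]_y (g y * expR (s * ln (g y / f y)))%:E < +oo)%E) ->
  (* the observation model: under H_m, V ~ Q (independent of m), the
     y_k(t) are distributed as g if k = m and f otherwise, and V and all
     y_k(t) are mutually independent *)
  (forall t k, measurable_fun setT (Z t k)) -> measurable_fun setT V ->
  (forall (m : 'I_M) (N : nat) (A : set TV) (B : nat -> 'I_M -> set Y),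
     measurable A -> (forall t k, measurable (B t k)) ->
     fine (P m (V @^-1` A `&` [set w | forall t k, (t < N)%N -> B t k (Z t k w)]))
     = fine (Q A) * \prod_(t < N) \prod_(k < M)
         fine (\int[mu]_(y in B t k) ((if k == m then g else f) y)%:E)%E) ->
  (* pol c is an admissible DGF policy with parameter c, for every c in (0,1) *)
  (forall c, 0 < c < 1 ->
     admissible Z V K (pol c) /\
     is_DGF Z K (fine (KL mu g f)) (fine (KL mu f g)) f g c (pol c)) ->
  let b := fun c : R => - c * ln c / Istar M K (fine (KL mu g f)) (fine (KL mu f g)) in
  [/\ (\forall c \near 0^'+, (bayes_risk P pi c (pol c) < +oo)%E),
      (fun c => fine (bayes_risk P pi c (pol c)) / b c) @ 0^'+ --> (1 : R),
      (\forall c \near 0^'+, (inf_risk Z V P pi K c < +oo)%E) &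
      (fun c => fine (inf_risk Z V P pi K c) / b c) @ 0^'+ --> (1 : R)].

Proof.
move=> M2 K1M pi01 pi1 mf mg f0 g0 f1 g1 Dg Df [e e0 mgf] mZ mV model polH b.
have pi0 m : 0 < pi m by have /andP[] := pi01 m.
have Dgf0 : 0 < fine (KL mu g f) by exact: fine_gt0.
have Dfg0 : 0 < fine (KL mu f g) by exact: fine_gt0.
set Dgf := fine (KL mu g f) in Dgf0 b *; set Dfg := fine (KL mu f g) in Dfg0 b *.
(* [KL] is infinite when absolute continuity fails, so finiteness of the two divergences gives both
   directions. *)
have gf : {ae mu, forall y, 0 < g y -> 0 < f y}.
  move: Dg; rewrite /KL; case: asboolP => // _; by rewrite ltxx andbF.
have fg : {ae mu, forall y, 0 < f y -> 0 < g y}.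
  move: Df; rewrite /KL; case: asboolP => // _; by rewrite ltxx andbF.
have DgfE : Dgf = fine (\int[mu]_y (g y * ln (g y / f y))%:E)%E.
  by rewrite /Dgf /KL asboolT.
have DfgE : Dfg = fine (\int[mu]_y (f y * ln (f y / g y))%:E)%E.
  by rewrite /Dfg /KL asboolT.
have mL := measurable_llr R dY Y f g mf mg f0 g0.
have mL' := measurable_llr R dY Y g f mg mf g0 f0.
have lnN y : ln (f y / g y) = - ln (g y / f y).
  by rewrite (llrE R dY Y g f g0 f0) (llrE R dY Y f g f0 g0) andbC; case: ifP; rewrite ?opprB ?oppr0.
have [C1 C10 H1] : exists2 C, 0 <= C & forall s, `|s| <= e / 4 ->
    (\int[mu]_y (g y * expR (s * ln (g y / f y)))%:E <= (1 + s * Dgf + C * s ^+ 2)%:E)%E.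
  rewrite DgfE; apply: (mgf_le_taylor2 R dY Y mu g (fun y => ln (g y / f y)) e) => //.
  by move=> s se; have [] := mgf s se.
(* The bound under [f] is proved for the log-ratio of [f] to [g], whose mean is [Dfg], and is then
   read at - s. *)
have [C2 C20 H2] : exists2 C, 0 <= C & forall s, `|s| <= e / 4 ->
    (\int[mu]_y (f y * expR (s * ln (f y / g y)))%:E <= (1 + s * Dfg + C * s ^+ 2)%:E)%E.
  rewrite DfgE; apply: (mgf_le_taylor2 R dY Y mu f (fun y => ln (f y / g y)) e) => //.
  move=> s se; have [] := mgf (- s); first by rewrite normrN.
  by under eq_integral do rewrite mulNr -mulrN -lnN.
pose C := C1 + C2 + 1.
have C0 : 0 < C by rewrite /C; lra.
have e40 : 0 < e / 4 by rewrite divr_gt0.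
have Hg s : `|s| <= e / 4 ->
    (\int[mu]_y (g y * expR (s * ln (g y / f y)))%:E <= (1 + s * Dgf + C * s ^+ 2)%:E)%E.
  move=> se; apply: (le_trans (H1 s se)).
  by rewrite lee_fin lerD2l ler_wpM2r ?sqr_ge0// /C; lra.
have Hf s : `|s| <= e / 4 ->
    (\int[mu]_y (f y * expR (s * ln (g y / f y)))%:E <= (1 - s * Dfg + C * s ^+ 2)%:E)%E.
  move=> se; have := H2 (- s); rewrite normrN => /(_ se).
  under eq_integral do rewrite lnN mulrNN.
  move=> /le_trans; apply.
  by rewrite lee_fin sqrrN mulNr lerD2l ler_wpM2r ?sqr_ge0// /C; lra.
(* [A0] is chosen before the policy [p], so the lower bound holds for the infimum too. *)
have bounds eta : 0 < eta < 1 -> exists2 A0 : R, 0 < A0 & forall c, 0 < c < 1 ->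
    A0 <= - ln c ->
    (forall p, admissible Z V K p -> (((1 - eta) * b c)%:E <= bayes_risk P pi c p)%E) /\
    (bayes_risk P pi c (pol c) <= ((1 + eta) * b c)%:E)%E.
  move=> eta01.
  have [A1 A10 HA1] := bayes_lower R M dY Y mu f g dO Omega P dV TV Q Z V mf mg f0 g0 f1 g1
    mZ mV model fg gf M2 Dgf Dfg C (e / 4) Dgf0 Dfg0 C0 e40 Hf Hg K pi K1M pi0 pi1 eta eta01.
  have [A2 A20 HA2] := dgf_upper_ratio R M dY Y mu f g dO Omega P dV TV Q Z V mf mg f0 g0 f1 g1
    mZ mV model fg gf M2 Dgf Dfg C (e / 4) Dgf0 Dfg0 C0 e40 Hf Hg K pi K1M pi0 pi1 eta eta01.
  exists (Num.max A1 A2); first by rewrite lt_max A10.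
  move=> c c01; rewrite ge_max => /andP[c1 c2].
  have bE : b c = c * (- ln c / Istar M K Dgf Dfg) by rewrite /b mulNr -mulrN -mulrA.
  rewrite bE; split => [p adm|]; first exact: HA1.
  by have [adm dgf] := polH c c01; exact: HA2.
have half01 : 0 < (2^-1 : R) < 1 by lra.
have small A0 : \forall c \near (0 : R)^'+, 0 < c < 1 /\ A0 <= - ln c.
  near=> c.
  have c0 : 0 < c by near: c; exact: nbhs_right_gt.
  have c1 : c < 1 by near: c; exact: nbhs_right_lt.
  have cA : c < expR (- A0) by near: c; apply: nbhs_right_lt; exact: expR_gt0.
  by rewrite c0 c1 lerNr -[leRHS]expRK ler_ln ?posrE ?expR_gt0// ltW.
have b0 c : 0 < c < 1 -> 0 < b c.
  move=> /andP[c0 c1]; rewrite /b divr_gt0//; last exact: Istar_gt0.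
  by rewrite mulNr -mulrN mulr_gt0// oppr_gt0 ln_lt0// c0.
have ratio (x : R -> \bar R) :
    (forall eta, 0 < eta < 1 -> exists2 A0 : R, 0 < A0 & forall c, 0 < c < 1 ->
      A0 <= - ln c -> (((1 - eta) * b c)%:E <= x c <= ((1 + eta) * b c)%:E)%E) ->
    (\forall c \near (0 : R)^'+, (x c < +oo)%E) /\
    (fun c => fine (x c) / b c) @ (0 : R)^'+ --> (1 : R).
  move=> H; split.
    have [A0 _ HA] := H _ half01.
    apply: filterS (small A0) => c [c01 cA].
    by have /andP[_ ub] := HA c c01 cA; exact: le_lt_trans ub (ltry _).
  apply/cvgrPdist_le => /= eps eps0.
  pose eta := Num.min eps 2^-1.
  have eta01 : 0 < eta < 1.
    by case/andP: half01 => h0 h1; rewrite lt_min eps0 gt_min h0 h1 orbT.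
  have [A0 _ HA] := H eta eta01.
  apply: filterS (small A0) => c [c01 cA].
  have bc := b0 c c01; have /andP[lb ub] := HA c c01 cA.
  have xfin : x c \is a fin_num.
    by rewrite fin_numE -ltNye -ltey (lt_le_trans _ lb) ?ltNyr// (le_lt_trans ub) ?ltry.
  move: lb ub; rewrite -(fineK xfin) !lee_fin /= => lb ub.
  apply: (@le_trans _ _ eta); last by rewrite ge_min lexx.
  rewrite ler_distlC; rewrite ler_pdivlMr// ler_pdivrMr//.
  by apply/andP.
have R1 : forall eta, 0 < eta < 1 -> exists2 A0 : R, 0 < A0 & forall c, 0 < c < 1 ->
      A0 <= - ln c ->
      (((1 - eta) * b c)%:E <= bayes_risk P pi c (pol c) <= ((1 + eta) * b c)%:E)%E.
  move=> eta eta01; have [A0 A00 HA] := bounds eta eta01; exists A0 => // c c01 cA.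
  have [lb ->] := HA c c01 cA; rewrite andbT; apply: lb.
  by have [] := polH c c01.
have R2 : forall eta, 0 < eta < 1 -> exists2 A0 : R, 0 < A0 & forall c, 0 < c < 1 ->
      A0 <= - ln c ->
      (((1 - eta) * b c)%:E <= inf_risk Z V P pi K c <= ((1 + eta) * b c)%:E)%E.
  move=> eta eta01; have [A0 A00 HA] := bounds eta eta01; exists A0 => // c c01 cA.
  have [lb ub] := HA c c01 cA; apply/andP; split.
    by apply: le_ereal_inf_tmp => _ [p adm <-]; exact: lb.
  apply: le_trans ub; apply: ereal_inf_lbound; exists (pol c) => //.
  by have [] := polH c c01.
by have [] := ratio _ R1; have [] := ratio _ R2; split.
Unshelve. all: by end_near.
Qed.
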